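(* Let $\mathbf{k}$ be a field of characteristic zero and let $A=\mathbf{\Lambda}(x_i)$ be the free graded commutative $\mathbf{k}$-algebra on generators $\{x_i\}$. If $d$ is an algebra differential on $A$, there is an isomorphism $$\widetilde{H}arr^{\,*}_{c.d.g.a.}(A;A;3)\approx H\big(\mathrm{Hom}^{*-1}_{\mathbf{k}}(\langle x_i\rangle,A),\mathrm{ad}(d)\big),$$ where $\langle x_i\rangle$ is the graded $\mathbf{k}$-module with basis $\{x_i\}$.
   Context: Conventions. Modules are non-negatively graded, $A$ is connected ($A^0\cong\mathbf{k}$), $\mu$ is the multiplication of $A$, $\mathrm{Hom}^p_{\mathbf{k}}$ is the space of $\mathbf{k}$-linear maps raising degree by $p$, and the Koszul sign rule for internal degree is used, e.g. $(f\otimes g)(x\otimes y)=(-1)^{|g||x|}f(x)\otimes g(y)$. An algebra differential is a derivation $d$ of degree $+1$ with $d^2=0$. A derivation of degree $p$ of $A$ is $\theta\in\mathrm{Hom}^p_{\mathbf{k}}(A,A)$ with $\theta\mu=\mu(\theta\otimes1+1\otimes\theta)$; the set of all of these is $\mathrm{Der}^p(A,A)$. On derivations, $\mathrm{ad}(d)(\theta)=d\circ\theta-(-1)^{|\theta|}\theta\circ d$. Restriction to generators identifies $\mathrm{Der}^p(A,A)$ with $\mathrm{Hom}^p_{\mathbf{k}}(\langle x_i\rangle,A)$, and $\mathrm{ad}(d)$ on $\mathrm{Hom}^{*}_{\mathbf{k}}(\langle x_i\rangle,A)$ is the differential transported along this identification. Harrison cochains. For $m\ge1$, $Ch^{p,m}(A;A)$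 is the space of $f\in\mathrm{Hom}^p_{\mathbf{k}}(A^{\otimes m},A)$ that are normalized ($f(a_1\otimes\cdots\otimes a_m)=0$ whenever some $|a_i|=0$) and that vanish on the image of $\sum_{\sigma}(-1)^{\sigma}\sigma$, the sum over all $(r,m-r)$-shuffles $\sigma\in S_m$, for each $r=1,\dots,m-1$; here $\sigma(x_1\otimes\cdots\otimes x_m)=\pm x_{\sigma^{-1}(1)}\otimes\cdots\otimes x_{\sigma^{-1}(m)}$ with Koszul sign, and $(-1)^\sigma$ is the sign of the permutation. For $f\in Ch^{p,m}(A;A)$ define $$d_B(f)=(-1)^pf\circ\Big(\sum_{i=0}^{m-1}1^{\otimes i}\otimes d\otimes1^{\otimes(m-1-i)}\Big)-d\circ f,$$ $$\partial_B(f)=\mu(1\otimes f)-f\circ\Big(\sum_{i=0}^{m-1}(-1)^i1^{\otimes i}\otimes\mu\otimes1^{\otimes(m-1-i)}\Big)+(-1)^{m+1}\mu(f\otimes1),$$ and $D_B=d_B-(-1)^p\partial_B$. Put $\widetilde{C}h^n(A;A;3)=\bigoplus_{0\le p\le n-1}Ch^{p,n-p}(A;A)$. Then $\widetilde{H}arr^{\,n}_{c.d.g.a.}(A;A;3)$, the restricted Harrison cohomology of $A$ with coefficients in itself truncated at degree $0$, is the $n$-th cohomology of $\{\widetilde{C}h^{*}(A;A;3),D_B\}$.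
   Formalization: Hom^{*-1} is taken only for *-1 ≥ 0 (zero term at *=0, so no boundaries from Hom^{-1} at *=1); with Hom^{-1} included the claim fails, e.g. A=Λ(x), |x|=1, d=0, where x↦1 gives a nonzero class at *=0 but the Harrison side vanishes. *)

(* Defs.v *)
From HB Require Import structures.
From mathcomp Require Import freeg.
From mathcomp Require Import all_boot all_order all_fingroup all_algebra.
From mathcomp Require Import generic_quotient ring_quotient.
From mathcomp Require Import boolp functions.

Set Implicit Arguments.
Unset Strict Implicit.
Unset Printing Implicit Defensive.

Import GRing.Theory.
Local Open Scope ring_scope.
Local Open Scope quotient_scope.

(* Non-negatively graded modules are internally graded: [hcomp n] is the      *)
(* projection of V = \bigoplus_n V^n onto V^n.                                *)
HB.mixin Record isGraded (k : fieldType) V of GRing.Lmodule k V := {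
  hcomp : nat -> V -> V;
  hcomp_linear : forall n, linear (hcomp n);
  hcomp_hcomp : forall m n v, hcomp m (hcomp n v) = if m == n then hcomp n v else 0;
  hcomp_fin : forall v, exists N, v == \sum_(n < N) hcomp n v
}.

#[short(type="gradedLmodType")]
HB.structure Definition GradedLmodule (k : fieldType) :=
  {V of GRing.Lmodule k V & isGraded k V}.

Definition homog (k : fieldType) (V : gradedLmodType k) (n : nat) (v : V) : Prop :=
  hcomp n v = v.

HB.mixin Record isGradedCommutative (k : fieldType) A
    of GRing.Algebra k A & isGraded k A := {
  homog1 : homog 0 (1 : A);
  homogM : forall m n (a b : A), homog m a -> homog n b -> homog (m + n)%N (a * b);
  gradedC : forall m n (a b : A), homog m a -> homog n b ->
    a * b = (-1) ^+ (m * n)%N *: (b * a)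
}.

#[short(type="gcAlgType")]
HB.structure Definition GradedCommAlgebra (k : fieldType) :=
  {A of GRing.Algebra k A & isGraded k A & isGradedCommutative k A}.

Section GradedModules.
Variable k : fieldType.

(* [tw p v] is the sum of the (-1)^(p * n) v_n: the Koszul sign acquired when *)
(* a map of degree p moves past v, extended from homogeneous v by linearity.  *)
Definition tw (V : gradedLmodType k) (p : nat) (v : V) : V :=
  \sum_(n < ex_minn (hcomp_fin v)) (-1) ^+ (p * n)%N *: hcomp n v.

Lemma tw_homog (V : gradedLmodType k) p n (v : V) :
  homog n v -> tw p v = (-1) ^+ (p * n)%N *: v.
Proof.
rewrite /tw => vn; case: ex_minnP => N /eqP vE _.
have hE m : hcomp m v = if m == n then v else 0.
  by rewrite -{1}vn hcomp_hcomp vn.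
have [ltnN|leNn] := ltnP n N.
  rewrite (bigD1 (Ordinal ltnN)) //= vn big1 ?addr0 // => i neq_i.
  by rewrite hE ifN ?scaler0.
have v0 : v = 0.
  by rewrite vE big1 // => i _; rewrite hE ltn_eqF // (leq_trans _ leNn).
rewrite v0 scaler0 big1 // => i _.
by rewrite -v0 hE; case: eqP; rewrite ?v0 scaler0.
Qed.

(* Hom^p(V, W)                                                                *)
Definition ghom (V W : gradedLmodType k) (p : nat) (f : V -> W) : Prop :=
  linear f /\ forall n v, homog n v -> homog (n + p)%N (f v).

Definition connected (A : gcAlgType k) : Prop :=
  forall a : A, homog 0 a <-> exists c : k, a = c%:A.

(* Universal property of A = Lambda(x_i), with |x_i| = deg i.                 *)
Definition free_on (I : Type) (deg : I -> nat) (A : gcAlgType k) (x : I -> A) : Prop :=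
  (forall i, homog (deg i) (x i)) /\
  forall (B : gcAlgType k) (y : I -> B), (forall i, homog (deg i) (y i)) ->
    exists phi : {lrmorphism A -> B},
      [/\ forall n a, homog n a -> homog n (phi a),
          forall i, phi (x i) = y i
        & forall psi : {lrmorphism A -> B},
            (forall n a, homog n a -> homog n (psi a)) ->
            (forall i, psi (x i) = y i) -> psi =1 phi].

Definition derivation (A : gcAlgType k) (p : nat) (theta : A -> A) : Prop :=
  ghom p theta /\ forall a b, theta (a * b) = theta a * b + tw p a * theta b.

Definition alg_differential (A : gcAlgType k) (d : A -> A) : Prop :=
  derivation 1 d /\ forall a, d (d a) = 0.

Definition ad (A : gcAlgType k) (d : A -> A) (p : nat) (theta : A -> A) : A -> A :=
  fun a => d (theta a) - (-1) ^+ p *: theta (d a).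

Lemma hcomp0 (V : gradedLmodType k) n : hcomp n (0 : V) = 0.
Proof.
have := hcomp_linear n (-1) (0 : V) 0.
by rewrite scaleN1r oppr0 addr0 scaleN1r addNr.
Qed.

Lemma homog0 (V : gradedLmodType k) n : homog n (0 : V).
Proof. exact: hcomp0. Qed.

Lemma homogP (V : gradedLmodType k) n c (u v : V) :
  homog n u -> homog n v -> homog n (c *: u + v).
Proof. by rewrite /homog hcomp_linear => -> ->. Qed.

Lemma ghom0 (V W : gradedLmodType k) p : ghom p (0 : V -> W).
Proof.
split=> [c u v|n v _]; last exact: homog0.
by change ((0 : W) = c *: 0 + 0); rewrite scaler0 addr0.
Qed.

Lemma ghomP (V W : gradedLmodType k) p c (f g : V -> W) :
  ghom p f -> ghom p g -> ghom p (c *: f + g).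
Proof.
have E v : (c *: f + g) v = c *: f v + g v by [].
move=> [f1 f2] [g1 g2]; split=> [e u v|n v nv]; rewrite !E.
  by rewrite f1 g1 !scalerDr !scalerA addrACA mulrC.
by apply: homogP; [exact: f2|exact: g2].
Qed.

Lemma derivation0 (A : gcAlgType k) p : derivation p (0 : A -> A).
Proof.
split=> [|a b]; first exact: ghom0.
by change ((0 : A) = 0 * b + tw p a * 0); rewrite mul0r mulr0 addr0.
Qed.

Lemma derivationP (A : gcAlgType k) p c (t s : A -> A) :
  derivation p t -> derivation p s -> derivation p (c *: t + s).
Proof.
have E v : (c *: t + s) v = c *: t v + s v by [].
move=> [t1 t2] [s1 s2]; split=> [|a b]; first exact: ghomP.
by rewrite !E t2 s2 mulrDl mulrDr -!scalerAl -scalerAr scalerDr addrACA.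
Qed.

End GradedModules.

(* A cochain complex whose terms C^n are subspaces of one ambient space V;    *)
(* [dif n u v] is the graph of the differential C^n -> C^(n+1), i.e. v = d u. *)
(* That d maps C^n to C^(n+1) and squares to zero is not part of the record:  *)
(* [cohomology] below is Z^n / (Z^n \cap B^n), where Z^n consists of the v in *)
(* C^n with d v = 0 and B^n = d C^(n-1) (zero for n = 0).                     *)
Record complex (k : fieldType) (V : lmodType k) := Complex {
  cochain : nat -> V -> Prop;
  dif : nat -> V -> V -> Prop;
  cochain0 : forall n, cochain n 0;
  cochainP : forall n c u v,
    cochain n u -> cochain n v -> cochain n (c *: u + v);
  dif0 : forall n, dif n 0 0;
  difP : forall n c u v u' v',
    dif n u u' -> dif n v v' -> dif n (c *: u + v) (c *: u' + v')
}.

Section Cohomology.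
Variables (k : fieldType) (V : lmodType k) (K : complex V) (n : nat).

Definition is_cocycle : {pred V} := fun v => `[< cochain K n v /\ dif K n v 0 >].

Lemma is_cocycle_submod : submod_closed is_cocycle.
Proof.
split=> [|c u v]; first by apply/asboolP; split; [exact: cochain0|exact: dif0].
move=> /asboolP[Cu du] /asboolP[Cv dv]; apply/asboolP; split; first exact: cochainP.
by rewrite -[0](addr0) -{1}[0](scaler0 _ c); exact: difP.
Qed.
HB.instance Definition _ :=
  GRing.isSubmodClosed.Build k V is_cocycle is_cocycle_submod.

Record cocycle := Cocycle { cocycle_val : V; _ : cocycle_val \in is_cocycle }.
HB.instance Definition _ := [isSub for cocycle_val].
HB.instance Definition _ := [Choice of cocycle by <:].
HB.instance Definition _ := [SubChoice_isSubLmodule of cocycle by <:].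

Definition is_coboundary : {pred cocycle} := fun z =>
  `[< if n is m.+1 then exists2 u, cochain K m u & dif K m u (val z) else val z = 0 >].

Lemma is_coboundary_submod : submod_closed is_coboundary.
Proof.
rewrite /is_coboundary; split=> [|c u v].
  apply/asboolP; rewrite raddf0; case: n => // m.
  by exists 0; [exact: cochain0|exact: dif0].
move=> /asboolP Bu /asboolP Bv; apply/asboolP.
have -> : val (c *: u + v) = c *: val u + val v by exact: linearP.
case: n Bu Bv => [u0 v0|m [u' Cu du] [v' Cv dv]].
  by rewrite u0 v0 scaler0 addr0.
by exists (c *: u' + v'); [exact: cochainP|exact: difP].
Qed.
HB.instance Definition _ :=
  GRing.isSubmodClosed.Build k cocycle is_coboundary is_coboundary_submod.

Definition cohomology : Type := {ideal_quot is_coboundary}.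
HB.instance Definition _ := GRing.Zmodule.on cohomology.

Definition coh_class (z : cocycle) : cohomology := \pi_{ideal_quot is_coboundary} z.

Lemma coh_class_surj h : exists z, h = coh_class z.
Proof. by exists (repr h); rewrite /coh_class reprK. Qed.

Lemma coh_classD : {morph coh_class : z w / z + w}.
Proof. exact: (raddfD \pi_{ideal_quot is_coboundary}). Qed.

Lemma coh_class_eq z w : (coh_class z == coh_class w) = (z - w \in is_coboundary).
Proof. by rewrite /coh_class -(Quotient.idealrBE is_coboundary). Qed.

Definition scaleq (c : k) (h : cohomology) : cohomology := coh_class (c *: repr h).

Lemma scaleq_class c z : scaleq c (coh_class z) = coh_class (c *: z).
Proof.
apply/eqP; rewrite coh_class_eq -scalerBr; set w := repr _ - z.
have Bw : w \in is_coboundary by rewrite -coh_class_eq /coh_class reprK.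
have [B0 Blin] := is_coboundary_submod.
by move: (Blin c _ 0 Bw B0); rewrite addr0.
Qed.

Fact scaleqA c e h : scaleq c (scaleq e h) = scaleq (c * e) h.
Proof. by have [z ->] := coh_class_surj h; rewrite !scaleq_class scalerA. Qed.
Fact scaleq1 : left_id 1 scaleq.
Proof. by move=> h; have [z ->] := coh_class_surj h; rewrite scaleq_class scale1r. Qed.
Fact scaleqDr : right_distributive scaleq +%R.
Proof.
move=> c h h'; have [z ->] := coh_class_surj h; have [w ->] := coh_class_surj h'.
by rewrite -coh_classD !scaleq_class scalerDr coh_classD.
Qed.
Fact scaleqDl h : {morph scaleq^~ h : c e / c + e}.
Proof.
move=> c e; have [z ->] := coh_class_surj h.
by rewrite !scaleq_class scalerDl coh_classD.
Qed.
HB.instance Definition _ :=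
  GRing.Zmodule_isLmodule.Build k cohomology scaleqA scaleq1 scaleqDr scaleqDl.

End Cohomology.

Section Harrison.
Variables (k : fieldType) (A : gcAlgType k).

(* Linear maps out of the m-fold tensor power of A are the multilinear        *)
(* functions of m arguments in A.                                             *)
Definition multi (m : nat) : Type := {ffun 'I_m -> A} -> A.

Definition upd m (a : {ffun 'I_m -> A}) (i : 'I_m) (b : A) : {ffun 'I_m -> A} :=
  [ffun j : 'I_m => if j == i then b else a j].

Definition multilinear m (f : multi m) : Prop :=
  forall a i, linear (fun b => f (upd a i b)).

Definition shuffle m (r : nat) (s : 'S_m) : bool :=
  [forall i : 'I_m, forall j : 'I_m,
    (i < j) && ((j < r) || (r <= i)) ==> (s i < s j)]%N.

(* Exponent of the Koszul sign of s acting on elements of degrees deg i.      *)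
Definition koszul m (deg : 'I_m -> nat) (s : 'S_m) : nat :=
  (\sum_(i < m) \sum_(j < m | (i < j) && (s j < s i)) deg i * deg j)%N.

(* Ch^{p,m}(A; A)                                                             *)
Definition Ch (p m : nat) (f : multi m) : Prop :=
  [/\ multilinear f,
      forall (deg : 'I_m -> nat) (a : {ffun 'I_m -> A}),
        (forall i, homog (deg i) (a i)) -> homog (\sum_(i < m) deg i + p)%N (f a),
      forall (a : {ffun 'I_m -> A}) i, homog 0 (a i) -> f a = 0
    & forall r, (0 < r < m)%N ->
        forall (deg : 'I_m -> nat) (a : {ffun 'I_m -> A}),
          (forall i, homog (deg i) (a i)) ->
          \sum_(s : 'S_m | shuffle r s)
             (-1) ^+ (s + koszul deg s)%N *: f [ffun i : 'I_m => a (s^-1%g i)] = 0].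

(* (1^i (x) d (x) 1^(m-1-i))(a), with the sign of moving d past a_0..a_(i-1). *)
Definition apply_at m (d : A -> A) (i : 'I_m) (a : {ffun 'I_m -> A}) :
    {ffun 'I_m -> A} :=
  [ffun j : 'I_m => if (j < i)%N then tw 1 (a j) else if j == i then d (a j) else a j].

Definition mul_at m (i : 'I_m) (a : {ffun 'I_m.+1 -> A}) : {ffun 'I_m -> A} :=
  [ffun j : 'I_m => if (j < i)%N then a (lift ord_max j)
             else if j == i then a (lift ord_max j) * a (lift ord0 j)
             else a (lift ord0 j)].

Definition d_B (d : A -> A) (p m : nat) (f : multi m) : multi m := fun a =>
  (-1) ^+ p *: (\sum_(i < m) f (apply_at d i a)) - d (f a).

Definition partial_B (p m : nat) (f : multi m) : multi m.+1 := fun a =>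
  tw p (a ord0) * f [ffun i : 'I_m => a (lift ord0 i)]
  - \sum_(i < m) (-1) ^+ i *: f (mul_at i a)
  + (-1) ^+ m.+1 *: (f [ffun i : 'I_m => a (lift ord_max i)] * a ord_max).

(* Families (f^{p,m}); the total complex in degree n is cut out by [Tot].     *)
Definition bicochain : Type := forall p m : nat, multi m.

Definition bc_zero : bicochain := fun _ _ _ => 0.
Definition bc_opp (f : bicochain) : bicochain := fun p m a => - f p m a.
Definition bc_add (f g : bicochain) : bicochain := fun p m a => f p m a + g p m a.
Definition bc_scale (c : k) (f : bicochain) : bicochain := fun p m a => c *: f p m a.

Lemma bicochainP (f g : bicochain) : (forall p m a, f p m a = g p m a) -> f = g.
Proof. by move=> fg; do 3 apply: functional_extensionality_dep => ?; exact: fg. Qed.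

Fact bc_addA : associative bc_add.
Proof. by move=> f g h; apply: bicochainP => *; exact: addrA. Qed.
Fact bc_addC : commutative bc_add.
Proof. by move=> f g; apply: bicochainP => *; exact: addrC. Qed.
Fact bc_add0 : left_id bc_zero bc_add.
Proof. by move=> f; apply: bicochainP => *; exact: add0r. Qed.
Fact bc_addN : left_inverse bc_zero bc_opp bc_add.
Proof. by move=> f; apply: bicochainP => *; exact: addNr. Qed.

HB.instance Definition _ := gen_eqMixin bicochain.
HB.instance Definition _ := gen_choiceMixin bicochain.
HB.instance Definition _ :=
  GRing.isZmodule.Build bicochain bc_addA bc_addC bc_add0 bc_addN.

Fact bc_scaleA c e f : bc_scale c (bc_scale e f) = bc_scale (c * e) f.
Proof. by apply: bicochainP => *; exact: scalerA. Qed.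
Fact bc_scale1 : left_id 1 bc_scale.
Proof. by move=> f; apply: bicochainP => *; exact: scale1r. Qed.
Fact bc_scaleDr : right_distributive bc_scale +%R.
Proof. by move=> c f g; apply: bicochainP => *; exact: scalerDr. Qed.
Fact bc_scaleDl f : {morph bc_scale^~ f : c e / c + e}.
Proof. by move=> c e; apply: bicochainP => *; exact: scalerDl. Qed.
HB.instance Definition _ :=
  GRing.Zmodule_isLmodule.Build k bicochain bc_scaleA bc_scale1 bc_scaleDr bc_scaleDl.

(* The sum over 0 <= p <= n - 1 of Ch^{p, n - p}(A; A).                       *)
Definition Tot (n : nat) (f : bicochain) : Prop :=
  forall p m, if ((0 < m) && (p + m == n))%N then Ch p (f p m) else f p m = 0.

(* The (p, m) component of D_B f; a component g of bidegree (p, m) has        *)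
(* D_B g = d_B g - (-1)^p partial_B g.                                        *)
Definition D_B (d : A -> A) (f : bicochain) : bicochain := fun p m =>
  (if p is p'.+1 then d_B d p' (f p' m) else 0)
  - (match m return multi m with
     | 0 => 0
     | m'.+1 => (-1) ^+ p *: partial_B p (f p m')
     end).

Lemma Ch0 p m : Ch p (0 : multi m).
Proof.
split=> [a i c u v|deg a _|a i _|r _ deg a _] /=.
- by rewrite scaler0 addr0.
- exact: homog0.
- by [].
- by rewrite big1 // => s _; exact: scaler0.
Qed.

Lemma ChP p m c (f g : multi m) : Ch p f -> Ch p g -> Ch p (c *: f + g).
Proof.
have fgE a : (c *: f + g) a = c *: f a + g a by [].
move=> [f1 f2 f3 f4] [g1 g2 g3 g4].
split=> [a i e u v|deg a ha|a i ha|r hr deg a ha]; rewrite ?fgE.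
- by rewrite f1 g1 !scalerDr !scalerA addrACA mulrC.
- by apply: homogP; [exact: f2|exact: g2].
- by rewrite (f3 _ _ ha) (g3 _ _ ha) scaler0 addr0.
- rewrite (eq_bigr (fun s : 'S_m =>
      c *: ((-1) ^+ (s + koszul deg s)%N *: f [ffun i : 'I_m => a (s^-1%g i)])
      + (-1) ^+ (s + koszul deg s)%N *: g [ffun i : 'I_m => a (s^-1%g i)])).
    by rewrite big_split -scaler_sumr /= (f4 _ hr _ _ ha) (g4 _ hr _ _ ha)
               scaler0 addr0.
  by move=> s _; rewrite fgE scalerDr !scalerA mulrC.
Qed.

Lemma d_BP (d : {linear A -> A}) p m c (f g : multi m) :
  d_B d p (c *: f + g) = c *: d_B d p f + d_B d p g.
Proof.
apply: funext => a; rewrite /d_B.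
have fgE b : (c *: f + g) b = c *: f b + g b by [].
under eq_bigr do rewrite fgE.
rewrite fgE linearP big_split /= -scaler_sumr scalerDr !scalerA.
have -> (u v : multi m) : (c *: u + v) a = c *: u a + v a by [].
by rewrite scalerBr !scalerA opprD addrACA [c * _]mulrC.
Qed.

Lemma partial_BP p m c (f g : multi m) :
  partial_B p (c *: f + g) = c *: partial_B p f + partial_B p g.
Proof.
apply: funext => a; rewrite /partial_B.
have fgE b : (c *: f + g) b = c *: f b + g b by [].
under eq_bigr do rewrite fgE scalerDr scalerA mulrC -scalerA.
have -> (u v : multi m.+1) : (c *: u + v) a = c *: u a + v a by [].
rewrite !fgE big_split /= -scaler_sumr mulrDr mulrDl -scalerAr -scalerAl.
rewrite !scalerDr scalerN !scalerA [c * _]mulrC opprD.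
by rewrite [RHS]addrACA; congr (_ + _); rewrite [RHS]addrACA.
Qed.

Lemma D_BP (d : {linear A -> A}) c (f g : bicochain) :
  D_B d (c *: f + g) = c *: D_B d f + D_B d g.
Proof.
apply: bicochainP => p m a.
have fgE (u v : bicochain) p' m' : (c *: u + v) p' m' = c *: u p' m' + v p' m' by [].
rewrite fgE /D_B.
have -> : (match p with p'.+1 => d_B d p' ((c *: f + g) p' m) | _ => 0 end) =
  c *: (match p with p'.+1 => d_B d p' (f p' m) | _ => 0 end)
  + (match p with p'.+1 => d_B d p' (g p' m) | _ => 0 end).
  by case: p => [|p]; [rewrite scaler0 addr0|rewrite fgE d_BP].
case: m a => [|m] a; first by rewrite !subr0.
rewrite fgE partial_BP scalerDr scalerA mulrC -scalerA opprD addrACA.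
by rewrite scalerBr.
Qed.

Lemma D_B0 (d : {linear A -> A}) : D_B d 0 = 0.
Proof. by have := D_BP d (-1) 0 0; rewrite scaleN1r oppr0 addr0 scaleN1r addNr. Qed.

Lemma Tot0 n : Tot n 0.
Proof. by move=> p m; case: ifP => // _; exact: Ch0. Qed.

Lemma TotP n c f g : Tot n f -> Tot n g -> Tot n (c *: f + g).
Proof.
move=> Tf Tg p m; move: (Tf p m) (Tg p m).
have -> : (c *: f + g) p m = c *: f p m + g p m by [].
by case: ifP => _; [exact: ChP|move=> -> ->; rewrite scaler0 addr0].
Qed.

Definition D_B_graph (d : A -> A) (n : nat) (f g : bicochain) : Prop := D_B d f = g.

Lemma D_B_graph0 (d : {linear A -> A}) n : D_B_graph d n 0 0.
Proof. exact: D_B0. Qed.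

Lemma D_B_graphP (d : {linear A -> A}) n c f g f' g' :
  D_B_graph d n f f' -> D_B_graph d n g g' ->
  D_B_graph d n (c *: f + g) (c *: f' + g').
Proof. by rewrite /D_B_graph => <- <-; exact: D_BP. Qed.

Definition harrison_complex (d : {linear A -> A}) : complex bicochain :=
  Complex Tot0 TotP (D_B_graph0 d) (@D_B_graphP d).

End Harrison.

Definition Harr (k : fieldType) (A : gcAlgType k) (d : {linear A -> A}) (n : nat) :=
  cohomology (harrison_complex d) n.

(* The free module <x_i>, graded by |x_i| = deg i.                            *)
Definition genmod (k : fieldType) (I : choiceType) (deg : I -> nat) : Type :=
  {freeg I / k}.

HB.instance Definition _ k I deg := GRing.Lmodule.on (@genmod k I deg).

Section GeneratorModule.
Variables (k : fieldType) (I : choiceType) (deg : I -> nat).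
Local Notation X := (genmod k deg).

Definition gen_hcomp (n : nat) (v : X) : X :=
  \sum_(i <- freeg.dom v | deg i == n) << coeff i v *g i >>.

Lemma coeff_gen_hcomp n v i : coeff i (gen_hcomp n v) = if deg i == n then coeff i v else 0.
Proof.
have -> : gen_hcomp n v = fgmap (fun i => deg i == n) id v by [].
by rewrite fgmap_f0_coeffE // mulrb.
Qed.

Fact gen_hcomp_linear n : linear (gen_hcomp n).
Proof.
move=> c u v; apply/eqP/freeg_eqP => i.
rewrite coeffD coeffZ !coeff_gen_hcomp coeffD coeffZ.
by case: ifP => // _; rewrite mulr0 addr0.
Qed.

Fact gen_hcomp_hcomp m n v :
  gen_hcomp m (gen_hcomp n v) = if m == n then gen_hcomp n v else 0.
Proof.
apply/eqP/freeg_eqP => i; rewrite (fun_if (coeff i)) !coeff_gen_hcomp coeff0.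
by case: (altP (m =P n)) => [<-|]; case: (altP (deg i =P m)) => // ->; case: ifP.
Qed.

Fact gen_hcomp_fin v : exists N, v == \sum_(n < N) gen_hcomp n v.
Proof.
have sumE N i : coeff i (\sum_(n < N) gen_hcomp n v) =
    \sum_(n < N) if deg i == n then coeff i v else 0.
  elim: N => [|N IH]; first by rewrite !big_ord0 coeff0.
  by rewrite !big_ord_recr coeffD IH coeff_gen_hcomp.
exists (\max_(i <- freeg.dom v) deg i).+1; apply/freeg_eqP => i; rewrite sumE.
have [iv|/coeff_outdom->] := boolP (i \in freeg.dom v); last first.
  by rewrite big1 // => n _; case: ifP.
have lt_i : (deg i < (\max_(i <- freeg.dom v) deg i).+1)%N by rewrite ltnS leq_bigmax_seq.
rewrite (bigD1 (Ordinal lt_i)) //= eqxx big1 ?addr0 // => n neq_n.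
by rewrite ifN // eq_sym.
Qed.

HB.instance Definition _ := isGraded.Build k X gen_hcomp_linear gen_hcomp_hcomp gen_hcomp_fin.

End GeneratorModule.

Section GeneratorComplex.
Variables (k : fieldType) (I : choiceType) (deg : I -> nat) (A : gcAlgType k).
Variables (x : I -> A) (d : {linear A -> A}).
Local Notation X := (genmod k deg).

(* Restriction to generators: composition with the linear map <x_i> -> A.     *)
Definition restrict (theta : A -> A) : X -> A := fun v => theta (fglift x v).

(* Graph of ad(d) : Hom^p(<x_i>, A) -> Hom^(p+1)(<x_i>, A), transported from  *)
(* Der(A, A) along restriction to generators.                                 *)
Definition ad_gen (p : nat) (h h' : X -> A) : Prop :=
  exists theta, [/\ derivation p theta, restrict theta = h & restrict (ad d p theta) = h'].

(* The complex Hom^(n-1)(<x_i>, A) in degree n, non-negatively graded as all  *)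
(* modules here: Hom^p occurs for p >= 0 only, so the term n = 0 is zero.     *)
Definition gen_cochain (n : nat) (h : X -> A) : Prop :=
  if n is p.+1 then ghom p h else h = 0.

Definition gen_dif (n : nat) (h h' : X -> A) : Prop :=
  if n is p.+1 then ad_gen p h h' else h = 0 /\ h' = 0.

Lemma gen_cochain0 n : gen_cochain n 0.
Proof. by case: n => // p; exact: ghom0. Qed.

Lemma gen_cochainP n c h h' :
  gen_cochain n h -> gen_cochain n h' -> gen_cochain n (c *: h + h').
Proof. by case: n => [->->|p]; [rewrite scaler0 addr0|exact: ghomP]. Qed.

Lemma ad0 p : ad d p 0 = 0.
Proof. by apply: funext => a; rewrite /ad linear0 scaler0 subr0. Qed.

Lemma adP p c (t s : A -> A) : ad d p (c *: t + s) = c *: ad d p t + ad d p s.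
Proof.
apply: funext => a; rewrite /ad.
have E (u v : A -> A) b : (c *: u + v) b = c *: u b + v b by [].
by rewrite !E linearP scalerDr scalerBr !scalerA [c * _]mulrC opprD addrACA.
Qed.

Lemma gen_dif0 n : gen_dif n 0 0.
Proof.
by case: n => // p; exists 0; split=> //; [exact: derivation0|rewrite ad0].
Qed.

Lemma gen_difP n c u v u' v' :
  gen_dif n u u' -> gen_dif n v v' -> gen_dif n (c *: u + v) (c *: u' + v').
Proof.
case: n => [[-> ->] [-> ->]|p [t [Dt <- <-]] [s [Ds <- <-]]].
  by rewrite scaler0 addr0.
by exists (c *: t + s); split=> //; [exact: derivationP|rewrite adP].
Qed.

Definition gen_complex : complex (X -> A) :=
  Complex gen_cochain0 gen_cochainP gen_dif0 gen_difP.

Definition H_gen (n : nat) := cohomology gen_complex n.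

End GeneratorComplex.

(* Main.v *)
From HB Require Import structures.
Require Import Defs.
From mathcomp Require Import freeg.
From mathcomp Require Import all_boot all_order all_fingroup all_algebra.
From mathcomp Require Import boolp functions finmap zify.

Set Implicit Arguments.
Unset Strict Implicit.
Unset Printing Implicit Defensive.

Import GRing.Theory.
Local Open Scope ring_scope.

(* For fixed p the rows of the Harrison bicomplex are exact in tensor degree >= 2,
   so the total complex is quasi-isomorphic to its part in tensor degree 1, where
   the cocycles of partial_B are the derivations.

   Exactness comes from an explicit homotopy.  Let d_x be the partial derivative
   along a generator x, and let h_x [a_1|...|a_m] be the signed sum over j <= i of
   the words obtained by inserting x in front of a_j and replacing a_i by d_x a_i.
   Then b h_x + h_x b is the action of the derivation x d_x, where b is the bar
   differential, and h_x is a derivation of the shuffle product, so f o h_x is a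
   Harrison cochain if f is.  For a Harrison cocycle f of tensor degree >= 2,
   partial_B (f o h_x) is x f(d_x -) - f(x d_x -): the remaining boundary term is a
   value of f on a shuffle with [x].  Summing over all x with weight |x| gives, by
   Euler's formula, minus the internal degree of the input times f, up to terms
   where f is evaluated in lower degree.  As generators have positive degree and
   the characteristic is zero, f can be killed one input degree at a time. *)

(** The weight |x| makes the sum of the operators |x| x d_x act on A as multiplication by the
    internal degree, the only grading that A comes with. Since the coefficients lie in A itself,
    outer letters of a word also act on values, and the homotopy is not exact: the term x f(d_x -)
    survives. It evaluates f at an input whose degree is smaller by |x| > 0, so the operator is
    triangular for the filtration by input degree, with the degree on the diagonal. Inverting it
    takes two infinite sums, over the generators and over the input degrees. Both are finite on each
    word, because a word involves finitely many generators and has bounded degree; hence convergence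
    is pointwise.

    A is known only through its universal property. The partial derivatives come from algebra maps
    into graded dual numbers, and the positivity of the degrees of the generators comes from
    connectedness.

    The truncation p >= 0 makes the passage to tensor degree 1 finite: in each total degree the
    components are cleared in order of increasing p. What remains of a cocycle is a derivation, on
    which D_B is ad(d) up to sign. *)

Section Abelian.
Variable M : zmodType.

(** Formal expressions for a decision procedure by reflection: an identity in an abelian group holds
    once the integer coefficients of all atoms agree. It takes over the sign bookkeeping of the
    homotopy identities. *)
Inductive abel_expr := Atom of nat | Zero | Plus of abel_expr & abel_expr | Opp of abel_expr.

Fixpoint abel_eval (s : seq M) t : M :=
  match t with
  | Atom i => s`_i
  | Zero => 0
  | Plus t1 t2 => abel_eval s t1 + abel_eval s t2
  | Opp t1 => - abel_eval s t1
  end.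

Fixpoint abel_coef t (i : nat) : int :=
  match t with
  | Atom j => (i == j)%:Z
  | Zero => 0
  | Plus t1 t2 => abel_coef t1 i + abel_coef t2 i
  | Opp t1 => - abel_coef t1 i
  end.

Lemma abel_evalE s t : abel_eval s t = \sum_(i < size s) s`_i *~ abel_coef t i.
Proof.
elim: t => [j||t1 IH1 t2 IH2|t IH] /=; rewrite ?IH ?IH1 ?IH2.
- have [lt|le] := ltnP j (size s).
    rewrite (bigD1 (Ordinal lt)) //= eqxx big1 ?addr0 // => i.
    by rewrite -val_eqE /= => /negPf ->.
  (* An index beyond the list reads the default 0 of [nth], in accordance with its absence from the
     sum. *)
  rewrite nth_default // big1 // => i _.
  by rewrite ltn_eqF // (leq_trans (ltn_ord i)).
- by rewrite big1.
- by rewrite -big_split; apply: eq_bigr => i _; rewrite mulrzDr.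
- by rewrite -sumrN; apply: eq_bigr => i _; rewrite mulrNz.
Qed.

Lemma abel_correct s t1 t2 :
  all (fun i => abel_coef t1 i == abel_coef t2 i) (iota 0 (size s)) ->
  abel_eval s t1 = abel_eval s t2.
Proof.
move=> /allP h; rewrite !abel_evalE; apply: eq_bigr => i _.
by rewrite (eqP (h i _)) // mem_iota /=.
Qed.

End Abelian.

(* atoms are compared up to conversion, since the same term may mention different
   paths of the algebraic hierarchy *)
Ltac abel_index x s :=
  match s with
  | ?y :: _ => let u := match goal with _ => unify x y end in constr:(0%N)
  | _ :: ?s' => let n := abel_index x s' in constr:(n.+1)
  end.

Ltac abel_atoms t s :=
  lazymatch t with
  | GRing.add ?a ?b => let s1 := abel_atoms a s in abel_atoms b s1
  | GRing.opp ?a => abel_atoms a s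
  | GRing.zero => s
  | _ => match s with
         | _ => let n := abel_index t s in s
         | _ => constr:(t :: s)
         end
  end.

Ltac abel_quote t s :=
  lazymatch t with
  | GRing.add ?a ?b => let u := abel_quote a s in let v := abel_quote b s in
                       constr:(Plus u v)
  | GRing.opp ?a => let u := abel_quote a s in constr:(Opp u)
  | GRing.zero => constr:(Zero)
  | _ => let n := abel_index t s in constr:(Atom n)
  end.

Ltac abel :=
  lazymatch goal with
  | |- @eq ?T ?l ?r =>
    let s0 := constr:(@nil T) in
    let s1 := abel_atoms l s0 in
    let s := abel_atoms r s1 in
    let tl := abel_quote l s in
    let tr := abel_quote r s in
    let H := fresh in
    assert (H : abel_eval s tl = abel_eval s tr)
      by (apply abel_correct; vm_compute; reflexivity);
    cbv beta iota delta [abel_eval nth] in H; exact H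
  end.

(** * Graded modules and algebras *)

Section Graded.
Variables (k : fieldType) (V : gradedLmodType k).
Implicit Types (u v : V).

HB.instance Definition _ n :=
  GRing.isLinear.Build k V V _ (@hcomp k V n) (@hcomp_linear k V n).

Lemma homog_hcomp n v : homog n (hcomp n v).
Proof. by rewrite /homog hcomp_hcomp eqxx. Qed.

Lemma hcomp_homog m n v : homog n v -> hcomp m v = if m == n then v else 0.
Proof. by rewrite /homog => hv; rewrite -hv hcomp_hcomp !hv. Qed.

Lemma homogD n u v : homog n u -> homog n v -> homog n (u + v).
Proof. by rewrite /homog linearD /= => -> ->. Qed.

Lemma homogZ n c v : homog n v -> homog n (c *: v).
Proof. by rewrite /homog linearZ /= => ->. Qed.

Lemma homogN n v : homog n v -> homog n (- v).
Proof. by rewrite /homog linearN /= => ->. Qed.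

Lemma homogB n u v : homog n u -> homog n v -> homog n (u - v).
Proof. by move=> ? ?; apply/homogD/homogN. Qed.

Lemma homog_sum (T : Type) (r : seq T) (P : pred T) n (f : T -> V) :
  (forall i, P i -> homog n (f i)) -> homog n (\sum_(i <- r | P i) f i).
Proof. by move=> h; apply: big_ind => //; [exact: homog0|exact: homogD]. Qed.

Lemma homog_ind (P : V -> Prop) :
  P 0 -> (forall u v, P u -> P v -> P (u + v)) ->
  (forall n v, homog n v -> P v) -> forall v, P v.
Proof.
move=> P0 PD Ph v; have [N /eqP ->] := hcomp_fin v.
by apply: big_ind => // i _; apply: (Ph i); exact: homog_hcomp.
Qed.

Lemma hcomp_inj u v : (forall n, hcomp n u = hcomp n v) -> u = v.
Proof.
move=> uv; apply/subr0_eq; have [N /eqP ->] := hcomp_fin (u - v).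
by rewrite big1 // => i _; rewrite linearB /= uv subrr.
Qed.

Lemma hcomp_bound v : exists N, forall n, (N <= n)%N -> hcomp n v = 0.
Proof.
have [N /eqP vN] := hcomp_fin v; exists N => n Nn; rewrite vN linear_sum big1 // => i _.
by rewrite /= hcomp_hcomp gtn_eqF // (leq_trans (ltn_ord i)).
Qed.

Lemma hcomp_sum N v : (forall n, (N <= n)%N -> hcomp n v = 0) -> v = \sum_(n < N) hcomp n v.
Proof.
move=> v0; apply: hcomp_inj => n; rewrite linear_sum.
under eq_bigr => i _ do rewrite /= hcomp_hcomp.
have [lt|le] := ltnP n N.
  rewrite (bigD1 (Ordinal lt)) //= eqxx big1 ?addr0 // => i.
  by rewrite -val_eqE /= eq_sym => /negPf ->.
by rewrite v0 // big1 // => i _; rewrite gtn_eqF // (leq_trans (ltn_ord i)).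
Qed.

(** This frees [tw] from the bound chosen in its definition; the facts on [tw] below follow by
    comparing components. *)
Lemma hcomp_tw p n v : hcomp n (tw p v) = (-1) ^+ (p * n)%N *: hcomp n v.
Proof.
rewrite /tw; case: ex_minnP => N /eqP vE _.
rewrite {2}vE !linear_sum; apply: eq_bigr => i _.
by rewrite linearZ /= hcomp_hcomp; case: eqP => [->|]; rewrite ?hcomp_hcomp ?eqxx ?scaler0.
Qed.

Fact tw_linear p : linear (tw p : V -> V).
Proof.
move=> c u v; apply: hcomp_inj => n; rewrite hcomp_tw !hcomp_linear !hcomp_tw.
by rewrite scalerDr !scalerA mulrC.
Qed.
HB.instance Definition _ p := GRing.isLinear.Build k V V _ (@tw k V p) (tw_linear p).

Lemma tw_tw p q v : tw p (tw q v) = tw (p + q) v.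
Proof. by apply: hcomp_inj => n; rewrite !hcomp_tw scalerA -exprD mulnDl. Qed.

Lemma tw_odd p v : tw p v = tw (odd p) v.
Proof.
apply: hcomp_inj => n; rewrite !hcomp_tw; congr (_ *: _).
by rewrite -signr_odd -[RHS]signr_odd !oddM oddb.
Qed.

Lemma tw0 v : tw 0 v = v.
Proof. by apply: hcomp_inj => n; rewrite hcomp_tw mul0n scale1r. Qed.

Lemma twK p v : tw p (tw p v) = v.
Proof. by rewrite tw_tw addnn tw_odd odd_double tw0. Qed.

Lemma homog_tw p n v : homog n v -> homog n (tw p v).
Proof. by move=> hv; rewrite (tw_homog _ hv); exact: homogZ. Qed.

End Graded.

Lemma linear_homog_ext (k : fieldType) (V : gradedLmodType k) (M : lmodType k)
    (f g : V -> M) : linear f -> linear g ->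
  (forall n v, homog n v -> f v = g v) -> f =1 g.
Proof.
move=> lf lg fg; apply: homog_ind fg => [|u v fgu fgv].
  have z (h : V -> M) : linear h -> h 0 = 0.
    by move=> lh; have := lh (-1) 0 0; rewrite scaler0 addr0 scaleN1r addNr.
  by rewrite !z.
by have := (lf 1 u v, lg 1 u v); rewrite !scale1r fgu fgv => -[-> ->].
Qed.

Section GradedAlg.
Variables (k : fieldType) (A : gcAlgType k).
Implicit Types (a b : A).

Lemma homog_mul m n a b : homog m a -> homog n b -> homog (m + n)%N (a * b).
Proof. exact: homogM. Qed.

Lemma homog_comm m n a b : homog m a -> homog n b ->
  a * b = (-1) ^+ (m * n)%N *: (b * a).
Proof. exact: gradedC. Qed.

Lemma tw1 p : tw p (1 : A) = 1.
Proof. by rewrite (tw_homog _ (@homog1 k A)) muln0 scale1r. Qed.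

Lemma twM p a b : tw p (a * b) = tw p a * tw p b.
Proof.
move: a; apply: homog_ind => [|u v hu hv|m a ha]; rewrite ?linear0 ?mul0r ?linear0 //.
  by rewrite mulrDl !linearD /= mulrDl hu hv.
move: b; apply: homog_ind => [|u v hu hv|n b hb]; rewrite ?linear0 ?mulr0 ?linear0 //.
  by rewrite mulrDr !linearD /= mulrDr hu hv.
rewrite (tw_homog _ (homog_mul ha hb)) (tw_homog _ ha) (tw_homog _ hb).
by rewrite -scalerAl -scalerAr scalerA -exprD mulnDr.
Qed.

(** Only one factor has to be homogeneous, as [tw] absorbs the sign. Commutativity enters the
    homotopy in this form. *)
Lemma homogC m a b : homog m a -> a * tw m b = b * a.
Proof.
move=> ha; move: b; apply: homog_ind => [|u v hu hv|n b hb]; rewrite ?linear0 ?mulr0 ?mul0r //.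
  by rewrite linearD /= mulrDr mulrDl hu hv.
rewrite (tw_homog _ hb) -scalerAr (homog_comm ha hb) scalerA -exprD addnn.
by rewrite -signr_odd odd_double scale1r.
Qed.

Lemma hcompM_lt m n x a : homog m x -> (n < m)%N -> hcomp n (x * a) = 0.
Proof.
move=> hx lt; move: a; apply: homog_ind => [|u v hu hv|q a ha].
- by rewrite mulr0 linear0.
- by rewrite mulrDr linearD /= hu hv addr0.
by rewrite (hcomp_homog _ (homog_mul hx ha)) ltn_eqF // ltn_addr.
Qed.

Lemma hcompM m n x a : homog m x -> hcomp (m + n) (x * a) = x * hcomp n a.
Proof.
move=> hx; move: a; apply: homog_ind => [|u v hu hv|q a ha].
- by rewrite mulr0 !linear0 mulr0.
- by rewrite mulrDr !linearD /= hu hv mulrDr.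
rewrite (hcomp_homog _ (homog_mul hx ha)) (hcomp_homog _ ha) eqn_add2l.
by case: eqP; rewrite ?mulr0.
Qed.

Lemma tw_ghom p q (f : A -> A) : ghom p f ->
  forall a, tw q (f a) = (-1) ^+ (q * p)%N *: f (tw q a).
Proof.
move=> [fl fh]; apply: linear_homog_ext => [c a b|c a b|n v hv].
- by rewrite fl linearP.
- by rewrite linearP fl scalerDr !scalerA mulrC.
have fZ c a : f (c *: a) = c *: f a.
  have f0 : f 0 = 0 by have := fl (-1) 0 0; rewrite scaler0 addr0 scaleN1r addNr.
  by rewrite -[c *: a]addr0 fl f0 addr0.
rewrite (tw_homog _ (fh _ _ hv)) (tw_homog _ hv) fZ scalerA -exprD.
by rewrite mulnDr addnC.
Qed.

End GradedAlg.

(** * Operators on words *)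

(* A cochain is a function on words of arbitrary length; operators are defined by
   peeling off the first letter, which fcons moves into the cochain. *)
Definition fcons (T M : Type) (a : T) (F : seq T -> M) : seq T -> M := fun u => F (a :: u).

Section Words.
Variables (k : fieldType) (A : algType k) (M : lmodType k).
Implicit Types (F G : seq A -> M) (a b c : A) (u v w : seq A).

(** Fixing the prefix [u] turns multilinearity on words of all lengths into a statement that is
    proved by induction on [u]. *)
Definition lin_at u F := forall v, linear (fun a => F (u ++ a :: v)).

Definition mlin F := forall u, lin_at u F.

Lemma lin_at_lin u e F G : lin_at u F -> lin_at u G -> lin_at u (e *: F + G).
Proof.
move=> uF uG v c a b; have E w : (e *: F + G) w = e *: F w + G w by [].
by rewrite !E uF uG !scalerDr !scalerA addrACA mulrC.
Qed.

Lemma lin_at_add u F G : lin_at u F -> lin_at u G -> lin_at u (F + G).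
Proof. by rewrite -[F in F + G]scale1r; exact: lin_at_lin. Qed.

Lemma lin_at_sub u F G : lin_at u F -> lin_at u G -> lin_at u (F - G).
Proof. by rewrite addrC -scaleN1r => ? ?; exact: lin_at_lin. Qed.

Lemma mlin_fcons a F : mlin F -> mlin (fcons a F).
Proof. by move=> mF u v; exact: (mF (a :: u) v). Qed.

Lemma mlin_fconsP F e a b : mlin F -> fcons (e *: a + b) F = e *: fcons a F + fcons b F.
Proof. by move=> mF; apply: funext => u; exact: (mF [::] u). Qed.

Lemma mlin_fcons0 F : mlin F -> fcons 0 F = 0.
Proof.
move=> mF; have := mlin_fconsP (-1) 0 0 mF.
by rewrite scaler0 addr0 scaleN1r addNr.
Qed.

Lemma mlin_head0 F u : mlin F -> F (0 :: u) = 0.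
Proof. by move=> /mlin_fcons0 /(congr1 (@^~ u)). Qed.

Lemma mlin_fconsD F a b : mlin F -> fcons (a + b) F = fcons a F + fcons b F.
Proof. by move=> mF; rewrite -[a]scale1r mlin_fconsP // !scale1r. Qed.

Lemma mlinD F a b u : mlin F -> F (a + b :: u) = F (a :: u) + F (b :: u).
Proof. by move=> /(mlin_fconsD a b)/(congr1 (@^~ u)). Qed.

Lemma mlin_fconsZ F e a : mlin F -> fcons (e *: a) F = e *: fcons a F.
Proof. by move=> mF; rewrite -[e *: a]addr0 mlin_fconsP // mlin_fcons0 // addr0. Qed.

Lemma mlin_fconsN F a : mlin F -> fcons (- a) F = - fcons a F.
Proof. by move=> mF; rewrite -scaleN1r mlin_fconsZ // scaleN1r. Qed.

Lemma mlin_lin e F G : mlin F -> mlin G -> mlin (e *: F + G).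
Proof.
by move=> mF mG u; exact: lin_at_lin.
Qed.

Lemma mlin0 : mlin 0.
Proof. by move=> u v c a b; rewrite /= scaler0 addr0. Qed.

Section Derivation.
Variables (t : {linear A -> A}) (D : {linear A -> A}) (x : A).

Definition lam a F : seq A -> M := fun u => if u is c :: v then F (a * c :: v) else 0.

(** Transpose of the bar differential, without end terms. [lam a F] merges [a] with the letter that
    follows and is 0 when there is none. *)
Fixpoint bar_op F u : M := if u is a :: v then lam a F v - bar_op (fcons a F) v else 0.

(* t is the Koszul sign D picks up when passing a letter *)
Fixpoint der_op F u : M := if u is a :: v then F (D a :: v) + der_op (fcons (t a) F) v else 0.

(** The letters in front of the inserted [x] contribute only the sign of the bar degree: [x] and [D]
    have opposite internal degrees, so the twist [t] is needed only on the letters between them. *)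
Fixpoint htpy_op F u : M := if u is a :: v then der_op (fcons x F) u - htpy_op (fcons a F) v else 0.

Lemma der_op_cons F a u : der_op F (a :: u) = F (D a :: u) + der_op (fcons (t a) F) u.
Proof. by []. Qed.
Lemma bar_op_cons F a u : bar_op F (a :: u) = lam a F u - bar_op (fcons a F) u.
Proof. by []. Qed.
Lemma htpy_op_cons F a u : htpy_op F (a :: u) = der_op (fcons x F) (a :: u) - htpy_op (fcons a F) u.
Proof. by []. Qed.

Lemma lamP e a F G : lam a (e *: F + G) = e *: lam a F + lam a G.
Proof. by apply: funext => -[|c v] /=; rewrite ?fctE ?scaler0 ?addr0. Qed.

Fact bar_op_linear : linear bar_op.
Proof.
move=> e F G; apply: funext => u; elim: u F G => [|a v IH] F G.
  by rewrite !fctE scaler0 addr0.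
rewrite ![in RHS]fctE /= lamP (_ : fcons a _ = e *: fcons a F + fcons a G) // IH !fctE.
by rewrite scalerBr opprD addrACA.
Qed.
HB.instance Definition _ := GRing.isLinear.Build k _ _ _ bar_op bar_op_linear.

Lemma bar_opD F G : bar_op (F + G) = bar_op F + bar_op G. Proof. exact: linearD. Qed.
Lemma bar_opN F : bar_op (- F) = - bar_op F. Proof. exact: linearN. Qed.
Lemma bar_opB F G : bar_op (F - G) = bar_op F - bar_op G. Proof. exact: linearB. Qed.
Lemma bar_opZ e F : bar_op (e *: F) = e *: bar_op F. Proof. exact: linearZ. Qed.

Fact der_op_linear : linear der_op.
Proof.
move=> e F G; apply: funext => u; elim: u F G => [|a v IH] F G.
  by rewrite !fctE scaler0 addr0.
rewrite ![in RHS]fctE /= (_ : fcons (t a) _ = e *: fcons (t a) F + fcons (t a) G) // IH !fctE.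
by rewrite scalerDr addrACA.
Qed.
HB.instance Definition _ := GRing.isLinear.Build k _ _ _ der_op der_op_linear.

Lemma der_op0 u : der_op 0 u = 0. Proof. exact: (congr1 (@^~ u) (linear0 der_op)). Qed.
Lemma der_opD F G : der_op (F + G) = der_op F + der_op G. Proof. exact: linearD. Qed.
Lemma der_opN F : der_op (- F) = - der_op F. Proof. exact: linearN. Qed.
Lemma der_opB F G : der_op (F - G) = der_op F - der_op G. Proof. exact: linearB. Qed.
Lemma der_opZ e F : der_op (e *: F) = e *: der_op F. Proof. exact: linearZ. Qed.

Fact htpy_op_linear : linear htpy_op.
Proof.
move=> e F G; apply: funext => u; elim: u F G => [|a v IH] F G.
  by rewrite !fctE scaler0 addr0.
rewrite ![in RHS]fctE /htpy_op -/htpy_op (_ : fcons a _ = e *: fcons a F + fcons a G) // IH.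
rewrite (_ : fcons x _ = e *: fcons x F + fcons x G) // der_op_linear !fctE.
by rewrite scalerBr opprD addrACA.
Qed.
HB.instance Definition _ := GRing.isLinear.Build k _ _ _ htpy_op htpy_op_linear.

Lemma htpy_op0 u : htpy_op 0 u = 0. Proof. exact: (congr1 (@^~ u) (linear0 htpy_op)). Qed.
Lemma htpy_opD F G : htpy_op (F + G) = htpy_op F + htpy_op G. Proof. exact: linearD. Qed.
Lemma htpy_opN F : htpy_op (- F) = - htpy_op F. Proof. exact: linearN. Qed.
Lemma htpy_opB F G : htpy_op (F - G) = htpy_op F - htpy_op G. Proof. exact: linearB. Qed.

Lemma fcons_bar_op a F : fcons a (bar_op F) = lam a F - bar_op (fcons a F).
Proof. by []. Qed.

Lemma fcons_der_op a F : fcons a (der_op F) = fcons (D a) F + der_op (fcons (t a) F).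
Proof. by []. Qed.

Lemma fcons_htpy_op a F : fcons a (htpy_op F) = fcons (D a) (fcons x F) +
  der_op (fcons (t a) (fcons x F)) - htpy_op (fcons a F).
Proof. by []. Qed.

Lemma der_op_ext F G u : (forall w, size w = size u -> F w = G w) -> der_op F u = der_op G u.
Proof.
elim: u F G => //= a v IH F G FG; rewrite FG //; congr (_ + _).
by apply: IH => w sw; rewrite /fcons FG //= sw.
Qed.

Lemma htpy_op_ext F G u :
  (forall w, size w = (size u).+1 -> F w = G w) -> htpy_op F u = htpy_op G u.
Proof.
elim: u F G => // a v IH F G FG; rewrite /htpy_op -/htpy_op; congr (_ - _).
  by apply: der_op_ext => w sw; rewrite /fcons FG //= sw.
by apply: IH => w sw; rewrite /fcons FG //= sw.
Qed.

Lemma bar_op_ext F G u :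
  (forall w, (size w).+1 = size u -> F w = G w) -> bar_op F u = bar_op G u.
Proof.
elim: u F G => //= a v IH F G FG; congr (_ - _).
  by case: v {IH} FG => //= b v FG; exact: FG.
by apply: IH => w sw; apply: FG; rewrite /= sw.
Qed.

Lemma mlin_der_op F : mlin F -> mlin (der_op F).
Proof.
move=> mF u; elim: u F mF => [|b u IH] F mF v.
  move=> e a c /=; rewrite (linearP t) (linearP D) mlin_fconsP // der_op_linear !fctE.
  by rewrite (mF [::] v) scalerDr addrACA.
apply: (lin_at_add (mlin_fcons (D b) mF u)).
by apply/IH/mlin_fcons.
Qed.

Lemma mlin_htpy_op F : mlin F -> mlin (htpy_op F).
Proof.
move=> mF; have mG := mlin_der_op (mlin_fcons x mF).
move=> u; elim: u F mF {mG} (mG) => [|b u IH] F mF mG v.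
  move=> e a c; rewrite ![[::] ++ _]/= !htpy_op_cons mlin_fconsP // htpy_op_linear !fctE.
  have /= -> := mG [::] v e a c.
  by rewrite scalerBr; abel.
apply: (lin_at_sub (mlin_fcons b mG u)).
by apply/IH; [exact: mlin_fcons|exact/mlin_der_op/mlin_fcons/mlin_fcons].
Qed.

Hypothesis tM : {morph t : a b / a * b}.
Hypothesis DM : forall a b, D (a * b) = D a * b + t a * D b.

Lemma fcons_lam a b F : fcons b (lam a F) = fcons (a * b) F.
Proof. by []. Qed.

(** The Leibniz rule matches [D] of a merged letter with the two terms in which [D] hits one of the
    letters before the merger. *)
Lemma der_op_bar_op F : mlin F -> der_op (bar_op F) = bar_op (der_op F).
Proof.
move=> mF; apply: funext => u; elim: u F mF => [|a [|c u] IH] F mF //.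
  by rewrite /= !subr0 addr0.
transitivity (fcons (D a) (bar_op F) (c :: u) + der_op (fcons (t a) (bar_op F)) (c :: u)) => //.
rewrite !fcons_bar_op der_opB !fctE IH; last exact: mlin_fcons.
rewrite [der_op (lam _ _) _]/= fcons_lam -tM.
transitivity (der_op F (a * c :: u) - bar_op (fcons a (der_op F)) (c :: u)); last by [].
rewrite fcons_der_op bar_opD !fctE [der_op F _]/= DM.
rewrite mlinD // /lam /fcons. by abel.
Qed.

End Derivation.

Section Homotopy.
Variables (t D E : {linear A -> A}) (x : A).
Hypothesis tM : {morph t : a b / a * b}.
Hypothesis DM : forall a b, D (a * b) = D a * b + t a * D b.
Hypothesis xC : forall a, x * t a = a * x.
Hypothesis EE : forall a, E a = x * D a.

(** Merging [x] with the letter after it cancels against merging the letter before it in the next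
    insertion position, by [x * t a = a * x]. What survives is [x] standing directly in front of the
    letter hit by [D], which merges to [x * D a = E a]. *)
Lemma htpy_op_bar_op F : mlin F -> htpy_op t D x (bar_op F) + bar_op (htpy_op t D x F) =
  der_op idfun E F.
Proof.
move=> mF; apply: funext => u; elim: u F mF => [|a u IH] F mF; first exact: addr0.
rewrite fctE der_op_cons -IH; last exact: mlin_fcons.
rewrite htpy_op_cons bar_op_cons fcons_bar_op der_opB fcons_bar_op htpy_opB !fctE der_op_bar_op //;
  last exact: mlin_fcons.
rewrite fcons_htpy_op bar_opB bar_opD !fctE bar_op_cons fcons_der_op bar_opD !fctE.
case: u {IH} => [|c u]; first by rewrite /= /fcons /= EE; abel.
have bc G a' : lam a' G (c :: u) = G (a' * c :: u) by [].
rewrite !bc der_op_cons fcons_lam [lam _ _ _]/= htpy_op_cons htpy_op_cons fcons_lam.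
rewrite ?fcons_lam ?xC [htpy_op t D x F (a * c :: u)]htpy_op_cons -EE; abel.
Qed.

End Homotopy.
End Words.

(** * End terms of the Hochschild coboundary and the homotopy formula *)

Section EndTerms.
Variables (k : fieldType) (A : algType k).
Implicit Types (F G : seq A -> A) (a b c : A) (u v w : seq A).

Definition mull b F : seq A -> A := fun u => b * F u.

Lemma der_op_mull (t D : {linear A -> A}) b F : der_op t D (mull b F) = mull b (der_op t D F).
Proof.
apply: funext => u; rewrite /mull; elim: u F => [|a u IH] F; first by rewrite mulr0.
by rewrite !der_op_cons mulrDr -IH.
Qed.

Lemma htpy_op_mull (t D : {linear A -> A}) x b F : htpy_op t D x (mull b F) = mull b (htpy_op t D x F).
Proof.
apply: funext => u; rewrite /mull; elim: u F => [|a u IH] F; first by rewrite mulr0.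
rewrite !htpy_op_cons mulrBr -IH; congr (_ - _).
by rewrite -[RHS]/(mull b (der_op t D (fcons x F)) _) -der_op_mull.
Qed.

Lemma bar_op_mull b F : bar_op (mull b F) = mull b (bar_op F).
Proof.
apply: funext => u; rewrite /mull; elim: u F => [|a u IH] F; first by rewrite mulr0.
rewrite !bar_op_cons mulrBr -IH; congr (_ - _).
by case: u {IH} => [|c u]; rewrite /= ?mulr0.
Qed.

Section Left.
Variable s : {linear A -> A}.

Definition left_op F u : A := if u is a :: v then s a * F v else 0.

Lemma left_op_cons F a u : left_op F (a :: u) = s a * F u. Proof. by []. Qed.

Lemma fcons_left_op a F : fcons a (left_op F) = mull (s a) F. Proof. by []. Qed.

Fact left_op_linear : linear left_op.
Proof.
move=> e F G; apply: funext => -[|a u]; rewrite !fctE /= ?scaler0 ?addr0 //.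
by rewrite mulrDr scalerAr.
Qed.
HB.instance Definition _ := GRing.isLinear.Build k _ _ _ left_op left_op_linear.

Lemma left_opB F G : left_op (F - G) = left_op F - left_op G. Proof. exact: linearB. Qed.
Lemma left_opD F G : left_op (F + G) = left_op F + left_op G. Proof. exact: linearD. Qed.

Lemma mlin_mull b F : mlin F -> mlin (mull b F).
Proof. by move=> mF u v e a c; rewrite /mull mF mulrDr scalerAr. Qed.

(** If [x] is inserted in front of the whole word, it becomes the outer factor itself; in every
    other insertion the first letter stays outside. *)
Lemma htpy_op_left_op (t D : {linear A -> A}) x F :
  htpy_op t D x (left_op F) = mull (s x) (der_op t D F) - left_op (htpy_op t D x F).
Proof.
apply: funext => -[|a u]; rewrite !fctE; first by rewrite /mull /= mulr0 subr0.
by rewrite htpy_op_cons !fcons_left_op der_op_mull htpy_op_mull.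
Qed.

Hypothesis sM : {morph s : a b / a * b}.

Lemma bar_op_left_op F : bar_op (left_op F) = left_op (left_op F) - left_op (bar_op F).
Proof.
apply: funext => -[|a [|c u]]; rewrite !fctE ?subr0 //=; first by rewrite !mulr0 !subr0.
rewrite fcons_left_op -/(bar_op _ (c :: u)) bar_op_cons -[X in _ - X]bar_op_cons bar_op_mull /mull.
by rewrite sM mulrA.
Qed.

End Left.

(** Each letter contributes a factor -1, so that the sign $(-1)^{m+1}$ of the last end term is
    produced without reference to the length. *)
Fixpoint right_op F u : A :=
  if u is a :: v then if v is [::] then - (F [::] * a) else - right_op (fcons a F) v else 0.

Lemma right_op_cons F a b u : right_op F (a :: b :: u) =
  - right_op (fcons a F) (b :: u). Proof. by []. Qed.

Fact right_op_linear : linear right_op.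
Proof.
move=> e F G; apply: funext => u; rewrite !fctE.
elim: u F G => [|a [|c u] IH] F G; first by rewrite scaler0 addr0.
  by rewrite /= mulrDl -scalerAl opprD -scalerN.
rewrite !right_op_cons (_ : fcons a _ = e *: fcons a F + fcons a G) // IH.
by rewrite opprD -scalerN.
Qed.
HB.instance Definition _ := GRing.isLinear.Build k _ _ _ right_op right_op_linear.

Lemma right_opB F G : right_op (F - G) = right_op F - right_op G. Proof. exact: linearB. Qed.
Lemma right_opD F G : right_op (F + G) = right_op F + right_op G. Proof. exact: linearD. Qed.
Lemma right_opZ e F : right_op (e *: F) = e *: right_op F. Proof. exact: linearZ. Qed.
Lemma right_opN F : right_op (- F) = - right_op F. Proof. exact: linearN. Qed.

Lemma right_op_ext F G u : (forall w, (size w).+1 = size u -> F w = G w) -> right_op F u = right_op G u.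
Proof.
elim: u F G => // a [|c u] IH F G FG; first by rewrite /= FG.
by rewrite !right_op_cons; congr (- _); apply: IH => w sw; apply: FG; rewrite /= sw.
Qed.

Lemma right_op_mull b F : right_op (mull b F) = mull b (right_op F).
Proof.
apply: funext => u; rewrite /mull; elim: u F => [|a [|c u] IH] F; first by rewrite mulr0.
  by rewrite /= mulrN mulrA.
by rewrite !right_op_cons mulrN -IH.
Qed.

Lemma right_op_left_op (s : {linear A -> A}) F : right_op (left_op s F) = - left_op s (right_op F).
Proof.
apply: funext => -[|a [|c u]]; rewrite !fctE ?oppr0 //; first by rewrite /left_op /= mul0r mulr0.
by rewrite right_op_cons fcons_left_op right_op_mull.
Qed.

Lemma bar_op_right_op F : bar_op (right_op F) + right_op (bar_op F) = right_op (right_op F).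
Proof.
apply: funext => u; elim: u F => [|a [|c [|e u]] IH] F; rewrite !fctE.
- by rewrite /= addr0.
- by rewrite /= subr0 mul0r oppr0 addr0.
- by rewrite /= /fcons /= !subr0 mul0r !oppr0 addr0 mulNr opprK mulrA.
rewrite bar_op_cons [right_op (bar_op F) _]right_op_cons fcons_bar_op right_opB.
(* [right_op] commutes with [fcons a] up to sign except at the empty word, which is not evaluated
   here. *)
rewrite (bar_op_ext (F := fcons a (right_op F)) (G := - right_op (fcons a F))); last by case.
rewrite bar_opN right_op_cons.
rewrite (right_op_ext (F := fcons a (right_op F)) (G := - right_op (fcons a F))); last by case.
rewrite right_opN !fctE -IH !fctE.
have -> : lam a (right_op F) [:: c, e & u] = - right_op (fcons (a * c) F) (e :: u) by [].
have -> : right_op (lam a F) [:: c, e & u] = - right_op (fcons (a * c) F) (e :: u) by [].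
abel.
Qed.

Lemma bar_op_bar_op F : bar_op (bar_op F) = 0.
Proof.
apply: funext => u; elim: u F => [|a [|c u] IH] F //.
  by rewrite /= subr0.
rewrite bar_op_cons fcons_bar_op bar_opB !fctE IH subr0.
rewrite -[lam a (bar_op F) _]/(bar_op F (a * c :: u)) !bar_op_cons.
rewrite (_ : fcons c (lam a F) = fcons (a * c) F) //.
by case: u {IH} => [|e u]; rewrite -[RHS]/(0 : A) /lam /= ?mulrA; abel.
Qed.

Section Partial.
Variable s : {linear A -> A}.
Definition partial_op F := left_op s F - bar_op F + right_op F.

Fact partial_op_linear : linear partial_op.
Proof.
move=> e F G; rewrite /partial_op left_op_linear bar_op_linear right_op_linear.
by rewrite !scalerDr scalerN; abel.
Qed.
HB.instance Definition _ := GRing.isLinear.Build k _ _ _ partial_op partial_op_linear.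

Lemma partial_opB F G : partial_op (F - G) = partial_op F - partial_op G. Proof. exact: linearB. Qed.
Lemma partial_opN F : partial_op (- F) = - partial_op F. Proof. exact: linearN. Qed.
Lemma partial_opZ e F : partial_op (e *: F) = e *: partial_op F. Proof. exact: linearZ. Qed.
Lemma partial_op_sum (J : Type) (r : seq J) (F : J -> seq A -> A) :
  partial_op (\sum_(j <- r) F j) = \sum_(j <- r) partial_op (F j).
Proof. exact: linear_sum. Qed.

Hypothesis sM : {morph s : a b / a * b}.

Lemma partial_op_partial_op F : partial_op (partial_op F) = 0.
Proof.
rewrite /partial_op right_opD right_opB left_opD left_opB bar_opD bar_opB bar_op_bar_op
  bar_op_left_op // right_op_left_op -bar_op_right_op.
abel.
Qed.

End Partial.

Section Insertion.
Variables (t D : {linear A -> A}) (x : A).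

(** The terms in which [D] hits the last letter, which [right_op] has moved outside of the
    cochain. *)
Fixpoint last_op F u : A :=
  if u is a :: v then if v is [::] then - (F [::] * D a) else - last_op (fcons (t a) F) v else 0.

Lemma last_op_cons F a b u : last_op F (a :: b :: u) =
  - last_op (fcons (t a) F) (b :: u). Proof. by []. Qed.

Lemma der_op_right_op F : der_op t D (right_op F) = right_op (der_op t D F) + last_op F.
Proof.
apply: funext => u; elim: u F => [|a [|c u] IH] F; rewrite !fctE.
- by rewrite addr0.
- by rewrite /= mul0r oppr0 addr0 add0r.
rewrite der_op_cons right_op_cons last_op_cons fcons_der_op right_opD !fctE right_op_cons.
rewrite (@der_op_ext _ _ _ t D (fcons (t a) (right_op F)) (- right_op (fcons (t a) F))); last by case.
rewrite der_opN fctE IH !fctE; abel.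
Qed.

(** The value of [F] on the signed shuffle of the one-letter word [[:: x]] with [u]; for nonempty
    [u] it is 0 on Harrison cochains. *)
Fixpoint insert_op F u : A :=
  if u is a :: v then F (x :: a :: v) - insert_op (fcons (t a) F) v else F [:: x].

Lemma insert_op_cons F a u : insert_op F (a :: u) = F (x :: a :: u) - insert_op (fcons (t a) F) u.
Proof. by []. Qed.

Fact insert_op_linear : linear insert_op.
Proof.
move=> e F G; apply: funext => u; rewrite ![in RHS]fctE; elim: u F G => [|a u IH] F G //.
rewrite !insert_op_cons (_ : fcons (t a) _ = e *: fcons (t a) F + fcons (t a) G) // IH.
by rewrite !fctE scalerBr; abel.
Qed.
HB.instance Definition _ := GRing.isLinear.Build k _ _ _ insert_op insert_op_linear.

Lemma insert_opZ e F : insert_op (e *: F) = e *: insert_op F. Proof. exact: linearZ. Qed.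

Lemma mlin_insert_op F : mlin F -> mlin (insert_op F).
Proof.
move=> mF u; elim: u F mF => [|b u IH] F mF v e a c.
  rewrite !cat0s !insert_op_cons (linearP t) mlin_fconsP // insert_op_linear !fctE.
  by rewrite (mF [:: x] v) scalerBr; abel.
rewrite !cat_cons !insert_op_cons (IH _ (mlin_fcons (t b) mF) v) (mF [:: x, b & u] v).
by rewrite scalerBr; abel.
Qed.

Hypothesis tt : forall a, t (t a) = a.

Lemma last_op_rcons F u a :
  last_op F (rcons u a) = - ((-1) ^+ size u *: (F (map t u) * D a)).
Proof.
elim: u F => [|b u IH] F; first by rewrite /= scale1r.
have -> : last_op F (rcons (b :: u) a) = - last_op (fcons (t b) F) (rcons u a) by case: u {IH}.
by rewrite IH /= exprS -scalerA scaleN1r.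
Qed.

(** The two operators anticommute except for the terms in which [D] hits the outer last letter [a].
    There [x] runs through all positions in the rest of the word, so these terms add up to a shuffle
    with [x], times [D a]. *)
Lemma htpy_op_right_op F : (forall u, insert_op F u = 0) -> htpy_op t D x (right_op F) =
  - right_op (htpy_op t D x F).
Proof.
move=> F0; pose q u := htpy_op t D x (right_op F) u + right_op (htpy_op t D x F) u.
(* [insert_op] twists the letters in front of [x]. On [map t u] this undoes the twist there and
   leaves it on the letters between [x] and [a], as in [htpy_op]. *)
suff qE u a : q (rcons u a) = (-1) ^+ size u *: (insert_op F (map t u) * D a).
  apply/eqP; rewrite -addr_eq0; apply/eqP/funext => u; rewrite fctE.
  case/lastP: u => [|u a]; first by rewrite /= addr0.
  by rewrite -[LHS]/(q _) qE F0 mul0r scaler0.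
rewrite /q => {F0 q}; elim: u F => [|b u IH] F.
  by rewrite /= /fcons /= scale1r !subr0 mul0r oppr0 !addr0 opprK.
have rc G : right_op G (b :: rcons u a) = - right_op (fcons b G) (rcons u a) by case: u {IH}.
have rc' G : right_op (fcons b G) (rcons u a) = - right_op G (b :: rcons u a) by rewrite rc opprK.
rewrite rcons_cons htpy_op_cons rc fcons_htpy_op -fcons_der_op right_opB !fctE rc'.
rewrite (@der_op_ext _ _ _ t D (fcons x (right_op F)) (- right_op (fcons x F))); last by case.
rewrite (@htpy_op_ext _ _ _ t D x (fcons b (right_op F)) (- right_op (fcons b F)));
  last by case: u {IH rc rc'} => [|? ?] [].
rewrite der_opN htpy_opN der_op_right_op !fctE -[b :: rcons u a]/(rcons (b :: u) a) last_op_rcons.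
have := IH (fcons b F); set X := htpy_op _ _ _ _ _;
  set Y := right_op (htpy_op t D x (fcons b F)) _ => /esym XY.
rewrite [insert_op _ _]/= tt mulrBl scalerBr [size _]/= exprS -!scalerA !scaleN1r XY.
by rewrite /fcons; abel.
Qed.

End Insertion.

Definition mulD x (D : {linear A -> A}) a := x * D a.
Fact mulD_linear x D : linear (mulD x D).
Proof. by move=> e a b; rewrite /mulD linearP mulrDr scalerAr. Qed.
HB.instance Definition _ x D := GRing.isLinear.Build k _ _ _ (mulD x D) (mulD_linear x D).

(* The homotopy identity: h contracts up to a term lowering the input degree. *)
Lemma partial_op_htpy_op (s t D : {linear A -> A}) x F :
  {morph t : a b / a * b} -> (forall a, t (t a) = a) ->
  (forall a b, D (a * b) = D a * b + t a * D b) ->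
  (forall a, x * t a = a * x) ->
  mlin F -> partial_op s F = 0 -> (forall u, insert_op t x F u = 0) ->
  partial_op s (htpy_op t D x F) = mull (s x) (der_op t D F) - der_op idfun (mulD x D) F.
Proof.
move=> tM tt DM xC mF dF F0.
(* The cocycle condition trades [bar_op F] for end terms, whose images under the homotopy are
   known. *)
have bF : bar_op F = left_op s F + right_op F by apply/eqP;
  rewrite eq_sym -subr_eq0 -dF /partial_op addrAC.
rewrite /partial_op -(htpy_op_bar_op tM DM xC (E := mulD x D) _ mF) // bF htpy_opD
  htpy_op_left_op htpy_op_right_op //.
set X := left_op _ _; set Y := bar_op _; set Z := right_op _; set W := mull _ _.
by abel.
Qed.

End EndTerms.

(** * Shuffles *)

Section Shuffle.
Variables (k : fieldType) (T : Type) (p : T -> bool) (M : lmodType k).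
Implicit Types (F G : seq T -> M) (a b c : T) (u v w : seq T).

Definition par u : bool := foldr (fun a e => p a (+) e) false u.

(* sign of moving the letter b, of bidegree (1, |b|), past the word u *)
Definition ssgn b u : bool := odd (size u) (+) (p b && par u).

(** Recursion on which of the two words supplies the first letter; a letter of the second word has
    to pass all of the remaining first word. Letters are abstract with a parity [p], since an
    element of A does not determine its degree. *)
Fixpoint sh u : seq T -> (seq T -> M) -> M :=
  if u is a :: u' then
    fix shv v F := if v is b :: v' then
      sh u' (b :: v') (fcons a F) + (-1) ^+ ssgn b u *: shv v' (fcons b F)
    else F u
  else fun v F => F v.

Lemma shw0 u F : sh u [::] F = F u. Proof. by case: u. Qed.
Lemma sh_cons a b u v F : sh (a :: u) (b :: v) F =
  sh u (b :: v) (fcons a F) + (-1) ^+ ssgn b (a :: u) *: sh (a :: u) v (fcons b F).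
Proof. by []. Qed.

Lemma sh_ind (P : seq T -> seq T -> Prop) :
  (forall v, P [::] v) -> (forall u, P u [::]) ->
  (forall a b u v, P u (b :: v) -> P (a :: u) v -> P (a :: u) (b :: v)) ->
  forall u v, P u v.
Proof.
move=> P0 P1 PS; elim=> // a u IHu; elim=> // b v IHv.
by apply: PS.
Qed.

Fact sh_linear u v : linear (sh u v).
Proof.
move: u v; apply: sh_ind => [v|u|a b u v IHu IHv] e F G; rewrite ?shw0 //.
rewrite !sh_cons (_ : fcons a _ = e *: fcons a F + fcons a G) // IHu.
rewrite (_ : fcons b _ = e *: fcons b F + fcons b G) // IHv.
by rewrite !scalerDr !scalerA [_ * e]mulrC addrACA.
Qed.
HB.instance Definition _ u v := GRing.isLinear.Build k _ _ _ (sh u v) (sh_linear u v).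

Lemma shD u v F G : sh u v (F + G) = sh u v F + sh u v G. Proof. exact: linearD. Qed.
Lemma shB u v F G : sh u v (F - G) = sh u v F - sh u v G. Proof. exact: linearB. Qed.
Lemma shZ u v e F : sh u v (e *: F) = e *: sh u v F. Proof. exact: linearZ. Qed.
Lemma sh_0 u v : sh u v 0 = 0. Proof. exact: linear0. Qed.

Section Derivation.
Variables (e : bool) (D : T -> T) (x : T).
Hypotheses (pD : forall a, p (D a) = p a (+) e) (px : p x = e).

(** Counterpart of [der_op] for letters that carry a parity: the twist becomes a scalar sign, and no
    linearity of [F] is needed to treat it. *)
Fixpoint derw F u : M :=
  if u is a :: v then F (D a :: v) + (-1) ^+ (e && p a) *: derw (fcons a F) v else 0.

Fixpoint htpyw F u : M := if u is a :: v then derw (fcons x F) u - htpyw (fcons a F) v else 0.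

Lemma derw_cons F a u : derw F (a :: u) = F (D a :: u) + (-1) ^+ (e && p a) *: derw (fcons a F) u.
Proof. by []. Qed.
Lemma htpyw_cons F a u : htpyw F (a :: u) = derw (fcons x F) (a :: u) - htpyw (fcons a F) u.
Proof. by []. Qed.

Lemma fcons_derw F a : fcons a (derw F) = fcons (D a) F + (-1) ^+ (e && p a) *: derw (fcons a F).
Proof. by []. Qed.
Lemma fcons_htpyw F a : fcons a (htpyw F) = fcons a (derw (fcons x F)) - htpyw (fcons a F).
Proof. by []. Qed.

(** The signs of a shuffle depend on the parity of the word, so agreement can be asked for only on
    words of the parity that [D] produces. *)
Lemma derw_ext F G u : (forall w, size w = size u -> par w = par u (+) e -> F w = G w) ->
  derw F u = derw G u.
Proof.
elim: u F G => //= a u IH F G FG; congr (_ + _ *: _).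
  by apply: FG => //=; rewrite pD addbAC.
by apply: IH => w sw pw; apply: FG; rewrite /= ?sw ?pw ?addbA.
Qed.

Lemma htpyw_ext F G u : (forall w, size w = (size u).+1 -> par w = par u -> F w = G w) ->
  htpyw F u = htpyw G u.
Proof.
elim: u F G => // a u IH F G FG; rewrite !htpyw_cons; congr (_ - _).
  apply: derw_ext => w sw pw; apply: FG; rewrite /= ?sw ?pw //.
  by rewrite px addbC -addbA addbb addbF.
by apply: IH => w sw pw; apply: FG; rewrite /= ?sw ?pw ?addbA.
Qed.

Fact derw_linear : linear derw.
Proof.
move=> c F G; apply: funext => u; elim: u F G => [|a v IH] F G.
  by rewrite !fctE scaler0 addr0.
rewrite ![in RHS]fctE /= (_ : fcons a _ = c *: fcons a F + fcons a G) // IH !fctE.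
by rewrite !scalerDr !scalerA [_ * c]mulrC addrACA.
Qed.
HB.instance Definition _ := GRing.isLinear.Build k _ _ _ derw derw_linear.

Fact htpyw_linear : linear htpyw.
Proof.
move=> c F G; apply: funext => u; elim: u F G => [|a v IH] F G.
  by rewrite !fctE scaler0 addr0.
rewrite ![in RHS]fctE !htpyw_cons (_ : fcons a _ = c *: fcons a F + fcons a G) // IH.
rewrite (_ : fcons x _ = c *: fcons x F + fcons x G) // derw_linear !fctE.
by rewrite scalerBr opprD addrACA.
Qed.
HB.instance Definition _ := GRing.isLinear.Build k _ _ _ htpyw htpyw_linear.

Lemma derwD F G : derw (F + G) = derw F + derw G. Proof. exact: linearD. Qed.
Lemma derwZ (r : k) F : derw (r *: F) = r *: derw F. Proof. exact: linearZ. Qed.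
Lemma htpywD F G : htpyw (F + G) = htpyw F + htpyw G. Proof. exact: linearD. Qed.
Lemma htpywZ (r : k) F : htpyw (r *: F) = r *: htpyw F. Proof. exact: linearZ. Qed.

Lemma sh_derw u v F : sh u v (derw F) =
  derw (fun w => sh w v F) u + (-1) ^+ (e && par u) *: derw (fun w => sh u w F) v.
Proof.
move: u v F; apply: sh_ind => [v|u|a b u v IHu IHv] F.
- by rewrite /= add0r andbF scale1r.
- rewrite /= scaler0 addr0 shw0; congr (derw _ u).
  by apply: funext => w; rewrite shw0.
rewrite sh_cons !fcons_derw !shD !shZ {}IHu {}IHv !derw_cons !sh_cons.
have -> : derw (fcons a (fun w => sh w (b :: v) F)) u =
    derw (fun w => sh w (b :: v) (fcons a F)) u +
    (-1) ^+ (ssgn b (a :: u) (+) (e && p b)) *: derw (fcons a (fun w => sh w v (fcons b F))) u.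
  rewrite -[_ *: _]/((_ *: derw _) u) -derwZ -[RHS]/((derw _ + derw _) u) -derwD.
  apply: derw_ext => w sw pw; rewrite /fcons /= fctE /=; congr (_ + (-1) ^+ nat_of_bool _ *: _).
  rewrite /ssgn /= sw pw; move: (p a) (p b) (par u) (odd _).
  by case: (e) => [] [] [] [] [].
have -> : derw (fcons b (fun w => sh (a :: u) w F)) v =
    derw (fcons b (fun w => sh u w (fcons a F))) v +
    (-1) ^+ ssgn b (a :: u) *: derw (fun w => sh (a :: u) w (fcons b F)) v.
  by rewrite -[_ *: _]/((_ *: derw _) v) -derwZ -[RHS]/((derw _ + derw _) v) -derwD.
rewrite !scalerDr !scalerA -!signr_addb.
have -> : ssgn b (D a :: u) = ssgn b (a :: u) (+) (e && p b).
  by rewrite /ssgn /= pD; move: (p a) (p b) (par u) (odd _); case: (e) => [] [] [] [] [].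
have -> : ssgn (D b) (a :: u) = ssgn b (a :: u) (+) (e && par (a :: u)).
  by rewrite /ssgn pD; move: (p b) (par _) (odd _); case: (e) => [] [] [] [].
have -> : e && par (a :: u) = (e && p a) (+) (e && par u) by rewrite -andb_addr.
move: (e && p a) (e && p b) (e && par u) (ssgn b _) => [] [] [] [];
  rewrite /= ?expr0 ?expr1 ?scale1r ?scaleN1r; abel.
Qed.

(** An insertion into a shuffled word is assigned to the factor that contains the letter hit by [D].
    Every position of [x] in front of that letter occurs exactly once when this enlarged factor is
    shuffled with the other one, so there are no mixed terms. *)
Lemma sh_htpyw u v F : sh u v (htpyw F) =
  htpyw (fun w => sh w v F) u + (-1) ^+ odd (size u) *: htpyw (fun w => sh u w F) v.
Proof.
move: u v F; apply: sh_ind => [v|u|a b u v IHu IHv] F.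
- by rewrite /= add0r scale1r.
- rewrite /= scaler0 addr0 shw0; congr (htpyw _ u).
  by apply: funext => w; rewrite shw0.
rewrite sh_cons !fcons_htpyw !shB {}IHu {}IHv !htpyw_cons.
have /esym L1 := sh_cons a b u v (derw (fcons x F)).
(* The homotopy lengthens the word by one letter and keeps its parity, which flips [ssgn b]. *)
have -> : htpyw (fcons a (fun w => sh w (b :: v) F)) u =
    htpyw (fun w => sh w (b :: v) (fcons a F)) u -
    (-1) ^+ ssgn b (a :: u) *: htpyw (fcons a (fun w => sh w v (fcons b F))) u.
  rewrite -scaleNr -[_ *: _]/((_ *: htpyw _) u) -htpywZ -[RHS]/((htpyw _ + htpyw _) u) -htpywD.
  apply: htpyw_ext => w sw pw; rewrite /fcons /= fctE /=; congr (_ + _ *: _).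
  by rewrite /ssgn /= sw pw /= addNb signrN.
have -> : htpyw (fcons b (fun w => sh (a :: u) w F)) v =
    htpyw (fcons b (fun w => sh u w (fcons a F))) v +
    (-1) ^+ ssgn b (a :: u) *: htpyw (fun w => sh (a :: u) w (fcons b F)) v.
  by rewrite -[_ *: _]/((_ *: htpyw _) v) -htpywZ -[RHS]/((htpyw _ + htpyw _) v) -htpywD.
have -> : derw (fcons x (fun w => sh w (b :: v) F)) (a :: u) =
    derw (fun w => sh w (b :: v) (fcons x F)) (a :: u) -
    (-1) ^+ ssgn b (a :: u) *: derw (fcons x (fun w => sh w v (fcons b F))) (a :: u).
  rewrite -scaleNr -[_ *: _]/((_ *: derw _) _) -derwZ -[RHS]/((derw _ + derw _) _) -derwD.
  apply: derw_ext => w sw pw; rewrite /fcons /= fctE /=; congr (_ + _ *: _).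
  rewrite /ssgn /= sw pw /= px -signrN; congr ((-1) ^+ nat_of_bool _).
  by move: (p a) (p b) (par u) (odd _); case: (e) => [] [] [] [] [].
have -> : derw (fcons x (fun w => sh (a :: u) w F)) (b :: v) =
    derw (fcons x (fun w => sh u w (fcons a F))) (b :: v) +
    (-1) ^+ ssgn x (a :: u) *: derw (fun w => sh (a :: u) w (fcons x F)) (b :: v).
  by rewrite -[_ *: _]/((_ *: derw _) _) -derwZ -[RHS]/((derw _ + derw _) _) -derwD.
(* The terms with [x] in front of the whole shuffled word add up to a shuffle evaluated on
   [derw (fcons x F)], where the derivation property of [derw] applies. *)
have := sh_derw (a :: u) (b :: v) (fcons x F).
rewrite -L1 => /(congr1 (+%R^~ (- ((-1) ^+ ssgn b (a :: u) *: sh (a :: u) v (fcons b (derw (fcons x F))))))).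
rewrite addrK => ->.
have -> : ssgn x (a :: u) = ~~ odd (size u) (+) (e && par (a :: u)) by rewrite /ssgn px.
rewrite [odd (size (a :: u))]/=.
move: (e && par (a :: u)) (ssgn b (a :: u)) (odd (size u)) => [] [] [];
  rewrite /= ?expr0 ?expr1 ?scale1r ?scaleN1r; abel.
Qed.

End Derivation.
End Shuffle.

Fixpoint Forall (T : Type) (P : T -> Prop) (w : seq T) : Prop :=
  if w is a :: v then P a /\ Forall P v else True.

Section ShuffleVanish.
Variables (k : fieldType) (T : Type) (p : T -> bool) (M : lmodType k).
Variable P : T -> Prop.
Implicit Types (F G : seq T -> M) (u v w : seq T).

Lemma sh_ext F G u v : Forall P u -> Forall P v ->
  (forall w, Forall P w -> size w = (size u + size v)%N -> F w = G w) ->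
  sh p u v F = sh p u v G.
Proof.
move: u v F G; apply: sh_ind => [v|u|a b u v IHu IHv] F G; rewrite ?shw0.
- by move=> _ Pv; apply.
- by move=> Pu _; apply=> //; rewrite addn0.
move=> /= [Pa Pu] [Pb Pv] FG; congr (_ + _ *: _).
  by apply: IHu => // w Pw sw; apply: FG => //=; rewrite sw.
by apply: IHv => // w Pw sw; apply: FG => //=; rewrite sw addnS.
Qed.

Variables (e : bool) (D : T -> T) (x : T).
Hypotheses (PD : forall a, P a -> P (D a)) (Px : P x).

Lemma derw_eq0 F u : Forall P u -> (forall w, Forall P w -> size w = size u -> F w = 0) ->
  derw p e D F u = 0.
Proof.
elim: u F => // a u IH F [Pa Pu] F0; rewrite derw_cons F0 /=; last 2 first.
- by split=> //; exact: PD.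
- by [].
by rewrite IH ?scaler0 ?addr0 // => w Pw sw; apply: F0; rewrite /= ?sw.
Qed.

Lemma htpyw_eq0 F u : Forall P u -> (forall w, Forall P w -> size w = (size u).+1 -> F w = 0) ->
  htpyw p e D x F u = 0.
Proof.
elim: u F => // a u IH F [Pa Pu] F0; rewrite htpyw_cons derw_eq0 //; last first.
  by move=> w Pw sw; apply: F0; rewrite /= ?sw.
by rewrite IH ?subr0 // => w Pw sw; apply: F0; rewrite /= ?sw.
Qed.

Lemma derw_shuffle0 F : (forall a, p (D a) = p a (+) e) ->
  (forall u v, Forall P u -> Forall P v -> (0 < size u)%N -> (0 < size v)%N -> sh p u v F = 0) ->
  forall u v, Forall P u -> Forall P v -> (0 < size u)%N -> (0 < size v)%N ->
  sh p u v (derw p e D F) = 0.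
Proof.
move=> pD F0 u v Pu Pv u0 v0; rewrite sh_derw // !derw_eq0 ?scaler0 ?addr0 // => w Pw sw.
  by apply: F0; rewrite ?sw.
by apply: F0; rewrite ?sw.
Qed.

Lemma htpyw_shuffle0 F : (forall a, p (D a) = p a (+) e) -> p x = e ->
  (forall u v, Forall P u -> Forall P v -> (0 < size u)%N -> (0 < size v)%N -> sh p u v F = 0) ->
  forall u v, Forall P u -> Forall P v -> (0 < size u)%N -> (0 < size v)%N ->
  sh p u v (htpyw p e D x F) = 0.
Proof.
move=> pD px F0 u v Pu Pv u0 v0; rewrite sh_htpyw // !htpyw_eq0 ?scaler0 ?addr0 // => w Pw sw.
  by apply: F0; rewrite ?sw.
by apply: F0; rewrite ?sw.
Qed.

End ShuffleVanish.

(** * Harrison cochains on words *)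

Section Cochains.
Variables (k : fieldType) (A : gcAlgType k).
Implicit Types (F G : seq A -> A) (a b c : A) (u v : seq A).

(** Letters carry their degree as a label because 0 is homogeneous of every degree. Shuffle signs
    need only the parity, recorded by [phom]. *)
Definition dhom (t : nat * A) : Prop := homog t.1 t.2.
Definition phom (t : bool * A) : Prop := exists2 q, homog q t.2 & odd q = t.1.

Definition vals T (w : seq (T * A)) : seq A := [seq t.2 | t <- w].
Lemma vals_cons T (t : T * A) w : vals (t :: w) = t.2 :: vals w. Proof. by []. Qed.

Definition wdeg (w : seq (nat * A)) : nat := sumn [seq t.1 | t <- w].

Definition hdeg p F := forall w, Forall dhom w -> homog (wdeg w + p)%N (F (vals w)).

Definition normd F := forall u v a, homog 0 a -> F (u ++ a :: v) = 0.

Definition shvan F := forall u v : seq (bool * A), Forall phom u -> Forall phom v ->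
  (0 < size u)%N -> (0 < size v)%N -> sh (@fst _ _) u v (fun w => F (vals w)) = 0.

Definition arity m F := forall u, size u <> m -> F u = 0.

(* n is the total degree of the letters already passed, cf. fcons *)
Definition lowvan n s F := forall w, Forall dhom w -> (n + wdeg w < s)%N -> F (vals w) = 0.

Definition good p F := [/\ mlin F, hdeg p F, normd F & shvan F].

Lemma mlin_ext F G : mlin F -> mlin G ->
  (forall w, Forall dhom w -> F (vals w) = G (vals w)) -> F = G.
Proof.
move=> mF mG FG; apply: funext => u; elim: u F G mF mG FG => [|a u IH] F G mF mG FG.
  exact: (FG [::]).
apply: (@linear_homog_ext _ _ _ (fun a => F (a :: u)) (fun a => G (a :: u))).
- exact: (mF [::] u).
- exact: (mG [::] u).
move=> n b hb; apply: (IH (fcons b F) (fcons b G)); try exact: mlin_fcons.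
by move=> w hw; apply: (FG ((n, b) :: w)).
Qed.

Lemma lowvan_fcons n s F q a : homog q a -> lowvan n s F -> lowvan (n + q) s (fcons a F).
Proof.
move=> ha vF w hw lt; apply: (vF ((q, a) :: w)); first by split.
by rewrite /wdeg /= addnA.
Qed.

Lemma normd_fcons F a : normd F -> normd (fcons a F).
Proof. by move=> nF u v b hb; exact: (nF (a :: u)). Qed.

Lemma normd_head F a u : normd F -> homog 0 a -> F (a :: u) = 0.
Proof. by move=> nF ha; exact: (nF [::] u). Qed.

Lemma normd_fcons0 F a : normd F -> homog 0 a -> fcons a F = 0.
Proof. by move=> nF ha; apply: funext => u; apply: normd_head. Qed.

Lemma good_lin p e F G : good p F -> good p G -> good p (e *: F + G).
Proof.
have E w : (e *: F + G) w = e *: F w + G w by [].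
move=> [mF dF nF sF] [mG dG nG sG]; split; first exact: mlin_lin.
- by move=> w hw; rewrite E; apply: homogD; [apply: homogZ; exact: dF|exact: dG].
- by move=> u v a ha; rewrite E nF // nG // scaler0 addr0.
move=> u v Pu Pv u0 v0.
rewrite -[X in sh _ _ _ X]/(e *: (fun w => F (vals w)) + (fun w => G (vals w))).
by rewrite shD shZ sF // sG // scaler0 addr0.
Qed.

Lemma good0 p : good p 0.
Proof.
split=> // [|w _|u v Pu Pv u0 v0]; [exact: mlin0|exact: homog0|exact: sh_0].
Qed.

Lemma goodZ p e F : good p F -> good p (e *: F).
Proof. by move=> gF; rewrite -[e *: F]addr0; apply: good_lin => //; exact: good0. Qed.

Lemma goodD p F G : good p F -> good p G -> good p (F + G).
Proof. by rewrite -[F in F + G]scale1r; exact: good_lin. Qed.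

Lemma goodB p F G : good p F -> good p G -> good p (F - G).
Proof. by rewrite addrC -scaleN1r => ? ?; exact: good_lin. Qed.

Lemma good_sum p (J : Type) (r : seq J) (F : J -> seq A -> A) :
  (forall j, good p (F j)) -> good p (\sum_(j <- r) F j).
Proof. by move=> gF; apply: big_ind => //; [exact: good0|exact: goodD]. Qed.

Lemma arity_lin m e F G : arity m F -> arity m G -> arity m (e *: F + G).
Proof. by move=> aF aG u su; rewrite !fctE aF // aG // scaler0 addr0. Qed.

Lemma arity_sum m (J : Type) (r : seq J) (F : J -> seq A -> A) :
  (forall j, arity m (F j)) -> arity m (\sum_(j <- r) F j).
Proof.
move=> aF; apply: big_ind => // G H aG aH.
by rewrite -[G]scale1r; exact: arity_lin.
Qed.

Section Operators.
Variables (e : nat) (D : {linear A -> A}).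
Hypothesis D0 : forall a, homog 0 a -> D a = 0.
Hypothesis Dp : forall q a, homog q a -> exists2 q', homog q' (D a) & odd q' = odd q (+) odd e.

(** Only the parity of the degree shift is recorded, so the same lemmas serve the partial
    derivatives, which lower degree, and d, which raises it. *)
Definition Dpar (t : bool * A) : bool * A := (t.1 (+) odd e, D t.2).

Lemma der_op_tw F a u :
  der_op (tw e) D F (a :: u) = F (D a :: u) + der_op (tw e) D (fcons (tw e a) F) u.
Proof. by []. Qed.

Lemma phom_D t : phom t -> phom (Dpar t).
Proof.
by case: t => b a [q /= ha <-]; have [q' ha' qq] := Dp ha; exists q'.
Qed.

Lemma phom_tw t : phom t -> tw e t.2 = (-1) ^+ (odd e && t.1) *: t.2.
Proof.
by case: t => b a [q /= ha <-]; rewrite (tw_homog _ ha) -signr_odd oddM.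
Qed.

Lemma der_op_derw F w : mlin F -> Forall phom w ->
  der_op (tw e) D F (vals w) = derw (@fst _ _) (odd e) Dpar (fun w => F (vals w)) w.
Proof.
elim: w F => // t w IH F mF [ht hw]; rewrite derw_cons [vals _]/= der_op_tw; congr (_ + _).
by rewrite phom_tw // mlin_fconsZ // der_opZ !fctE IH //; exact: mlin_fcons.
Qed.

Lemma htpy_op_htpyw F x w : mlin F -> Forall phom w -> homog e x ->
  htpy_op (tw e) D x F (vals w) =
  htpyw (@fst _ _) (odd e) Dpar (odd e, x) (fun w => F (vals w)) w.
Proof.
move=> mF + hx; elim: w F mF => // t w IH F mF tw.
rewrite htpyw_cons [vals _]/= htpy_op_cons -[t.2 :: _]/(vals (t :: w)) der_op_derw //;
  last exact: mlin_fcons.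
by case: tw => _ hw; rewrite IH //; exact: mlin_fcons.
Qed.

Lemma normd_der_op F : mlin F -> normd F -> normd (der_op (tw e) D F).
Proof.
move=> mF nF u v a ha; elim: u F mF nF => [|b u IH] F mF nF; rewrite ?cat0s ?cat_cons der_op_tw.
  rewrite D0 // mlin_head0 //.
  by rewrite (normd_fcons0 nF) ?der_op0 ?addr0 //; exact: homog_tw.
rewrite -cat_cons (nF (D b :: u)) // add0r.
by apply: IH; [exact: mlin_fcons|exact: normd_fcons].
Qed.

Lemma normd_htpy_op F x : mlin F -> normd F -> normd (htpy_op (tw e) D x F).
Proof.
move=> mF nF u v a ha; elim: u F mF nF => [|b u IH] F mF nF; rewrite ?cat0s ?cat_cons htpy_op_cons.
  rewrite (normd_fcons0 nF ha) htpy_op0 subr0.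
  by apply: (normd_der_op _ _ [::]) => //; [exact: mlin_fcons|exact: normd_fcons].
rewrite -cat_cons (normd_der_op _ _ (b :: u)) // ?sub0r ?IH ?oppr0 //;
  by [exact: mlin_fcons|exact: normd_fcons].
Qed.

Lemma shvan_der_op F : mlin F -> shvan F -> shvan (der_op (tw e) D F).
Proof.
move=> mF sF u v Pu Pv u0 v0.
rewrite (@sh_ext _ _ _ _ phom _ (derw (@fst _ _) (odd e) Dpar (fun w => F (vals w)))) //.
  by apply: (@derw_shuffle0 _ _ _ _ phom) => //; exact: phom_D.
by move=> w Pw _; exact: der_op_derw.
Qed.

Lemma shvan_htpy_op F x : mlin F -> homog e x -> shvan F -> shvan (htpy_op (tw e) D x F).
Proof.
move=> mF hx sF u v Pu Pv u0 v0.
rewrite (@sh_ext _ _ _ _ phom _ (htpyw (@fst _ _) (odd e) Dpar (odd e, x) (fun w => F (vals w)))) //.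
  by apply: (@htpyw_shuffle0 _ _ _ _ phom) => //; [exact: phom_D|exists e].
by move=> w Pw _; exact: htpy_op_htpyw.
Qed.

Lemma arity_der_op m F : arity m F -> arity m (der_op (tw e) D F).
Proof.
move=> aF u su; rewrite (@der_op_ext _ _ _ _ _ F 0) ?der_op0 ?htpy_op0 // => w sw.
by apply: aF; rewrite sw.
Qed.

Lemma arity_htpy_op m F x : arity m.+1 F -> arity m (htpy_op (tw e) D x F).
Proof.
move=> aF u su; rewrite (@htpy_op_ext _ _ _ _ _ _ F 0) ?der_op0 ?htpy_op0 // => w sw.
by apply: aF; rewrite sw => -[].
Qed.

End Operators.

(* Q n y: a property of the value y of a cochain at an input of total degree n *)
Section DegreeProperty.
Variable Q : nat -> A -> Prop.
Hypotheses (Q0 : forall n, Q n 0) (QD : forall n y z, Q n y -> Q n z -> Q n (y + z)).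
Hypothesis QN : forall n y, Q n y -> Q n (- y).

(** Two kinds of [Q] are used: homogeneity of the value, which gives [hdeg], and vanishing of the
    value for [n < s], which gives [lowvan]. *)
Definition qdeg n F := forall w, Forall dhom w -> Q (n + wdeg w) (F (vals w)).

Lemma qdeg_fcons n F q a : homog q a -> qdeg n F -> qdeg (n + q) (fcons a F).
Proof.
move=> ha qF w hw; have := qF ((q, a) :: w) (conj ha hw).
by rewrite /wdeg /= addnA.
Qed.

Lemma qdeg_up r (D : {linear A -> A}) F n :
  (forall q a, homog q a -> homog (q + r) (D a)) -> qdeg n F ->
  forall w, Forall dhom w -> Q (n + wdeg w + r) (der_op (tw r) D F (vals w)).
Proof.
move=> Dr qF w; elim: w n F qF => [|[q a] w IH] n F qF; first by move=> _; exact: Q0.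
move=> [ha hw].
rewrite vals_cons der_op_tw; apply: QD.
  have := qF ((q + r, D a)%N :: w) (conj (Dr _ _ ha) hw).
  by rewrite /wdeg /= -!addnA [(r + _)%N]addnC.
rewrite /wdeg /= addnA; apply: IH => //; apply: qdeg_fcons => //; exact: homog_tw.
Qed.

Variables (e : nat) (D : {linear A -> A}).
Hypothesis De : forall q a, homog q a -> (e <= q)%N -> homog (q - e) (D a).
Hypothesis D_lt : forall q a, homog q a -> (q < e)%N -> D a = 0.

(** The equation for [m] avoids a truncated subtraction: single letters may have degree below [e],
    and then [D] kills them. *)
Lemma qdeg_down F n : mlin F -> qdeg n F ->
  forall w m, Forall dhom w -> (m + e)%N = (n + wdeg w)%N -> Q m (der_op (tw e) D F (vals w)).
Proof.
move=> mF qF w m; elim: w n F mF qF => [|[q a] w IH] n F mF qF; first by move=> _ _; exact: Q0.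
move=> [ha hw] me.
rewrite vals_cons der_op_tw; apply: QD.
  have [le|lt] := leqP e q; last first.
    by rewrite (D_lt ha lt) mlin_head0 //; exact: Q0.
  have := qF ((q - e, D a)%N :: w) (conj (De ha le) hw).
  suff -> : (n + wdeg ((q - e, D a)%N :: w))%N = m by [].
  by apply/eqP; rewrite -(eqn_add2r e) me /wdeg /= -addnA addnAC subnK.
apply: (IH (n + q)%N); rewrite ?me -?addnA //; first exact: mlin_fcons.
by apply: qdeg_fcons => //; exact: homog_tw.
Qed.

Lemma qdeg_htpy_op F n x : homog e x -> mlin F -> qdeg n F -> qdeg n (htpy_op (tw e) D x F).
Proof.
move=> hx mF qF w; elim: w n F mF qF => [|[q a] w IH] n F mF qF hw; first exact: Q0.
rewrite vals_cons htpy_op_cons; apply: QD; last apply: QN.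
  rewrite -[a :: vals w]/(vals ((q, a) :: w)).
  apply: (@qdeg_down _ (n + e)) => //; first exact: mlin_fcons.
    exact: qdeg_fcons.
  by rewrite addnAC.
case: hw => /= ha hw; rewrite /wdeg /= addnA; apply: IH => //; first exact: mlin_fcons.
exact: qdeg_fcons.
Qed.

Lemma der_op_low F w : mlin F -> Forall dhom w -> (wdeg w < e)%N -> der_op (tw e) D F (vals w) = 0.
Proof.
elim: w F => // -[q a] w IH F mF [ha hw] lt0; have lt : (q + wdeg w < e)%N := lt0.
rewrite vals_cons der_op_tw (D_lt ha) ?(leq_ltn_trans _ lt) ?leq_addr // mlin_head0 //.
by rewrite add0r IH //; [exact: mlin_fcons|rewrite (leq_ltn_trans _ lt) ?leq_addl].
Qed.

End DegreeProperty.

Section Down.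
Variables (e : nat) (D : {linear A -> A}) (x : A).
Hypothesis e_gt0 : (0 < e)%N.
Hypothesis hx : homog e x.
Hypothesis De : forall q a, homog q a -> (e <= q)%N -> homog (q - e) (D a).
Hypothesis D_lt : forall q a, homog q a -> (q < e)%N -> D a = 0.

Let D0 a : homog 0 a -> D a = 0. Proof. by move=> /D_lt; exact. Qed.

Let Dp q a : homog q a -> exists2 q', homog q' (D a) & odd q' = odd q (+) odd e.
Proof.
move=> ha; have [le|lt] := leqP e q; first by exists (q - e)%N; [exact: De|rewrite oddB].
by exists (q + e)%N; [rewrite (D_lt ha) //; exact: homog0|rewrite oddD].
Qed.

Lemma good_htpy_op p F : good p F -> good p (htpy_op (tw e) D x F).
Proof.
move=> [mF dF nF sF]; split; [exact: mlin_htpy_op| |exact: normd_htpy_op|exact: shvan_htpy_op].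
apply: (@qdeg_htpy_op (fun n y => homog (n + p)%N y) _ _ _ _ _ _ _ _ 0) => //.
- by move=> *; exact: homog0.
- by move=> *; exact: homogD.
- by move=> *; exact: homogN.
Qed.

Lemma lowvan_htpy_op s F : mlin F -> lowvan 0 s F -> lowvan 0 s (htpy_op (tw e) D x F).
Proof.
move=> mF vF; apply: (@qdeg_htpy_op (fun n y => (n < s)%N -> y = 0) _ _ _ _ _ _ _ _ 0) => //.
- by move=> n y z + + lt => -> // ->; rewrite ?addr0.
- by move=> n y + lt => ->; rewrite ?oppr0.
Qed.

(** Together with [good_LE] this places the coboundary of the homotopy in the Harrison complex
    through the homotopy formula, without a separate proof that [partial_op] preserves vanishing on
    shuffles. *)
Lemma good_mull_der_op p F : good p F -> good p (mull (tw p x) (der_op (tw e) D F)).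
Proof.
move=> [mF dF nF sF]; split.
- exact/mlin_mull/mlin_der_op.
- move=> w hw; rewrite /mull; have [le|lt] := leqP e (wdeg w); last first.
    by rewrite der_op_low ?mulr0 //; exact: homog0.
  rewrite -{1}(subnKC le) -addnA; apply: homog_mul; first exact: homog_tw.
  apply: (@qdeg_down (fun n y => homog (n + p)%N y) _ _ _ _ _ _ _ 0) => //.
  - by move=> *; exact: homog0.
  - by move=> *; exact: homogD.
  - by rewrite subnK.
- by move=> u v a ha; rewrite /mull (normd_der_op e D0 mF nF) ?mulr0.
move=> u v Pu Pv u0 v0.
have -> : (fun w => mull (tw p x) (der_op (tw e) D F) (vals w)) =
          (fun y => tw p x * y) \o (fun w => der_op (tw e) D F (vals w)) by [].
have shm (b : A) (G : seq (bool * A) -> A) (u' v' : seq (bool * A)) :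
    sh (@fst _ _) u' v' ((fun y => b * y) \o G) = b * sh (@fst _ _) u' v' G.
  move: u' v' G; apply: sh_ind => [v'|u'|c c' u' v' IHu IHv] G; rewrite ?shw0 //.
  by rewrite !sh_cons mulrDr -scalerAr -IHu -IHv.
by rewrite shm (shvan_der_op Dp mF sF) ?mulr0.
Qed.

(** [D] lowers the input degree by [e > 0], so the range of vanishing grows by at least one. This is
    what makes the leftover term of the homotopy formula harmless. *)
Lemma lowvan_mull_der_op s F b : mlin F -> lowvan 0 s F ->
  lowvan 0 s.+1 (mull b (der_op (tw e) D F)).
Proof.
move=> mF vF w hw; rewrite add0n ltnS => lt; rewrite /mull.
have [le|lt'] := leqP e (wdeg w); last by rewrite der_op_low ?mulr0.
rewrite (@qdeg_down (fun n y => (n < s)%N -> y = 0) _ _ _ _ _ _ _ 0 _ _ _ (wdeg w - e)%N) ?mulr0 //.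
- by move=> n y z + + lt' => -> // ->; rewrite ?addr0.
- by rewrite subnK.
by rewrite (leq_trans _ lt) // ltn_subrL e_gt0 (leq_trans e_gt0).
Qed.

End Down.

Lemma good_der_op r (D : {linear A -> A}) p F :
  (forall q a, homog q a -> homog (q + r) (D a)) -> (forall a, homog 0 a -> D a = 0) ->
  good p F -> good (p + r) (der_op (tw r) D F).
Proof.
move=> Dr D0 [mF dF nF sF].
have Dp q a : homog q a -> exists2 q', homog q' (D a) & odd q' = odd q (+) odd r.
  by move=> /Dr ha; exists (q + r)%N; rewrite ?oddD.
split; [exact: mlin_der_op| |exact: normd_der_op|exact: shvan_der_op].
move=> w hw; rewrite addnCA -[X in (X + r)%N]add0n.
apply: (@qdeg_up (fun n y => homog (p + n)%N y) _ _ _ _ _ 0) => //.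
- by move=> *; exact: homog0.
- by move=> *; exact: homogD.
by move=> v hv; rewrite add0n addnC; exact: dF.
Qed.

End Cochains.

(** * Pointwise limits of cochains *)

Section Limits.
Variables (k : fieldType) (A : gcAlgType k).
Variables (T : Type) (le : T -> T -> Prop).
Hypotheses (le_refl : forall t, le t t) (le_trans : forall t s r, le t s -> le s r -> le t r).
Hypothesis directed : forall t s, exists2 r, le t r & le s r.

Definition ev (P : T -> Prop) := exists t0, forall t, le t0 t -> P t.

Lemma ev_and P Q : ev P -> ev Q -> ev (fun t => P t /\ Q t).
Proof.
move=> [t Pt] [s Qs]; have [r tr sr] := directed t s; exists r => q rq.
by split; [apply: Pt|apply: Qs]; exact: le_trans rq.
Qed.

Lemma ev2 (P Q R : T -> Prop) : ev P -> ev Q -> (forall t, P t -> Q t -> R t) -> ev R.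
Proof. by move=> evP evQ PQR; have [t0 h] := ev_and evP evQ; exists t0 => t /h[/PQR]. Qed.

Lemma ev_ex P : ev P -> exists t, P t.
Proof. by move=> [t Pt]; exists t; exact: Pt. Qed.

Variable t0 : T.

(** Each single value becomes constant. All operators and all conditions on cochains involve
    finitely many words at a time, hence pass to such limits. The index is a finite set of
    generators or a natural number. *)
Definition limit (X : Type) (Z : T -> seq X -> A) (H : seq X -> A) :=
  forall u, ev (fun t => Z t u = H u).

Lemma limit_ex X (Z : T -> seq X -> A) :
  (forall u, exists y, ev (fun t => Z t u = y)) -> exists H, limit Z H.
Proof. by move=> /choice[H ZH]; exists H. Qed.

Lemma limit_uniq X (Z : T -> seq X -> A) H H' : limit Z H -> limit Z H' -> H = H'.
Proof.
move=> ZH ZH'; apply: funext => u.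
by have [t [<- <-]] := ev_ex (ev_and (ZH u) (ZH' u)).
Qed.

Lemma limit_left_op s Z H : limit Z H -> limit (fun t => left_op s (Z t)) (left_op s H).
Proof. by move=> ZH [|a u]; [exists t0|have [t h] := ZH u; exists t => r /h /= ->]. Qed.

Lemma limit_bar_op Z H : limit Z H -> limit (fun t => bar_op (Z t) : seq A -> A) (bar_op H).
Proof.
move=> ZH u; elim: u Z H ZH => [|a u IH] Z H ZH; first by exists t0.
apply: (ev2 (P := fun t => lam a (Z t) u = lam a H u) _ (IH (fun t => fcons a (Z t)) (fcons a H) _)).
- by case: u {IH} => [|b u]; [exists t0|exact: ZH].
- by move=> v; exact: ZH.
by move=> t E1 E2; rewrite !bar_op_cons E1 E2.
Qed.

Lemma limit_right_op Z H : limit Z H -> limit (fun t => right_op (Z t)) (right_op H).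
Proof.
move=> ZH u; elim: u Z H ZH => [|a [|b u] IH] Z H ZH; first by exists t0.
  by have [t h] := ZH [::]; exists t => r /h /= ->.
have [|t h] := IH (fun t => fcons a (Z t)) (fcons a H); first by move=> v; exact: ZH.
by exists t => r /h; rewrite !right_op_cons => ->.
Qed.

Lemma limit_partial_op s Z H : limit Z H -> limit (fun t => partial_op s (Z t)) (partial_op s H).
Proof.
move=> ZH u; apply: (ev2 (ev_and (limit_left_op s ZH u) (limit_bar_op ZH u)) (limit_right_op ZH u)).
by move=> t [E1 E2] E3; rewrite /partial_op !fctE E1 E2 E3.
Qed.

Lemma limit_sh (X : Type) (p : X -> bool) u v Z H : limit Z H ->
  ev (fun t => sh p u v (Z t) = sh p u v H).
Proof.
move: u v Z H; apply: sh_ind => [v|u|a b u v IHu IHv] Z H ZH.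
- exact: ZH.
- by have [t h] := ZH u; exists t => r /h; rewrite !shw0.
apply: (ev2 (IHu (fun t => fcons a (Z t)) (fcons a H) _) (IHv (fun t => fcons b (Z t)) (fcons b H) _)).
- by move=> w; exact: ZH.
- by move=> w; exact: ZH.
by move=> t E1 E2; rewrite !sh_cons E1 E2.
Qed.

Lemma limit_good p Z H : (forall t, good p (Z t)) -> limit Z H -> good p H.
Proof.
move=> gZ ZH; split.
- move=> u v e a b.
  have [t [[<- <-] <-]] := ev_ex (ev_and (ev_and (ZH (u ++ (e *: a + b) :: v))
    (ZH (u ++ a :: v))) (ZH (u ++ b :: v))).
  by have [m _ _ _] := gZ t; exact: m.
- by move=> w hw; have [t <-] := ev_ex (ZH (vals w)); have [_ d _ _] := gZ t; exact: d.
- by move=> u v a ha; have [t <-] := ev_ex (ZH (u ++ a :: v)); have [_ _ n _] := gZ t; exact: n.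
move=> u v Pu Pv u0 v0.
have [t <-] := ev_ex (@limit_sh _ (@fst _ _) u v (fun t w => Z t (vals w))
  (fun w => H (vals w)) (fun w => ZH (vals w))).
by have [_ _ _ s] := gZ t; exact: s.
Qed.

Lemma limit_arity m Z H : (forall t, arity m (Z t)) -> limit Z H -> arity m H.
Proof. by move=> aZ ZH u su; have [t <-] := ev_ex (ZH u); exact: aZ. Qed.

Lemma limit_lowvan s Z H : (forall t, lowvan 0 s (Z t)) -> limit Z H -> lowvan 0 s H.
Proof. by move=> aZ ZH w hw lt; have [t <-] := ev_ex (ZH (vals w)); exact: aZ. Qed.

End Limits.

(** * Exactness of the rows in tensor degree at least 2 *)

Section Exactness.
Variables (k : fieldType) (A : gcAlgType k).
Implicit Types (F G : seq A -> A).

Lemma insert_op_tw e x F a u :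
  insert_op (tw e) x F (a :: u) = F (x :: a :: u) - insert_op (tw e) x (fcons (tw e a) F) u.
Proof. by []. Qed.

(** For nonempty [u] this is the Harrison condition for [[:: x]] and [u]. The empty word gives [F
    [:: x]], which vanishes by arity; hence the exclusion of tensor degree 1. *)
Lemma insert_op_good e x p m F : homog e x -> good p F -> arity m F -> m != 1%N ->
  forall u, insert_op (tw e) x F u = 0.
Proof.
move=> hx [mF dF nF sF] aF m1; suff -> : insert_op (tw e) x F = 0 by [].
apply: mlin_ext; [exact: mlin_insert_op|exact: mlin0|].
have shE (w : seq (bool * A)) G : mlin G -> Forall (@phom k A) w ->
    insert_op (tw e) x G (vals w) = sh (@fst _ _) [:: (odd e, x)] w (fun w => G (vals w)).
  elim: w G => // t w IH G mG [ht hw]; rewrite vals_cons insert_op_tw sh_cons.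
  congr (_ + _); rewrite (_ : ssgn _ _ _ = ~~ (odd e && t.1)); last first.
    by rewrite /ssgn /= addbF andbC.
  rewrite signrN scaleNr; congr (- _).
  rewrite (phom_tw e ht) mlin_fconsZ // -(IH (fcons t.2 G)) ?fctE //; last exact: mlin_fcons.
  by rewrite insert_opZ.
rewrite /= => w hw.
pose w' := [seq (odd t.1, t.2) | t <- w].
have vw : vals w = vals w' by rewrite /vals -map_comp.
have hw' : Forall (@phom k A) w' by rewrite /w' => {vw w'}; elim: w hw => //= t w IH [ht /IH hw];
  split=> //; exists t.1.
have [w0|w0] := eqVneq w [::].
  by rewrite w0 /= aF //= => /esym/eqP; rewrite (negPf m1).
rewrite vw shE // sF //; first by split=> //; exists e.
by rewrite /w' size_map lt0n size_eq0.
Qed.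

Lemma der_op_D0 (t D : {linear A -> A}) F u : mlin F -> (forall a, t (t a) = a) ->
  Forall (fun a => D a = 0 /\ D (t a) = 0) u -> der_op t D F u = 0.
Proof.
move=> + tt; elim: u F => // a u IH F mF [[Da _] Du].
by rewrite der_op_cons Da mlin_head0 // add0r IH //; exact: mlin_fcons.
Qed.

Lemma htpy_op_D0 (t D : {linear A -> A}) x F u : mlin F -> (forall a, t (t a) = a) ->
  Forall (fun a => D a = 0 /\ D (t a) = 0) u -> htpy_op t D x F u = 0.
Proof.
move=> + tt; elim: u F => // a u IH F mF Du.
rewrite htpy_op_cons der_op_D0 ?sub0r ?IH ?oppr0 //; try exact: mlin_fcons.
by case: Du.
Qed.

(** The bound depends on [u] alone, uniformly in [F]: a sum of cochains that vanish in ever higher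
    input degrees is thus finite at each word. *)
Lemma lowvan_bound u : exists N, forall F n s, (N + n <= s)%N -> mlin F -> lowvan n s F -> F u = 0.
Proof.
elim: u => [|a u [N IH]].
  exists 1%N => F n s ns mF vF; apply: (vF [::]) => //.
  by rewrite addn0.
move: a; apply: homog_ind => [|a b [N1 h1] [N2 h2]|q a ha].
- by exists 0%N => F n s _ mF _; exact: mlin_head0.
- exists (N1 + N2)%N => F n s ns mF vF; rewrite mlinD // (h1 F n s) ?(h2 F n s) ?addr0 //;
    by rewrite (leq_trans _ ns) // leq_add2r ?leq_addl ?leq_addr.
exists (N + q)%N => F n s ns mF vF; apply: (IH (fcons a F) (n + q)%N s).
- by rewrite [(n + q)%N]addnC addnA.
- exact: mlin_fcons.
- exact: lowvan_fcons.
Qed.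

Lemma der_op_id (D : {linear A -> A}) F : der_op (tw 0) D F = der_op idfun D F.
Proof.
apply: funext => u; elim: u F => // a u IH F.
by rewrite der_op_tw der_op_cons tw0 IH.
Qed.

Section Generators.
Variables (I : choiceType) (deg : I -> nat) (x : I -> A) (D : I -> {linear A -> A}).
Hypothesis char0 : [pchar k] =i pred0.
Hypothesis deg_gt0 : forall i, (0 < deg i)%N.
Hypothesis hx : forall i, homog (deg i) (x i).
Hypothesis DM : forall i a b, D i (a * b) = D i a * b + tw (deg i) a * D i b.
Hypothesis De : forall i q a, homog q a -> (deg i <= q)%N -> homog (q - deg i) (D i a).
Hypothesis D_lt : forall i q a, homog q a -> (q < deg i)%N -> D i a = 0.
Hypothesis Dfin : forall a, exists S : {fset I}, forall i, i \notin S -> D i a = 0.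
Hypothesis Euler : forall n a (S : {fset I}), homog n a ->
  (forall i, i \notin S -> D i a = 0) ->
  \sum_(i <- S) (deg i)%:R *: (x i * D i a) = n%:R *: a.

Local Notation L i := (der_op (tw (deg i)) (D i)).
Local Notation h i := (htpy_op (tw (deg i)) (D i) (x i)).
Local Notation LE i := (der_op idfun (mulD (x i) (D i))).

(** The twist depends on [i] only through the parity of [deg i], so the supports of [a] and of
    [tw 1 a] suffice for all [i] at once. *)
Lemma Dfin_word u : exists S : {fset I}, forall i, i \notin S ->
  Forall (fun a => D i a = 0 /\ D i (tw (deg i) a) = 0) u.
Proof.
elim: u => [|a u [S hS]]; first by exists fset0.
have [S1 h1] := Dfin a; have [S2 h2] := Dfin (tw 1 a).
exists (S1 `|` S2 `|` S)%fset => i; rewrite !inE !negb_or => /andP[/andP[i1 i2] iS].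
split; last exact: hS.
rewrite tw_odd; split; first exact: h1.
by case: odd; [exact: h2|rewrite tw0 h1].
Qed.

Lemma partial_op_h i p m F : good p F -> arity m F -> m != 1%N -> partial_op (tw p) F = 0 ->
  partial_op (tw p) (h i F) = mull (tw p (x i)) (L i F) - LE i F.
Proof.
move=> gF aF m1 dF; apply: partial_op_htpy_op => //.
- by move=> a b; exact: twM.
- exact: twK.
- by move=> a; exact: homogC.
- by case: gF.
exact: (insert_op_good (hx i) gF aF m1).
Qed.

Lemma good_LE i p F : good p F -> good p (LE i F).
Proof.
rewrite -der_op_id -{2}[p]addn0; apply: good_der_op => [q a ha|a ha]; rewrite /= /mulD.
  have [le|lt] := leqP (deg i) q; last by rewrite (D_lt ha lt) mulr0; exact: homog0.
  by rewrite addn0 -(subnKC le); apply: homog_mul => //; exact: De.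
by rewrite /mulD (D_lt ha) ?mulr0.
Qed.

(** Each x_i D_i acts on words as an untwisted derivation, so Euler's formula for the single letters
    adds up to the total degree of the word. *)
Lemma sum_LE F w (S : {fset I}) : mlin F -> Forall (@dhom k A) w ->
  (forall i, i \notin S -> Forall (fun a => D i a = 0 /\ D i (tw (deg i) a) = 0) (vals w)) ->
  \sum_(i <- S) (deg i)%:R *: LE i F (vals w) = (wdeg w)%:R *: F (vals w).
Proof.
elim: w F => [|[n a] w IH] F mF hw hS.
  by rewrite big1 ?scale0r // => i _; rewrite scaler0.
case: hw => ha hw; rewrite vals_cons.
under eq_bigr => i _ do rewrite der_op_cons scalerDr.
rewrite big_split /=; have mG := mlin_fcons a mF.
rewrite [X in _ + X](IH (fcons a F)) //; last by move=> i /hS[].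
rewrite -[wdeg (_ :: _)]/(n + wdeg w)%N natrD scalerDl; congr (_ + _).
have -> : \sum_(i <- S) (deg i)%:R *: F (mulD (x i) (D i) a :: vals w) =
    F (\sum_(i <- S) (deg i)%:R *: (x i * D i a) :: vals w).
  elim/big_rec2: _ => [|i y z _ ->]; first by rewrite mlin_head0.
  by rewrite (mF [::] (vals w)).
rewrite (Euler (n := n)) //; last by move=> i /hS[[]].
by have := mlin_fconsZ n%:R a mF => /(congr1 (@^~ (vals w))).
Qed.

Definition fsub (S S' : {fset I}) : Prop := (S `<=` S')%fset.

Lemma fsub_directed S S' : exists2 S'', fsub S S'' & fsub S' S''.
Proof. by exists (S `|` S')%fset; rewrite /fsub ?fsubsetUl ?fsubsetUr. Qed.

Lemma kill_lowest p m s F : (0 < m)%N -> (0 < s)%N -> good p F -> arity m.+1 F ->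
  lowvan 0 s F -> partial_op (tw p) F = 0 ->
  exists G, [/\ good p G, arity m G, lowvan 0 s G, good p (F - partial_op (tw p) G) &
    arity m.+1 (F - partial_op (tw p) G) /\ lowvan 0 s.+1 (F - partial_op (tw p) G)].
Proof.
move=> m0 s0 gF aF vF dF; have [mF _ _ _] := gF.
have m1 : m.+1 != 1%N by rewrite eqSS -lt0n.
(* On words of degree [s] the weighted sum of the homotopies has coboundary [- s] times [F];
   characteristic zero and [s > 0] make [s] invertible. *)
pose c : k := - s%:R^-1.
pose Z (S : {fset I}) := c *: \sum_(i <- S) (deg i)%:R *: h i F.
have [G ZG] : exists G, limit fsub Z G.
  apply: limit_ex => u; have [S0 hS0] := Dfin_word u.
  (* Enlarging the set beyond a support of [u] adds only vanishing terms, so the values at [u]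
     stabilize. *)
  exists (Z S0 u), S0 => S sub; rewrite /Z !fctE !fct_sumE; congr (_ *: _).
  apply/esym/big_fset_incl => // i iS iS0.
  by rewrite fctE htpy_op_D0 ?scaler0 //; [exact: twK|exact: hS0].
have dZ S : partial_op (tw p) (Z S) =
    c *: \sum_(i <- S) (deg i)%:R *: (mull (tw p (x i)) (L i F) - LE i F).
  rewrite partial_opZ partial_op_sum; congr (_ *: _); apply: eq_bigr => i _.
  by rewrite partial_opZ (partial_op_h i gF aF).
have fref S : fsub S S by exact: fsubset_refl.
have ftr S S' S'' : fsub S S' -> fsub S' S'' -> fsub S S'' by exact: fsubset_trans.
have lP : limit fsub (fun S => partial_op (tw p) (Z S)) (partial_op (tw p) G).
  exact: (limit_partial_op ftr fsub_directed fset0).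
have gL i : good p (mull (tw p (x i)) (L i F)).
  by apply: good_mull_der_op => //; [exact: De|exact: D_lt].
have gG : good p G.
  apply: (limit_good fref ftr fsub_directed) ZG => S.
  apply/goodZ/good_sum => i; apply/goodZ/good_htpy_op => //; [exact: De|exact: D_lt].
have gP : good p (partial_op (tw p) G).
  apply: (limit_good fref ftr fsub_directed) lP => S; rewrite dZ.
  by apply/goodZ/good_sum => i; apply/goodZ/goodB; last exact: good_LE.
exists G; split => //.
- apply: (limit_arity fref) ZG => S; rewrite -[Z S]addr0; apply: arity_lin => //.
  apply: arity_sum => i; rewrite -[_ *: _]addr0; apply: arity_lin => //.
  exact: arity_htpy_op.
- apply: (limit_lowvan fref) ZG => S w hw lt; rewrite /Z fctE fct_sumE.
  rewrite big1 ?scaler0 // => i _; rewrite fctE.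
  by rewrite (lowvan_htpy_op (hx i) (@De i) (@D_lt i) mF vF) ?scaler0.
- exact: goodB.
split.
  rewrite addrC -scaleN1r; apply: arity_lin => //.
  apply: (limit_arity fref) lP => S; rewrite dZ -[_ *: _]addr0; apply: arity_lin => //.
  apply: arity_sum => i; rewrite -[_ *: _]addr0; apply: arity_lin => //.
  rewrite addrC -scaleN1r; apply: arity_lin; first by rewrite -der_op_id; exact: arity_der_op.
  by move=> u su; rewrite /mull (arity_der_op _ _ aF) ?mulr0.
move=> w hw; rewrite add0n ltnS => lt.
(* [S] has to contain a support of the word, for Euler's formula, and to be so large that the
   coboundary of [Z S] agrees with that of [G] at this word. *)
have [S0 hS0] := Dfin_word (vals w); have [S1 hS1] := lP (vals w).
have [S sub0 sub1] := fsub_directed S0 S1.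
rewrite !fctE -(hS1 S sub1) dZ fctE fct_sumE.
rewrite (eq_bigr (fun i => - ((deg i)%:R *: LE i F (vals w)))); last first.
  move=> i _; rewrite !fctE (lowvan_mull_der_op (deg_gt0 i) (@De i) (@D_lt i) (tw p (x i)) mF vF) //.
  by rewrite sub0r scalerN.
rewrite sumrN sum_LE //; last first.
  by move=> i iS; apply: hS0; apply: contra iS; exact: (fsubsetP sub0).
rewrite scalerN -scaleNr opprK /c scalerA.
have [lt'|ge] := ltnP (wdeg w) s; first by rewrite vF ?scaler0 ?subr0.
have -> : wdeg w = s by apply/eqP; rewrite eqn_leq lt.
by rewrite mulVf ?scale1r ?subrr // (proj1 (pcharf0P k) char0) -lt0n.
Qed.

(** [G] is the infinite sum of the corrections for the input degrees 1, 2, and so on. The correction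
    for degree s vanishes in input degrees below s, so the sum is finite at each word, and the
    remainder [Fs] tends to 0. *)
Lemma partial_exact p m F : (0 < m)%N -> good p F -> arity m.+1 F -> partial_op (tw p) F = 0 ->
  exists G, [/\ good p G, arity m G & partial_op (tw p) G = F].
Proof.
move=> m0 gF aF dF; have [mF _ nF _] := gF.
pose inv s F := [/\ good p F, arity m.+1 F, lowvan 0 s F & partial_op (tw p) F = 0].
(* The hypotheses are placed under the existential quantifier, so that choice gives a function on
   all pairs. *)
have /choice[g gP] : forall sF : nat * (seq A -> A), exists G, (0 < sF.1)%N -> inv sF.1 sF.2 ->
    [/\ good p G, arity m G, lowvan 0 sF.1 G & inv sF.1.+1 (sF.2 - partial_op (tw p) G)].
  move=> [s H]; have [[s0 [gH aH vH dH]]|] := EM ((0 < s)%N /\ inv s H); last first.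
    by move=> nh; exists 0 => s0 iH; case: nh.
  have [G [? ? ? ? [? ?]]] := kill_lowest m0 s0 gH aH vH dH.
  exists G => _ _; split=> //; split=> //.
  by rewrite partial_opB dH partial_op_partial_op ?subr0 // => a b; exact: twM.
pose Fs := fix Fs n := if n is n'.+1 then Fs n' - partial_op (tw p) (g (n'.+1, Fs n')) else F.
pose Gs n := g (n.+1, Fs n).
have Finv n : inv n.+1 (Fs n).
  elim: n => [|n IH]; last by have [] := gP (n.+1, Fs n) isT IH.
  (* The induction can start at degree 1: a nonempty word of total degree 0 begins with a letter of
     degree 0, where a normalized cochain vanishes, and the empty word is excluded by arity. *)
  split=> // -[|[q a] w]; first by move=> _ _; exact: aF.
  move=> [/= ha _]; rewrite add0n ltnS leqn0 addn_eq0 => /andP[/eqP q0 _].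
  by apply: normd_head => //; rewrite -q0.
have Ginv n : [/\ good p (Gs n), arity m (Gs n) & lowvan 0 n.+1 (Gs n)].
  by have [] := gP (n.+1, Fs n) isT (Finv n).
pose Z N := \sum_(0 <= n < N) Gs n.
have ltr t s r : (t <= s)%N -> (s <= r)%N -> (t <= r)%N by exact: leq_trans.
have ldir t s : exists2 r, (t <= r)%N & (s <= r)%N.
  by exists (maxn t s); rewrite ?leq_maxl ?leq_maxr.
have [G ZG] : exists G, limit (fun t s => (t <= s)%N) Z G.
  apply: limit_ex => u; have [N hN] := lowvan_bound u.
  exists (Z N u), N => t Nt; rewrite /Z (@big_cat_nat _ _ _ N) //= fctE.
  rewrite [X in _ + X](_ : _ = 0) ?addr0 // fct_sumE big_nat big1 // => n /andP[Nn _].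
  have [[mG _ _ _] _ vG] := Ginv n; apply: (hN _ 0%N n.+1) => //.
  by rewrite addn0 (leq_trans Nn).
exists G; split.
- apply: (limit_good leqnn ltr ldir) ZG => N; apply: good_sum => n.
  by have [] := Ginv n.
- by apply: (limit_arity leqnn) ZG => N; apply: arity_sum => n; have [] := Ginv n.
have lP := limit_partial_op ltr ldir 0%N (tw p) ZG.
apply: (limit_uniq leqnn ltr ldir lP) => u.
have [N hN] := lowvan_bound u; exists N => t Nt.
have -> : partial_op (tw p) (Z t) = F - Fs t.
  elim: t {Nt} => [|t IH]; first by rewrite /Z big_geq // linear0 subrr.
  rewrite /Z big_nat_recr //= -/(Z t) linearD /= IH.
  by abel.
have [[mF' _ _ _] _ vF _] := Finv t.
rewrite !fctE (hN (Fs t) 0%N t.+1) ?subr0 // addn0.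
exact: leq_trans Nt _.
Qed.

End Generators.
End Exactness.

(** * Derivations of a free algebra *)

Section Generated.
Variables (k : fieldType) (I : Type) (deg : I -> nat) (A : gcAlgType k) (x : I -> A).
Hypothesis hx : forall i, homog (deg i) (x i).

(** Impredicative form of the subalgebra generated by the x_i: the least subspace that contains 1
    and is stable under left multiplication by generators. The induction principle then adds one
    generator at a time, as suits the Leibniz rule. *)
Definition generated : {pred A} := fun a => `[< forall P : A -> Prop, P 1 ->
  (forall i b, P b -> P (x i * b)) ->
  (forall c b b', P b -> P b' -> P (c *: b + b')) -> P a >].

Lemma generated1 : 1 \in generated.
Proof. by rewrite unfold_in; apply/asboolP => P P1 _ _. Qed.

Lemma generatedM i b : b \in generated -> x i * b \in generated.
Proof. by move=> /asboolP gb; apply/asboolP => P P1 PM PL; apply: (PM i); exact: (gb P). Qed.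

Lemma generatedP c b b' : b \in generated -> b' \in generated -> c *: b + b' \in generated.
Proof.
move=> /asboolP gb /asboolP gb'; apply/asboolP => P P1 PM PL.
by apply: (PL c); [exact: (gb P)|exact: (gb' P)].
Qed.

Lemma generated_ind (P : A -> Prop) : P 1 -> (forall i b, P b -> P (x i * b)) ->
  (forall c b b', P b -> P b' -> P (c *: b + b')) -> forall a, a \in generated -> P a.
Proof. by move=> P1 PM PL a /asboolP; apply. Qed.

Lemma generated_subalg : subalg_closed generated.
Proof.
split=> [|c u v|u v gu gv]; [exact: generated1|exact: generatedP|].
move: u gu; apply: generated_ind => [|i b|c b b' gb gb']; first by rewrite mul1r.
  by rewrite -mulrA; exact: generatedM.
by rewrite mulrDl -scalerAl; exact: generatedP.
Qed.

Lemma generated0 : 0 \in generated.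
Proof.
have := generatedP (-1) generated1 generated1.
by rewrite scaleN1r addNr.
Qed.

Lemma generated_hcomp n a : a \in generated -> hcomp n a \in generated.
Proof.
move=> ga; move: a ga n; apply: generated_ind => [n|i b gb n|c b b' gb gb' n].
- rewrite (hcomp_homog _ (@homog1 k A)); case: eqP => _; [exact: generated1|exact: generated0].
- have [le|lt] := leqP (deg i) n; last by rewrite (hcompM_lt _ (hx i)) //; exact: generated0.
  by rewrite -(subnKC le) (hcompM _ _ (hx i)); exact: generatedM.
by rewrite hcomp_linear; exact: generatedP.
Qed.

HB.instance Definition _ := GRing.isSubalgClosed.Build k A generated generated_subalg.

Record subgen := Subgen { subgen_val : A; _ : subgen_val \in generated }.
HB.instance Definition _ := [isSub for subgen_val].
HB.instance Definition _ := [Choice of subgen by <:].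
HB.instance Definition _ := [SubChoice_isSubAlgebra of subgen by <:].

Definition subgen_hcomp n (a : subgen) : subgen :=
  Subgen (generated_hcomp n (valP a)).

Fact subgen_hcomp_linear n : linear (subgen_hcomp n).
Proof. by move=> c u v; apply: val_inj; rewrite /= !linearP. Qed.

Fact subgen_hcomp_hcomp m n v :
  subgen_hcomp m (subgen_hcomp n v) = if m == n then subgen_hcomp n v else 0.
Proof. by apply: val_inj; rewrite /= hcomp_hcomp; case: eqP. Qed.

Fact subgen_hcomp_fin v : exists N, v == \sum_(n < N) subgen_hcomp n v.
Proof.
have [N /eqP vN] := hcomp_fin (val v); exists N; apply/eqP/val_inj.
by rewrite linear_sum.
Qed.

HB.instance Definition _ :=
  isGraded.Build k subgen subgen_hcomp_linear subgen_hcomp_hcomp subgen_hcomp_fin.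

Lemma subgen_homog n (a : subgen) : homog n a <-> homog n (val a).
Proof. by split=> [/(congr1 val)|h]; [|apply: val_inj]. Qed.

Fact subgen_homog1 : homog 0 (1 : subgen).
Proof. by apply/subgen_homog; exact: homog1. Qed.

Fact subgen_homogM m n (a b : subgen) : homog m a -> homog n b -> homog (m + n)%N (a * b).
Proof. by move=> /subgen_homog ha /subgen_homog hb; apply/subgen_homog/homog_mul. Qed.

Fact subgen_gradedC m n (a b : subgen) : homog m a -> homog n b ->
  a * b = (-1) ^+ (m * n)%N *: (b * a).
Proof.
move=> /subgen_homog ha /subgen_homog hb; apply: val_inj.
by rewrite /= (homog_comm ha hb).
Qed.

HB.instance Definition _ :=
  isGradedCommutative.Build k subgen subgen_homog1 subgen_homogM subgen_gradedC.

Definition subgen_incl (a : subgen) : A := subgen_val a.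
Fact subgen_incl_linear : linear subgen_incl. Proof. by []. Qed.
Fact subgen_incl_monoid : monoid_morphism subgen_incl. Proof. by []. Qed.
HB.instance Definition _ := GRing.isLinear.Build k subgen A _ subgen_incl subgen_incl_linear.
HB.instance Definition _ := GRing.isMonoidMorphism.Build subgen A subgen_incl subgen_incl_monoid.

(** The map from A to the generated subalgebra, followed by the inclusion, is an endomorphism that
    fixes the generators, hence the identity by uniqueness. *)
Lemma free_generated : free_on deg x -> forall a, a \in generated.
Proof.
move=> [_ A_free] a.
have gx i : x i \in generated by rewrite -[x i]mulr1; exact/generatedM/generated1.
have [i|phi [phi_h phi_x _]] := A_free subgen (fun i => Subgen (gx i)).
  by apply/subgen_homog; exact: hx.
have [//|psi0 [_ _ psi_uniq]] := A_free A x.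
pose psi : {lrmorphism A -> A} := subgen_incl \o phi.
have psiE : psi a = psi0 a.
  by apply: psi_uniq => [n b|i]; [move=> /phi_h /subgen_homog|rewrite /= phi_x].
have aE : idfun a = psi0 a by apply: psi_uniq.
rewrite -[a]/(idfun a) aE -psiE.
exact: valP.
Qed.

End Generated.

(** * Graded dual numbers *)

Section DualNumbers.
Variables (k : fieldType) (A : gcAlgType k).

(* A + eps A with eps^2 = 0 and |eps| = e; (a, b) stands for a + eps b *)
Definition dual_numbers (e : nat) : Type := (A * A)%type.

Variable e : nat.
Local Notation dual := (dual_numbers e).
HB.instance Definition _ := GRing.Lmodule.on dual.

Definition dual1 : dual := (1, 0).
(** The twist comes from moving eps to the left past [u.1]. A multiplicative map a -> a + eps D(a)
    thus encodes the twisted Leibniz rule for [D]. *)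
Definition dual_mul (u v : dual) : dual := (u.1 * v.1, u.2 * v.1 + tw e u.1 * v.2).

Fact dual_mulA : associative dual_mul.
Proof.
move=> u v w; congr pair; rewrite /=; first exact: mulrA.
by rewrite twM mulrDr mulrDl !mulrA addrA.
Qed.
Fact dual_mul1l : left_id dual1 dual_mul.
Proof. by case=> a b; rewrite /dual_mul /= tw1 !mul1r mul0r add0r. Qed.
Fact dual_mul1r : right_id dual1 dual_mul.
Proof. by case=> a b; rewrite /dual_mul /= !mulr1 mulr0 addr0. Qed.
Fact dual_mulDl : left_distributive dual_mul +%R.
Proof.
move=> u v w; congr pair; rewrite /= ?mulrDl //.
by rewrite linearD /= mulrDl addrACA.
Qed.
Fact dual_mulDr : right_distributive dual_mul +%R.
Proof. by move=> u v w; congr pair; rewrite /= ?mulrDr // addrACA. Qed.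
Fact dual_oner_neq0 : dual1 != 0.
Proof. by apply/eqP => -[/eqP]; rewrite oner_eq0. Qed.
HB.instance Definition _ := GRing.Zmodule_isNzRing.Build dual
  dual_mulA dual_mul1l dual_mul1r dual_mulDl dual_mulDr dual_oner_neq0.
Fact dual_scaleAl (c : k) (u v : dual) : c *: dual_mul u v = dual_mul (c *: u) v.
Proof.
case: u v => u1 u2 [v1 v2]; congr pair; rewrite /=; first exact: scalerAl.
by rewrite linearZ /= scalerDr !scalerAl.
Qed.
HB.instance Definition _ := GRing.Lmodule_isLalgebra.Build k dual dual_scaleAl.
Fact dual_scaleAr (c : k) (u v : dual) : c *: dual_mul u v = dual_mul u (c *: v).
Proof.
case: u v => u1 u2 [v1 v2]; congr pair; rewrite /=; first exact: scalerAr.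
by rewrite scalerDr !scalerAr.
Qed.
HB.instance Definition _ := GRing.Lalgebra_isAlgebra.Build k dual dual_scaleAr.

(** Since eps has degree [e], a map into the dual numbers that preserves degree has a second
    component that lowers degree by [e] and vanishes below [e]. *)
Definition dual_hcomp n (u : dual) : dual :=
  (hcomp n u.1, if (e <= n)%N then hcomp (n - e) u.2 else 0).

Fact dual_hcomp_linear n : linear (dual_hcomp n).
Proof.
move=> c u v; congr pair; rewrite /= ?hcomp_linear //.
by case: ifP => _; rewrite ?hcomp_linear // scaler0 addr0.
Qed.

Fact dual_hcomp_hcomp m n v :
  dual_hcomp m (dual_hcomp n v) = if m == n then dual_hcomp n v else 0.
Proof.
rewrite [RHS](_ : _ = (if m == n then (dual_hcomp n v).1 else 0,
  if m == n then (dual_hcomp n v).2 else 0)); last by case: eqP.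
congr pair; rewrite /= ?hcomp_hcomp //.
have [le|] := leqP e m; have [le'|] := leqP e n; rewrite ?hcomp_hcomp ?linear0 ?if_same //.
- by rewrite -(eqn_add2r e) !subnK.
- by move=> lt; rewrite ltn_eqF // (leq_trans lt le').
Qed.

Fact dual_hcomp_fin v : exists N, v == \sum_(n < N) dual_hcomp n v.
Proof.
have [N1 h1] := hcomp_bound v.1; have [N2 h2] := hcomp_bound v.2.
exists (e + maxn N1 N2)%N; apply/eqP.
have -> : \sum_(n < e + maxn N1 N2) dual_hcomp n v =
    (\sum_(n < e + maxn N1 N2) hcomp n v.1, \sum_(n < maxn N1 N2) hcomp n v.2) :> dual.
  have pairD (r : seq 'I_(e + maxn N1 N2)) (f g : _ -> A) :
      \sum_(i <- r) ((f i, g i) : dual) = (\sum_(i <- r) f i, \sum_(i <- r) g i).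
    by elim/big_rec3: _ => // i y1 y2 y3 _ ->.
  rewrite pairD; congr pair; rewrite big_split_ord /= big1 ?add0r => [|i _].
    by apply: eq_bigr => i _; rewrite leq_addr addKn.
  by rewrite leqNgt ltn_ord.
rewrite -!hcomp_sum; first by case: v {h1 h2}.
  by move=> n le; apply: h2; rewrite (leq_trans _ le) ?leq_maxr.
by move=> n le; apply: h1; rewrite (leq_trans _ le) // (leq_trans (leq_maxl _ N2)) ?leq_addl.
Qed.

HB.instance Definition _ :=
  isGraded.Build k dual dual_hcomp_linear dual_hcomp_hcomp dual_hcomp_fin.

Lemma dual_homog n (u : dual) : homog n u <->
  homog n u.1 /\ (if (e <= n)%N then homog (n - e) u.2 else u.2 = 0).
Proof.
split=> [h|[h1 h2]].
  have h1 := congr1 fst h; have h2 := congr1 snd h; split=> //.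
  by move: h2 => /=; case: ifP.
case: u h1 h2 => a b h1 h2; rewrite /homog; congr pair; first exact: h1.
by rewrite /=; move: h2 => /=; case: ifP => // _ ->.
Qed.

Fact dual_homog1 : homog 0 (1 : dual).
Proof. by apply/dual_homog; split; [exact: homog1|case: ifP => // _; exact: homog0]. Qed.

Fact dual_homogM m n (u v : dual) : homog m u -> homog n v -> homog (m + n)%N (u * v).
Proof.
move=> /dual_homog[u1 u2] /dual_homog[v1 v2]; apply/dual_homog; split; first exact: homog_mul.
rewrite /=; have [le|lt] := leqP e (m + n); last first.
  rewrite ifN in u2; last by rewrite -ltnNge (leq_ltn_trans _ lt) ?leq_addr.
  rewrite ifN in v2; last by rewrite -ltnNge (leq_ltn_trans _ lt) ?leq_addl.
  by rewrite u2 v2 mul0r mulr0 addr0.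
apply: homogD.
  case: ifP u2 => [le'|_ ->]; last by rewrite mul0r; exact: homog0.
  by move=> u2; rewrite -addnBAC //; exact: homog_mul.
case: ifP v2 => [le'|_ ->]; last by rewrite mulr0; exact: homog0.
by move=> v2; rewrite -addnBA //; apply: homog_mul => //; exact: homog_tw.
Qed.

Fact dual_gradedC m n (u v : dual) : homog m u -> homog n v ->
  u * v = (-1) ^+ (m * n)%N *: (v * u).
Proof.
move=> /dual_homog[u1 u2] /dual_homog[v1 v2]; congr pair; rewrite /= ?(homog_comm u1 v1) //.
rewrite scalerDr addrC (tw_homog _ u1) (tw_homog _ v1); congr (_ + _).
  case: ifP v2 => [le v2|_ ->]; last by rewrite mulr0 mul0r scaler0.
  rewrite -scalerAl (homog_comm u1 v2) scalerA -exprD; congr (_ ^+ _ *: _).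
  by rewrite [(e * m)%N]mulnC -mulnDr subnKC.
case: ifP u2 => [le u2|_ ->]; last by rewrite mulr0 mul0r scaler0.
rewrite -scalerAl scalerA (homog_comm u2 v1); congr (_ *: _).
rewrite -exprD -signr_odd -[RHS]signr_odd oddD !oddM oddB //.
by case: (odd m) (odd n) (odd e) => [] [] [].
Qed.

HB.instance Definition _ :=
  isGradedCommutative.Build k dual dual_homog1 dual_homogM dual_gradedC.

Definition dual_fst (u : dual) : A := u.1.
Fact dual_fst_linear : linear dual_fst. Proof. by []. Qed.
Fact dual_fst_monoid : monoid_morphism dual_fst. Proof. by []. Qed.
HB.instance Definition _ := GRing.isLinear.Build k dual A _ dual_fst dual_fst_linear.
HB.instance Definition _ := GRing.isMonoidMorphism.Build dual A dual_fst dual_fst_monoid.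

Definition dual_snd (u : dual) : A := u.2.
Fact dual_snd_linear : linear dual_snd. Proof. by []. Qed.
HB.instance Definition _ := GRing.isLinear.Build k dual A _ dual_snd dual_snd_linear.

End DualNumbers.

(** * Partial derivatives on a free algebra and Euler's formula *)

Section FreeAlgebra.
Variables (k : fieldType) (I : choiceType) (deg : I -> nat) (A : gcAlgType k) (x : I -> A).
Hypotheses (A_free : free_on deg x) (A_connected : connected A).

Let hx i : homog (deg i) (x i). Proof. by case: A_free. Qed.

Lemma free_ind (P : A -> Prop) : P 1 -> (forall i b, P b -> P (x i * b)) ->
  (forall c b b', P b -> P b' -> P (c *: b + b')) -> forall a, P a.
Proof.
move=> P1 PM PL a; apply: (generated_ind P1 PM PL).
exact: (free_generated hx A_free).
Qed.

(** A generator of degree 0 would be a scalar by connectedness, hence fixed by every algebra map;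
    but freeness provides one that sends x_i to x_i + 1. *)
Lemma deg_gt0 i : (0 < deg i)%N.
Proof.
rewrite lt0n; apply/eqP => i0; have := hx i; rewrite i0 => /A_connected[c xE].
have [_ /(_ A (fun j => if j == i then x i + 1 else x j))[j|phi [_ phi_x _]]] := A_free.
  case: eqP => [->|_]; last exact: hx.
  by apply: homogD; [exact: hx|rewrite i0; exact: homog1].
have := phi_x i; rewrite eqxx xE rmorph_alg => /eqP.
by rewrite -subr_eq0 opprD addNKr oppr_eq0 oner_eq0.
Qed.

(** Extend x_j -> x_j + eps delta_ij to an algebra map into the dual numbers with |eps| = |x_i|. Its
    first component is the identity by uniqueness, and its second is the derivative. *)
Lemma partial_ex i : exists D : {linear A -> A},
  [/\ forall j, D (x j) = if j == i then 1 else 0,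
      forall a b, D (a * b) = D a * b + tw (deg i) a * D b,
      forall q a, homog q a -> (deg i <= q)%N -> homog (q - deg i) (D a)
    & forall q a, homog q a -> (q < deg i)%N -> D a = 0].
Proof.
pose y j : dual_numbers A (deg i) := (x j, if j == i then 1 else 0).
have [_ /(_ _ y)[j|phi [phi_h phi_x _]]] := A_free.
  apply/dual_homog; split; first exact: hx.
  rewrite /y /=; case: eqP => [->|_]; last by case: ifP => // _; exact: homog0.
  by rewrite leqnn subnn; exact: homog1.
have phi1 a : (phi a).1 = a.
  have [_ /(_ A x hx)[psi0 [_ _ psi_uniq]]] := A_free.
  pose psi : {lrmorphism A -> A} := @dual_fst k A (deg i) \o phi.
  have psiE : psi a = psi0 a.
    by apply: psi_uniq => [n b|j]; [move=> /phi_h /dual_homog[]|rewrite /= phi_x].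
  have aE : idfun a = psi0 a by apply: psi_uniq.
  by rewrite -[RHS]/(idfun a) aE -psiE.
pose D : {linear A -> A} := @dual_snd k A (deg i) \o phi.
have DE a : D a = (phi a).2 by [].
exists D; split=> [j|a b|q a ha le|q a ha lt]; rewrite !DE.
- by rewrite phi_x.
- by rewrite rmorphM /= !phi1.
- by have /dual_homog[_] := phi_h _ _ ha; rewrite le.
by have /dual_homog[_] := phi_h _ _ ha; rewrite leqNgt lt.
Qed.

Lemma derivation1 p (t : A -> A) : derivation p t -> t 1 = 0.
Proof.
move=> [_ tM]; have := tM 1 1; rewrite tw1 !mul1r mulr1 => /eqP.
by rewrite -subr_eq subrr eq_sym => /eqP.
Qed.

Lemma derivation_ext p (t s : A -> A) : derivation p t -> derivation p s ->
  (forall i, t (x i) = s (x i)) -> t =1 s.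
Proof.
move=> dt ds ts; have [[t_lin _] tM] := dt; have [[s_lin _] sM] := ds.
apply: free_ind => [|i b tsb|c b b' tsb tsb'].
- by rewrite (derivation1 dt) (derivation1 ds).
- by rewrite tM sM ts tsb.
by rewrite t_lin s_lin tsb tsb'.
Qed.

Section Partials.
Variable D : I -> {linear A -> A}.
Hypothesis DP : forall i, 
  [/\ forall j, D i (x j) = if j == i then 1 else 0,
      forall a b, D i (a * b) = D i a * b + tw (deg i) a * D i b,
      forall q a, homog q a -> (deg i <= q)%N -> homog (q - deg i) (D i a)
    & forall q a, homog q a -> (q < deg i)%N -> D i a = 0].

Lemma Dx i j : D i (x j) = if j == i then 1 else 0.
Proof. by case: (DP i). Qed.
Lemma DM i a b : D i (a * b) = D i a * b + tw (deg i) a * D i b.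
Proof. by case: (DP i). Qed.
Lemma De i q a : homog q a -> (deg i <= q)%N -> homog (q - deg i) (D i a).
Proof. by case: (DP i) => _ _ + _; apply. Qed.
Lemma D_lt i q a : homog q a -> (q < deg i)%N -> D i a = 0.
Proof. by case: (DP i) => _ _ _; apply. Qed.

Lemma Dfin a : exists S : {fset I}, forall i, i \notin S -> D i a = 0.
Proof.
move: a; apply: free_ind => [|i b [S hS]|c b b' [S hS] [S' hS']].
- by exists fset0 => i _; apply: (D_lt (q := 0)); [exact: homog1|exact: deg_gt0].
- exists (i |` S)%fset => j; rewrite !inE negb_or => /andP[ji jS].
  by rewrite DM Dx eq_sym (negPf ji) mul0r add0r hS ?mulr0.
exists (S `|` S')%fset => j; rewrite !inE negb_or => /andP[jS jS'].
by rewrite linearP hS // hS' // scaler0 addr0.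
Qed.

Definition supp a : {fset I} := projT1 (cid (Dfin a)).

Lemma suppP a i : i \notin supp a -> D i a = 0.
Proof. by rewrite /supp; case: cid => S; exact. Qed.

(** The derivation with prescribed values y_i on the generators. The sum runs over a chosen support
    of [a]; by [thetaE] any finite set outside of which the derivatives vanish serves. *)
Definition theta (y : I -> A) a : A := \sum_(i <- supp a) y i * D i a.

Lemma thetaE y (S : {fset I}) a : (forall i, i \notin S -> D i a = 0) ->
  theta y a = \sum_(i <- S) y i * D i a.
Proof.
move=> hS; rewrite /theta.
rewrite (big_fset_incl _ (fsubsetUl (supp a) S)) /=; last first.
  by move=> i _ /suppP ->; rewrite mulr0.
apply/esym/big_fset_incl => [|i _ /hS ->]; first exact: fsubsetUr.
by rewrite mulr0.
Qed.

Lemma theta_x y j : theta y (x j) = y j.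
Proof.
rewrite (@thetaE _ [fset j]%fset) ?big_seq_fset1 ?Dx ?eqxx ?mulr1 // => i.
by rewrite inE Dx eq_sym => /negPf ->.
Qed.

Lemma theta_linear y : linear (theta y).
Proof.
move=> c a b; pose S := (supp a `|` supp b)%fset.
have aS i : i \notin S -> D i a = 0 by rewrite inE negb_or => /andP[/suppP].
have bS i : i \notin S -> D i b = 0 by rewrite inE negb_or => /andP[_ /suppP].
rewrite !(@thetaE _ S) // => [|i iS]; last by rewrite linearP aS // bS // scaler0 addr0.
rewrite scaler_sumr -big_split; apply: eq_bigr => i _.
by rewrite linearP mulrDr scalerAr.
Qed.

Lemma theta_derivation p y : (forall i, homog (deg i + p)%N (y i)) -> derivation p (theta y).
Proof.
move=> hy; split; [split; first exact: theta_linear|].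
  move=> n a ha; apply: homog_sum => i _.
  have [le|lt] := leqP (deg i) n; last by rewrite (D_lt ha lt) mulr0; exact: homog0.
  by rewrite -(subnKC le) addnAC; apply: homog_mul => //; exact: De.
move=> a b; pose S := (supp a `|` supp b)%fset.
have aS i : i \notin S -> D i a = 0 by rewrite inE negb_or => /andP[/suppP].
have bS i : i \notin S -> D i b = 0 by rewrite inE negb_or => /andP[_ /suppP].
rewrite !(@thetaE _ S) // => [|i iS]; last by rewrite DM aS // bS // mul0r mulr0 addr0.
rewrite mulr_suml mulr_sumr -big_split; apply: eq_bigr => i _ /=.
rewrite DM mulrDr mulrA; congr (_ + _); rewrite !mulrA; congr (_ * _).
(* Moving y_i past [a] costs a twist by deg i + p, and together with the twist by p this has the
   parity of deg i. *)
rewrite -(homogC _ (hy i)) tw_tw; congr (_ * _).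
by rewrite tw_odd [RHS]tw_odd -addnA !oddD addbb addbF.
Qed.

(** The left side is the degree 0 derivation with values |x_i| x_i on the generators. Multiplying by
    one more generator raises both degree and eigenvalue by |x_i|; the induction treats all
    components [hcomp n] at once. *)
Lemma Euler n a (S : {fset I}) : homog n a -> (forall i, i \notin S -> D i a = 0) ->
  \sum_(i <- S) (deg i)%:R *: (x i * D i a) = n%:R *: a.
Proof.
move=> ha hS; pose y i := (deg i)%:R *: x i.
transitivity (theta y a).
  by rewrite (thetaE _ hS); apply: eq_bigr => i _; rewrite scalerAl.
have hy i : homog (deg i + 0)%N (y i) by rewrite addn0; apply: homogZ.
have [[tl _] tM] := theta_derivation hy.
have t0 : theta y 0 = 0 by have := tl (-1) 0 0; rewrite scaler0 addr0 scaleN1r addNr.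
rewrite -{1 2}ha; move: a {ha hS} n; apply: free_ind => [n|i b hb n|c b b' hb hb' n].
- rewrite (hcomp_homog _ (@homog1 k A)); case: eqP => [->|_].
    by rewrite (derivation1 (theta_derivation hy)) scale0r.
  by rewrite t0 scaler0.
- have [le|lt] := leqP (deg i) n; last first.
    by rewrite (hcompM_lt _ (hx i)) // t0 scaler0.
  rewrite -(subnKC le) (hcompM _ _ (hx i)) tM theta_x tw0 hb natrD scalerDl.
  by rewrite scalerAl scalerAr.
by rewrite hcomp_linear tl hb hb' scalerDr !scalerA mulrC.
Qed.

End Partials.

Lemma partials_ex : exists D : I -> {linear A -> A}, forall i,
  [/\ forall j, D i (x j) = if j == i then 1 else 0,
      forall a b, D i (a * b) = D i a * b + tw (deg i) a * D i b,
      forall q a, homog q a -> (deg i <= q)%N -> homog (q - deg i) (D i a)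
    & forall q a, homog q a -> (q < deg i)%N -> D i a = 0].
Proof. by have /choice[D DP] := partial_ex; exists D. Qed.

End FreeAlgebra.

(** * Tensor cochains and cochains on words *)

Section ShufflePermutations.
Local Open Scope nat_scope.

(** A permutation is split by the index that it sends to 0. This is the first letter of the permuted
    word, on which the recursion of [sh] operates. *)
Lemma lift_perm_bij n : bijective (fun p : 'I_n.+1 * 'S_n => lift_perm p.1 ord0 p.2).
Proof.
apply: inj_card_bij => [[i s] [j t] /= st|]; last first.
  by rewrite card_prod !card_Sn card_ord factS.
have ij : i = j.
  by apply: (@perm_inj _ (lift_perm i ord0 s)); rewrite {2}st !lift_perm_id.
congr pair => //; apply/permP => l; apply: (@lift_inj _ ord0).
by rewrite -(lift_perm_lift i) st ij lift_perm_lift.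
Qed.

Lemma lt_lift n (i : 'I_n.+1) (j l : 'I_n) : (lift i j < lift i l) = (j < l).
Proof. by rewrite /= /bump; case: (leqP i j); case: (leqP i l); lia. Qed.

Lemma shuffleP n r (s : 'S_n) :
  reflect (forall i j : 'I_n, i < j -> (j < r) || (r <= i) -> s i < s j) (shuffle r s).
Proof.
apply: (iffP idP) => [/forallP sh i j ij jr|h].
  by have /forallP/(_ j)/implyP := sh i; apply; rewrite ij.
apply/forallP => i; apply/forallP => j; apply/implyP => /andP[ij jr].
exact: h.
Qed.

Lemma shuffle_lift n r r1 (i0 : 'I_n.+1) (t : 'S_n) :
  (forall j : 'I_n, (lift i0 j < r) = (j < r1)) ->
  (forall i : 'I_n.+1, i < i0 -> ~~ ((i0 < r) || (r <= i))) ->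
  shuffle r (lift_perm i0 ord0 t) = shuffle r1 t.
Proof.
move=> lr i0r; have rl (j : 'I_n) : (r <= lift i0 j) = (r1 <= j) by rewrite leqNgt lr -leqNgt.
apply/shuffleP/shuffleP => h i j.
  by move: (h (lift i0 i) (lift i0 j)); rewrite lt_lift lr rl !lift_perm_lift.
case: (unliftP i0 j) => [j'|] ->; last by move=> /i0r/negPf ->.
case: (unliftP i0 i) => [i'|] ->; last by rewrite lift_perm_id lift_perm_lift.
by rewrite lt_lift lr rl !lift_perm_lift; exact: h.
Qed.

(** The first letter of a shuffled word heads one of the two blocks, so its index is 0 or [r]. *)
Lemma shuffle_lift0 n r (i0 : 'I_n.+1) (t : 'S_n) :
  i0 != ord0 -> i0 != r :> nat -> shuffle r (lift_perm i0 ord0 t) = false.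
Proof.
rewrite -val_eqE /= -lt0n => i0_gt0 i0r; apply/negP => /shuffleP h.
have [lt|ge] := ltnP i0 r.
  by have := h ord0 i0 i0_gt0; rewrite lt lift_perm_id ltn0 => /(_ isT).
have rn : r < n.+1 by apply: leq_ltn_trans ge (ltn_ord i0).
have := h (Ordinal rn) i0.
by rewrite /= ltn_neqAle eq_sym i0r ge leqnn orbT lift_perm_id ltn0 => /(_ isT isT).
Qed.

Lemma koszul_lift n (dg : 'I_n.+1 -> nat) (i0 : 'I_n.+1) (t : 'S_n) :
  koszul dg (lift_perm i0 ord0 t) =
  \sum_(i < n | i < i0) dg (lift i0 i) * dg i0 + koszul (dg \o lift i0) t.
Proof.
rewrite /koszul (bigD1_ord i0) //= big1 ?add0n; last first.
  by move=> j; rewrite lift_perm_id ltn0 andbF.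
rewrite [in RHS]big_mkcond -big_split; apply: eq_bigr => i _ /=.
rewrite big_mkcond (bigD1_ord i0) //= lift_perm_id lift_perm_lift andbT.
have -> : (bump i0 i < i0) = (i < i0) by rewrite /bump; case: leqP; lia.
congr (_ + _); rewrite [RHS]big_mkcond; apply: eq_bigr => j _.
by rewrite -[bump i0 i]/(val (lift i0 i)) -[bump i0 j]/(val (lift i0 j)) lt_lift lift_perm_lift.
Qed.

End ShufflePermutations.

(** * Sums over shuffle permutations as recursive shuffles *)

Section ShuffleSum.
Variables (k : fieldType) (T : Type) (p : T -> bool) (M : lmodType k).

Definition word n (c : 'I_n -> T) : seq T := [seq c i | i <- enum 'I_n].

Lemma word_cons n (c : 'I_n.+1 -> T) : word c = c ord0 :: word (c \o lift ord0).
Proof. by rewrite /word enum_ordSl /= -map_comp. Qed.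

Lemma size_word n (c : 'I_n -> T) : size (word c) = n.
Proof. by rewrite size_map size_enum_ord. Qed.

Lemma nth_word x0 n (c : 'I_n -> T) (i : 'I_n) : nth x0 (word c) i = c i.
Proof. by rewrite (nth_map i) ?size_enum_ord // nth_ord_enum. Qed.

Lemma word_lift n (c : 'I_n.+1 -> T) (r : 'I_n.+1) :
  take r (word (c \o lift r)) = take r (word c) /\ 
  drop r (word (c \o lift r)) = drop r.+1 (word c).
Proof.
have x0 := c ord0; split; apply: (@eq_from_nth _ x0).
- rewrite !size_take !size_word ltn_ord; case: ltnP => // nr.
  by apply/eqP; rewrite eqn_leq nr -ltnS ltn_ord.
- rewrite size_take size_word => i; case: (ltnP r n) => [lt ir|le ir].
    rewrite !nth_take //.
    have lin : (i < n)%N by exact: ltn_trans ir lt.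
    have -> : i = nat_of_ord (Ordinal lin) by [].
    rewrite (nth_word x0 (c \o lift r)) /= -(nth_word x0 c) /=.
    by rewrite /bump leqNgt ir.
  rewrite !nth_take ?(leq_trans ir) //.
  have -> : i = nat_of_ord (Ordinal ir) by [].
  rewrite (nth_word x0 (c \o lift r)) /= -(nth_word x0 c) /=.
  by rewrite /bump leqNgt (leq_trans ir le).
- by rewrite !size_drop !size_word subSS.
move=> i; rewrite size_drop size_word => lt; rewrite !nth_drop.
have rin : (r + i < n)%N by move: lt; lia.
have -> : (r + i)%N = nat_of_ord (Ordinal rin) by [].
rewrite (nth_word x0 (c \o lift r)) /= -(nth_word x0 c) /=.
by rewrite /bump leq_addr.
Qed.

Lemma par_take n (c : 'I_n -> T) (dg : 'I_n -> nat) m : (forall i, odd (dg i) = p (c i)) ->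
  par p (take m (word c)) = odd (\sum_(i < n | (i < m)%N) dg i).
Proof.
elim: n c dg m => [|n IH] c dg m cp; first by rewrite big_ord0 /word enum_ord0.
case: m => [|m]; first by rewrite take0 big_pred0.
rewrite word_cons /= big_mkcond big_ord_recl /= oddD cp; congr (_ (+) _).
rewrite (IH _ (dg \o lift ord0)) => [|i]; last by rewrite /= cp.
by congr odd; rewrite big_mkcond; apply: eq_bigr.
Qed.

Definition shuffle_term n (c : 'I_n -> T) (dg : 'I_n -> nat) (G : seq T -> M) (s : 'S_n) : M :=
  (-1) ^+ (s + koszul dg s)%N *: G (word (fun i => c (s^-1%g i))).

Lemma shuffle_term_lift n (c : 'I_n.+1 -> T) (dg : 'I_n.+1 -> nat) G i0 (t : 'S_n) :
  shuffle_term c dg G (lift_perm i0 ord0 t) =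
  (-1) ^+ (i0 + \sum_(i < n | (i < i0)%N) dg (lift i0 i) * dg i0)%N *:
  shuffle_term (c \o lift i0) (dg \o lift i0) (fcons (c i0) G) t.
Proof.
rewrite /shuffle_term scalerA -exprD koszul_lift odd_lift_perm addbF.
rewrite lift_permV word_cons /= lift_perm_id /fcons. congr (_ *: G (_ :: _)).
  rewrite -signr_odd -[RHS]signr_odd !oddD !oddb. congr ((-1) ^+ nat_of_bool _). 
  by rewrite addbACA.
by apply: eq_map => i /=; rewrite lift_perm_lift.
Qed.

Lemma sum_shuffle n r (c : 'I_n -> T) (dg : 'I_n -> nat) G :
  (forall i, odd (dg i) = p (c i)) -> (r <= n)%N ->
  \sum_(s : 'S_n | shuffle r s) shuffle_term c dg G s =
  sh p (take r (word c)) (drop r (word c)) G.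
Proof.
elim: n r c dg G => [|n IH] r c dg G cp rn.
  move: rn; rewrite leqn0 => /eqP ->.
  have s1 (s : 'S_0) : s = 1%g by apply/permP => -[].
  rewrite (big_pred1 1%g) => [|s]; last first.
    by rewrite [s]s1 /= eqxx; apply/forallP => -[].
  rewrite /shuffle_term odd_perm1 /koszul big_ord0 expr0 scale1r.
  by rewrite /word enum_ord0.
rewrite (reindex _ (onW_bij _ (lift_perm_bij n))) /=.
rewrite -(pair_big_dep xpredT (fun i t => shuffle r (lift_perm i ord0 t))
  (fun i t => shuffle_term c dg G (lift_perm i ord0 t))) /=.
have inner (i0 : 'I_n.+1) r1 : (r1 <= n)%N ->
    (forall j : 'I_n, (lift i0 j < r)%N = (j < r1)%N) ->
    (forall i : 'I_n.+1, (i < i0)%N -> ~~ ((i0 < r) || (r <= i))%N) ->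
    \sum_(t | shuffle r (lift_perm i0 ord0 t)) shuffle_term c dg G (lift_perm i0 ord0 t) =
    (-1) ^+ (i0 + \sum_(i < n | (i < i0)%N) dg (lift i0 i) * dg i0)%N *:
    sh p (take r1 (word (c \o lift i0))) (drop r1 (word (c \o lift i0))) (fcons (c i0) G).
  move=> r1n h1 h2; rewrite -(IH _ _ (dg \o lift i0)) => [||//]; last first.
    by move=> i; exact: cp.
  rewrite scaler_sumr; apply: eq_big => [t|t _]; first exact: shuffle_lift.
  exact: shuffle_term_lift.
(* For [r = 0] index 0 belongs to the second block, and the first block keeps size [r.-1 = 0], so
   one formula covers both cases. *)
rewrite (bigD1_ord ord0) //= (inner ord0 r.-1); last 3 first.
- by lia.
- by move=> j; rewrite /= /bump; lia.
- by [].
rewrite big1 ?addr0; last by move=> i; rewrite ltn0.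
rewrite expr0 scale1r word_cons.
have zero (i : 'I_n) : i.+1 != r -> \sum_(j | shuffle r (lift_perm (lift ord0 i) ord0 j))
    shuffle_term c dg G (lift_perm (lift ord0 i) ord0 j) = 0.
  by move=> ir; rewrite big_pred0 // => t; rewrite shuffle_lift0.
case: r rn inner zero => [|r] rn inner zero.
  by rewrite big1 ?addr0 ?take0 ?drop0 // => i _; rewrite zero.
rewrite [r.+1.-1]/= [take _ (_ :: _)]/= [drop _ (_ :: _)]/=; set w := word _.
have [le|lt] := leqP n r.
  rewrite drop_oversize ?size_word // !shw0 big1 ?addr0 // => i _.
  by rewrite zero // eqSS ltn_eqF // (leq_trans (ltn_ord i)).
pose i0 := lift ord0 (Ordinal lt).
rewrite (bigD1 (Ordinal lt)) // -/i0 (inner i0 r.+1) //; last 2 first.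
- by move=> j; rewrite /= /bump /= add1n; case: leqP; lia.
- by move=> i; rewrite /= /bump /= add1n ltnS ltnn /= -ltnNge.
rewrite [X in _ + (_ + X)]big1 ?addr0; last first.
  move=> i /eqP ir; rewrite zero // eqSS; apply/eqP => e; apply: ir; exact: val_inj.
have [-> ->] := word_lift c i0.
have cw : drop r w = c i0 :: drop r.+1 w.
  rewrite (drop_nth (c i0)) ?size_word //; congr (_ :: _).
  by rewrite -[r]/(nat_of_ord (Ordinal lt)) nth_word.
rewrite cw sh_cons -cw [word c]word_cons -/w; congr (_ + _ *: _).
rewrite -signr_odd -big_distrl oddD oddM cp /ssgn /= size_take size_word lt.
congr ((-1) ^+ nat_of_bool (_ (+) _)); rewrite andbC; congr (_ && _).
have -> : p (c ord0) (+) par p (take r w) = par p (take r.+1 (word c)) by rewrite word_cons.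
rewrite -[r.+1]/(nat_of_ord i0) -(word_lift c i0).1.
by rewrite (@par_take _ _ (dg \o lift i0)) // => j; rewrite /= cp.
Qed.

End ShuffleSum.

(** * Harrison cochains of fixed tensor degree as functions on words *)

Section WordCochains.
Variables (k : fieldType) (A : gcAlgType k).
Implicit Types (F : seq A -> A) (u v : seq A) (b : A).

Definition letters m u : {ffun 'I_m -> A} := [ffun i : 'I_m => nth 0 u i].

Definition to_words m (f : multi A m) : seq A -> A :=
  fun u => if size u == m then f (letters m u) else 0.

Definition of_words m F : multi A m := fun a => F (word a).
Arguments of_words : clear implicits.

Lemma letters_word m (a : {ffun 'I_m -> A}) : letters m (word a) = a.
Proof. by apply/ffunP => i; rewrite ffunE nth_word. Qed.

Lemma word_letters m u : size u = m -> word (letters m u) = u.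
Proof.
move=> um; apply: (@eq_from_nth _ 0); rewrite size_word // => i im.
by rewrite -[i]/(nat_of_ord (Ordinal im)) nth_word ffunE.
Qed.

Lemma to_words_word m (f : multi A m) (a : {ffun 'I_m -> A}) : to_words f (word a) = f a.
Proof. by rewrite /to_words size_word eqxx letters_word. Qed.

Lemma of_words_to_words m (f : multi A m) : of_words m (to_words f) = f.
Proof. by apply: funext => a; rewrite /of_words to_words_word. Qed.

Lemma arity_to_words m (f : multi A m) : arity m (to_words f).
Proof. by move=> u /eqP/negPf um; rewrite /to_words um. Qed.

Lemma to_words_of_words m F : arity m F -> to_words (of_words m F) = F.
Proof.
move=> aF; apply: funext => u; rewrite /to_words; case: eqP => [um|um]; last by rewrite aF.
by rewrite /of_words word_letters.
Qed.

Lemma arity_ext m F G : arity m F -> arity m G ->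
  (forall a : {ffun 'I_m -> A}, F (word a) = G (word a)) -> F = G.
Proof. by move=> aF aG FG; rewrite -(to_words_of_words aF) -(to_words_of_words aG); congr to_words;
  apply: funext. Qed.

Lemma word_cat m u v b : (size u + size v).+1 = m ->
  forall i : 'I_m, i = size u :> nat ->
  letters m (u ++ b :: v) = upd (letters m (u ++ 0 :: v)) i b.
Proof.
move=> mE i iE; apply/ffunP => j; rewrite !ffunE !nth_cat -val_eqE /= iE.
by case: ltngtP => [ju|uj|->] //=; rewrite ?subnn // -(subnSK uj).
Qed.

Lemma mlin_to_words m (f : multi A m) : multilinear f -> mlin (to_words f).
Proof.
move=> mf u v c a b; rewrite /to_words !size_cat /= addnS.
case: eqP => [um|_]; last by rewrite scaler0 addr0.
have iu : (size u < m)%N by rewrite -um ltnS leq_addr.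
have E w := word_cat w um (i := Ordinal iu) erefl.
by rewrite E (mf _ _ c a b) -!E.
Qed.

Lemma word_upd m (a : {ffun 'I_m -> A}) (i : 'I_m) :
  exists2 uv, (forall b, word (upd a i b) = uv.1 ++ b :: uv.2) & size uv.1 = i.
Proof.
exists (take i (word a), drop i.+1 (word a)); last first.
  by rewrite size_take size_word ltn_ord.
move=> b; apply: (@eq_from_nth _ 0) => [|j]; rewrite size_word.
  rewrite size_cat /= size_take size_drop size_word ltn_ord subnSK //.
  by rewrite subnKC // ltnW.
move=> jm; rewrite -[in LHS](_ : nat_of_ord (Ordinal jm) = j) // nth_word ffunE.
rewrite nth_cat size_take size_word ltn_ord -val_eqE /=.
case: ltngtP => [ji|ij|->]; last by rewrite subnn.
  by rewrite nth_take // -[j]/(nat_of_ord (Ordinal jm)) nth_word.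
rewrite -(subnSK ij) /= nth_drop subnKC //.
by rewrite -[in RHS](_ : nat_of_ord (Ordinal jm) = j) // nth_word.
Qed.

Lemma multilinear_of_words m F : mlin F -> multilinear (of_words m F).
Proof.
move=> mF a i c b b'; rewrite /of_words; have [[u v] E _] := word_upd a i.
by rewrite !E mF.
Qed.

Lemma upd_id m (a : {ffun 'I_m -> A}) i : upd a i (a i) = a.
Proof. by apply/ffunP => j; rewrite ffunE; case: eqP => // ->. Qed.

Lemma Forall_nth (T : Type) (P : T -> Prop) x0 w i :
  Forall P w -> (i < size w)%N -> P (nth x0 w i).
Proof. by elim: w i => // t w IH [|i] [] // _ /IH; apply. Qed.

Lemma Forall_word (T : Type) (P : T -> Prop) n (c : 'I_n -> T) :
  (forall i, P (c i)) -> Forall P (word c).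
Proof.
move=> Pc; rewrite /word; elim: (enum 'I_n) => //= i s IH; split=> //; exact: Pc.
Qed.

Lemma wdeg_word m (dg : 'I_m -> nat) (a : 'I_m -> A) :
  wdeg (word (fun i => (dg i, a i))) = (\sum_(i < m) dg i)%N.
Proof. by rewrite /wdeg /word -map_comp sumnE big_map big_enum. Qed.

Lemma vals_word (T : Type) m (dg : 'I_m -> T) (a : 'I_m -> A) :
  vals (word (fun i => (dg i, a i))) = word a.
Proof. by rewrite /vals /word -map_comp. Qed.

Lemma word_nth (T : Type) (x0 : T) w : word (fun i : 'I_(size w) => nth x0 w i) = w.
Proof.
apply: (@eq_from_nth _ x0); rewrite size_word // => i lt.
by rewrite -[i]/(nat_of_ord (Ordinal lt)) (nth_word x0 (fun i => nth x0 w (nat_of_ord i))).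
Qed.

Lemma word_pair (T : Type) (x0 : T) (w : seq (T * A)) :
  w = word (fun i : 'I_(size w) => ((nth (x0, 0) w i).1, letters (size w) (vals w) i)).
Proof.
rewrite -[LHS](word_nth (x0, 0)); congr map; apply: funext => i.
by rewrite ffunE /vals (nth_map (x0, 0)) //; case: nth.
Qed.

Lemma shuffle_to_words m r (f : multi A m) (deg : 'I_m -> nat) (a : {ffun 'I_m -> A}) : (r <= m)%N ->
  \sum_(s : 'S_m | shuffle r s)
     (-1) ^+ (s + koszul deg s)%N *: f [ffun i : 'I_m => a (s^-1%g i)] =
  sh (@fst _ _) (take r (word (fun i => (odd (deg i), a i))))
    (drop r (word (fun i => (odd (deg i), a i)))) (fun w => to_words f (vals w)).
Proof.
move=> rm; rewrite -(sum_shuffle (dg := deg)) //; apply: eq_bigr => s _.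
rewrite /shuffle_term vals_word; congr (_ *: _).
rewrite -(to_words_word f); congr (to_words f (map _ _)).
by apply: funext => i; rewrite ffunE.
Qed.

Lemma good_to_words p m (f : multi A m) : Ch p f -> good p (to_words f).
Proof.
move=> [f1 f2 f3 f4]; split; first exact: mlin_to_words.
- move=> w; have [wm|/eqP wm] := eqVneq (size w) m; last first.
    by rewrite arity_to_words ?size_map // => _; exact: homog0.
  subst m; move=> hw; rewrite [w in wdeg w](word_pair 0%N) wdeg_word /to_words size_map eqxx.
  apply: f2 => i; rewrite ffunE (nth_map (0%N, 0)) //.
  by have := Forall_nth (0%N, 0) hw (ltn_ord i).
- move=> u v b hb; rewrite /to_words size_cat /= addnS; case: eqP => // um.
  have iu : (size u < m)%N by rewrite -um ltnS leq_addr.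
  by apply: (f3 _ (Ordinal iu)); rewrite ffunE nth_cat /= ltnn subnn.
move=> u v Pu Pv u0 v0; set w := u ++ v.
have [wm|/eqP wm] := eqVneq (size w) m; last first.
  rewrite (@sh_ext _ _ _ _ (@phom k A) _ 0) ?sh_0 // => w' _ sw'.
  by rewrite arity_to_words // size_map sw' -size_cat.
subst m.
have hw : Forall (@phom k A) w by rewrite /w; elim: (u) Pu => // t u' IH [Pt /IH]; split.
(* The parity labels are refined to degrees, which the Harrison condition in [Ch] refers to. *)
have /choice[dg dgP] : forall i : 'I_(size w), exists q,
    homog q (letters (size w) (vals w) i) /\ odd q = (nth (false, 0) w i).1.
  move=> i; have [q hq qq] := Forall_nth (false, 0) hw (ltn_ord i); exists q.
  by rewrite ffunE (nth_map (false, 0)).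
have wE : w = word (fun i => (odd (dg i), letters (size w) (vals w) i)).
  rewrite {1}[w](word_pair false); congr map; apply: funext => i.
  by have [_ ->] := dgP i.
have ru : (size u <= size w)%N by rewrite size_cat leq_addr.
have := shuffle_to_words f dg (letters (size w) (vals w)) ru; rewrite -wE.
rewrite take_size_cat // drop_size_cat // => <-; apply: f4 => [|i]; last by have [] := dgP i.
by rewrite u0 size_cat -addn1 leq_add2l.
Qed.

Lemma Ch_of_words p m F : good p F -> Ch p (of_words m F).
Proof.
move=> [mF dF nF sF]; pose G := to_words (of_words m F).
split.
- exact: multilinear_of_words.
- move=> deg a ha; rewrite -(wdeg_word deg a) /of_words -(vals_word deg).
  by apply: dF; apply: Forall_word.
- move=> a i ha; rewrite /of_words -(upd_id a i); have [[u v] E _] := word_upd a i.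
  by rewrite E; exact: nF.
move=> r /andP[r0 rm] deg a ha; rewrite (shuffle_to_words _ _ _ (ltnW rm)).
set w := word _.
have hw : Forall (@phom k A) w by apply: Forall_word => i; exists (deg i).
have sw : size w = m by rewrite size_word.
have : Forall (@phom k A) (take r w) /\ Forall (@phom k A) (drop r w).
  move: hw; rewrite -{1}(cat_take_drop r w).
  by elim: (take r w) => //= t u IH [Pt /IH []].
move=> [h1 h2]; rewrite -(sF _ _ h1 h2) ?size_take ?size_drop ?sw ?rm ?subn_gt0 //.
apply: (@sh_ext _ _ _ _ (@phom k A)) => // w' _.
rewrite size_take size_drop sw rm subnKC 1?ltnW // => sw'.
by rewrite /to_words size_map sw' eqxx /of_words word_letters // size_map.
Qed.

Lemma Chs_good p m (f : multi A m) : Ch p f <-> good p (to_words f).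
Proof.
split; first exact: good_to_words.
by move=> gf; rewrite -(of_words_to_words f); exact: Ch_of_words.
Qed.

End WordCochains.

Arguments of_words {k A} m F _.

(** * The differentials in terms of words *)

Section ListForm.
Variables (k : fieldType) (A : gcAlgType k).
Implicit Types (F G : seq A -> A) (u v : seq A).

Lemma to_words_wordf m (f : multi A m) (c : 'I_m -> A) : to_words f (word c) = f [ffun i => c i].
Proof.
rewrite -to_words_word; congr (to_words f (map _ _)); apply: funext => i.
by rewrite ffunE.
Qed.

Lemma word_rcons (T : Type) n (c : 'I_n.+1 -> T) :
  word c = rcons (word (c \o lift ord_max)) (c ord_max).
Proof.
rewrite /word enum_ordSr map_rcons -map_comp; congr (rcons (map _ _) _).
by apply: funext => i; congr c; apply: val_inj; rewrite /= /bump leqNgt ltn_ord.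
Qed.

Lemma right_op_rcons F u b : right_op F (rcons u b) = (-1) ^+ (size u).+1 *: (F u * b).
Proof.
elim: u F => [|a u IH] F; first by rewrite /= expr1 scaleN1r.
have -> : right_op F (rcons (a :: u) b) = - right_op (fcons a F) (rcons u b) by case: u {IH}.
by rewrite IH [in RHS]exprS -[in RHS]scalerA scaleN1r.
Qed.

Lemma bar_op_word F m (a : {ffun 'I_m.+1 -> A}) :
  bar_op F (word a) = \sum_(i < m) (-1) ^+ i *: F (word (mul_at i a)).
Proof.
elim: m F a => [|m IH] F a; rewrite word_cons bar_op_cons.
  by rewrite big_ord0 /word enum_ord0 subr0.
pose a' : {ffun 'I_m.+1 -> A} := [ffun i => a (lift ord0 i)].
have -> : word (a \o lift ord0) = word a'.
  by congr map; apply: funext => i; rewrite ffunE.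
rewrite IH big_ord_recl expr0 scale1r -sumrN; congr (_ + _).
  rewrite !word_cons /lam; congr (F (_ :: _)).
    by rewrite !ffunE /=; congr (a _ * _); apply: val_inj.
  congr map; apply: funext => i; rewrite /= !ffunE /=.
  by [].
apply: eq_bigr => i _; rewrite -scaleNr /= [(-1) ^+ (bump 0 i)]exprS mulN1r.
congr (_ *: _); rewrite /fcons word_cons; congr (F (_ :: _)).
  have e0 : lift ord_max ord0 = ord0 :> 'I_m.+2 by apply: val_inj.
  by rewrite ffunE /= e0.
congr map; apply: funext => j; rewrite /= !ffunE /= /bump /= !add1n ltnS.
have e1 : lift ord_max (lift ord0 j) = lift ord0 (lift ord_max j).
  by apply: val_inj; rewrite /= /bump /= !add1n ltnS leqNgt ltn_ord.
by rewrite e1 -[_ == lift ord0 i](inj_eq val_inj) /= /bump /= eqSS.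
Qed.

Lemma der_op_word (d : {linear A -> A}) F m (a : {ffun 'I_m -> A}) :
  der_op (tw 1) d F (word a) = \sum_(i < m) F (word (apply_at d i a)).
Proof.
elim: m F a => [|m IH] F a.
  by rewrite big_ord0 /word enum_ord0.
rewrite word_cons der_op_tw big_ord_recl.
pose a' : {ffun 'I_m -> A} := [ffun i => a (lift ord0 i)].
have -> : word (a \o lift ord0) = word a'.
  by congr map; apply: funext => i; rewrite ffunE.
rewrite IH; congr (_ + _).
  rewrite [in RHS]word_cons; congr (F (_ :: _)); first by rewrite ffunE.
  by congr map; apply: funext => i; rewrite /= !ffunE.
apply: eq_bigr => i _; rewrite /fcons [in RHS]word_cons; congr (F (_ :: _)).
  by rewrite ffunE.
congr map; apply: funext => j; rewrite /= !ffunE /= /bump /= !add1n ltnS.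
by rewrite -[_ == lift ord0 i](inj_eq val_inj) /= /bump /= eqSS.
Qed.

Lemma partial_op_ext (s : {linear A -> A}) F G u :
  (forall w, (size w).+1 = size u -> F w = G w) -> partial_op s F u = partial_op s G u.
Proof.
move=> FG; rewrite /partial_op !fctE (bar_op_ext FG) (right_op_ext FG); congr (_ - _ + _).
by case: u FG => //= a u FG; rewrite FG.
Qed.

Lemma arity_partial_op (s : {linear A -> A}) m F : arity m F -> arity m.+1 (partial_op s F).
Proof.
move=> aF u su; rewrite (@partial_op_ext s F 0) ?linear0 // => w sw.
by apply: aF => wm; apply: su; rewrite -sw wm.
Qed.

Lemma to_words_partial p m (f : multi A m) : to_words (partial_B p f) = partial_op (tw p) (to_words f).
Proof.
apply: (@arity_ext _ _ m.+1); [exact: arity_to_words|exact/arity_partial_op/arity_to_words|].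
move=> a; rewrite to_words_word /partial_B /partial_op !fctE bar_op_word.
congr (_ - _ + _).
- by rewrite word_cons left_op_cons to_words_wordf.
- by apply: eq_bigr => i _; rewrite to_words_word.
by rewrite word_rcons right_op_rcons size_word to_words_wordf.
Qed.

Definition int_op (d : {linear A -> A}) p F : seq A -> A :=
  (-1) ^+ p *: der_op (tw 1) d F - (fun u => d (F u)).

Lemma int_op_ext (d : {linear A -> A}) p F G u : (forall w, size w = size u -> F w = G w) ->
  int_op d p F u = int_op d p G u.
Proof. by move=> FG; rewrite /int_op !fctE (der_op_ext _ _ FG) FG. Qed.

Lemma to_words_dB (d : {linear A -> A}) p m (f : multi A m) : to_words (d_B d p f) =
  int_op d p (to_words f).
Proof.
apply: (@arity_ext _ _ m); first exact: arity_to_words.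
  move=> u su; rewrite (@int_op_ext d p _ 0); last first.
    by move=> w sw; apply: arity_to_words; rewrite sw.
  by rewrite /int_op !fctE der_op0 scaler0 linear0 subr0.
move=> a; rewrite to_words_word /d_B /int_op !fctE der_op_word to_words_word; congr (_ *: _ - _).
by apply: eq_bigr => i _; rewrite to_words_word.
Qed.

(** For each p the components of all tensor degrees are glued to one function, which reads the
    tensor degree off the word. This removes the index [m] on which the types depend. *)
Definition flat (f : bicochain A) : nat -> seq A -> A := fun p u => to_words (f p (size u)) u.

Definition unflat (F : nat -> seq A -> A) : bicochain A := fun p m => of_words m (F p).

Lemma flatE (f : bicochain A) p m (a : {ffun 'I_m -> A}) : flat f p (word a) = f p m a.
Proof. by rewrite /flat size_word to_words_word. Qed.

Lemma unflatK (F : nat -> seq A -> A) : flat (unflat F) = F.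
Proof.
apply: funext => p; apply: funext => u.
by rewrite /flat /unflat /to_words eqxx /of_words word_letters.
Qed.

Lemma flatK (f : bicochain A) : unflat (flat f) = f.
Proof. by apply: bicochainP => p m a; rewrite /unflat /of_words flatE. Qed.

Lemma flat_lin c (f g : bicochain A) : flat (c *: f + g) = c *: flat f + flat g.
Proof.
apply: funext => p; apply: funext => u.
by rewrite -[RHS]/(c *: flat f p u + flat g p u) /flat /to_words !eqxx.
Qed.

Definition total_op (d : {linear A -> A}) (F : nat -> seq A -> A) : nat -> seq A -> A := fun p =>
  (if p is p'.+1 then int_op d p' (F p') else 0) - (-1) ^+ p *: partial_op (tw p) (F p).

Lemma flat_total_op (d : {linear A -> A}) (f : bicochain A) : flat (D_B d f) = total_op d (flat f).
Proof.
apply: funext => p; apply: funext => u; rewrite /total_op !fctE.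
have E q m (w : seq A) : size w = m -> flat f q w = to_words (f q m) w by move=> <-.
have -> : flat (D_B d f) p u =
    (if p is p'.+1 then to_words (d_B d p' (f p' (size u))) u else 0) -
    (if size u is m.+1 then (-1) ^+ p *: to_words (partial_B p (f p m)) u else 0).
  rewrite /flat /to_words !eqxx /D_B; congr (_ - _); first by case: p.
  by case: u => [|a u] /=; rewrite ?eqxx.
congr (_ - _).
  by case: p => // p; rewrite to_words_dB; apply: int_op_ext => w sw; rewrite (E _ _ _ sw).
case: u => [|a u]; first by rewrite /partial_op !fctE /= subr0 addr0 scaler0.
rewrite -[LHS]/((-1) ^+ p *: to_words (partial_B p (f p (size u))) (a :: u)) to_words_partial.
congr (_ *: _); apply: partial_op_ext => w [sw].
by rewrite (E _ _ _ sw).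
Qed.

End ListForm.

(** * The internal differential and the total complex *)

Section InternalDifferential.
Variables (k : fieldType) (A : gcAlgType k) (d : {linear A -> A}).
Hypotheses (A_connected : connected A) (d_diff : alg_differential d).
Implicit Types (F G : seq A -> A) (u v : seq A).

Let dh q a : homog q a -> homog (q + 1) (d a).
Proof. by case: d_diff => -[[_ h] _] _ /h. Qed.

Let dM a b : d (a * b) = d a * b + tw 1 a * d b.
Proof. by case: d_diff => -[_ h] _; exact: h. Qed.

Let dK a : d (d a) = 0. Proof. by case: d_diff. Qed.

Let tdM : {morph (tw 1 : A -> A) : a b / a * b}. Proof. exact: twM. Qed.

(** By connectedness degree 0 consists of scalars. This is why [int_op] preserves normalization. *)
Let d0 a : homog 0 a -> d a = 0.
Proof.
move=> /A_connected[c ->]; rewrite linearZ /= (_ : d 1 = 0) ?scaler0 //.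
by case: d_diff => /derivation1.
Qed.

Lemma tw_d p a : tw p (d a) = (-1) ^+ p *: d (tw p a).
Proof. by case: d_diff => -[/(tw_ghom p) -> _] _; rewrite muln1. Qed.

Fact int_op_linear p : linear (int_op d p : (seq A -> A) -> (seq A -> A)).
Proof.
move=> c F G; apply: funext => u; rewrite /int_op !fctE der_op_linear !fctE (linearP d).
by rewrite !scalerDr !scalerN !scalerA [_ * c]mulrC; abel.
Qed.
HB.instance Definition _ p := GRing.isLinear.Build k _ _ _ (int_op d p) (int_op_linear p).

Lemma good_int_op p F : good p F -> good p.+1 (int_op d p F).
Proof.
move=> gF; rewrite /int_op -addn1; apply: goodB.
  by apply/goodZ/good_der_op.
case: gF => mF dF nF sF; split.
- by move=> u v c a b; rewrite mF linearP.
- by move=> w hw; rewrite addnA; apply/dh/dF.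
- by move=> u v a ha; rewrite nF // linear0.
move=> u v Pu Pv u0 v0.
have shd (G : seq (bool * A) -> A) (u' v' : seq (bool * A)) :
    sh (@fst _ _) u' v' (fun w => d (G w)) = d (sh (@fst _ _) u' v' G).
  move: u' v' G; apply: sh_ind => [v'|u'|c c' u' v' IHu IHv] G; rewrite ?shw0 //.
  by rewrite !sh_cons (linearD d) [d (_ *: _)]linearZ /= -IHu -IHv.
by rewrite shd sF // linear0.
Qed.

Lemma arity_int_op p m F : arity m F -> arity m (int_op d p F).
Proof.
move=> aF u su; rewrite (@int_op_ext _ _ d p F 0); last by move=> w sw; apply: aF; rewrite sw.
by rewrite /int_op !fctE der_op0 scaler0 linear0 subr0.
Qed.

Lemma der_op_post F : der_op (tw 1) d (fun u => d (F u)) = fun u => d (der_op (tw 1) d F u).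
Proof.
apply: funext => u; elim: u F => [|a u IH] F; first by rewrite /= linear0.
by rewrite !der_op_cons (linearD d) -IH.
Qed.

Lemma der_op_der_op F : mlin F -> der_op (tw 1) d (der_op (tw 1) d F) = 0.
Proof.
move=> mF; apply: funext => u; elim: u F mF => // a u IH F mF.
rewrite der_op_tw der_op_tw fcons_der_op der_opD !fctE dK mlin_head0 // add0r.
rewrite -[tw 1 (d a)]/(tw 1 (d a)) tw_d expr1 scaleN1r mlin_fconsN // der_opN !fctE addrA addNr add0r.
by rewrite (IH (fcons _ (F))) //; exact: mlin_fcons.
Qed.

Lemma int_op_int_op p F : mlin F -> int_op d p.+1 (int_op d p F) = 0.
Proof.
move=> mF; rewrite /int_op der_opB der_opZ der_op_post der_op_der_op // scaler0 sub0r.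
apply: funext => u; rewrite !fctE (linearB d) [d (_ *: _)]linearZ /= dK subr0 exprS mulN1r.
by rewrite scaleNr scalerN opprK subrr.
Qed.

(** Input and output degree differ by p. The lemma provides the sign with which d passes [F u] in
    the last end term. *)
Lemma tw_cochain p F u : mlin F -> hdeg p F -> tw 1 (F u) = (-1) ^+ p *: F (map (tw 1) u).
Proof.
move=> mF dF; move: u.
suff E : (fun u => tw 1 (F u)) = (fun u => (-1) ^+ p *: F (map (tw 1) u)).
  by move=> u; exact: (congr1 (@^~ u) E).
apply: mlin_ext.
- by move=> u v c a b; rewrite mF linearP.
- move=> u v c a b; rewrite !map_cat /= linearP mF scalerDr !scalerA.
  by rewrite [_ * c]mulrC.
move=> w hw; rewrite (tw_homog _ (dF _ hw)) mul1n exprD mulrC -scalerA; congr (_ *: _).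
elim: w {p dF} F mF hw => [|[q a] w IH] F mF; first by rewrite scale1r.
move=> [ha hw]; rewrite vals_cons /= (tw_homog _ ha) mul1n.
have E : F ((-1) ^+ q *: a :: map (tw 1) (vals w)) = (-1) ^+ q *: F (a :: map (tw 1) (vals w)).
  by have /(congr1 (@^~ (map (tw 1) (vals w)))) := mlin_fconsZ ((-1) ^+ q) a mF.
rewrite E; have := IH (fcons a F) (mlin_fcons a mF) hw; rewrite /fcons => <-.
by rewrite scalerA -exprD.
Qed.

(** Each of the three parts of [partial_op] commutes with the internal differential, where the twist
    of the first letter changes with p. The sign $(-1)^p$ in [total_op] then makes the square
    zero. *)
Lemma int_op_partial_op p F : good p F -> int_op d p (partial_op (tw p) F) =
  partial_op (tw p.+1) (int_op d p F).
Proof.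
move=> [mF dF _ _].
have Eb : int_op d p (bar_op F) = bar_op (int_op d p F).
  rewrite /int_op bar_opB bar_opZ (der_op_bar_op tdM dM) //; congr (_ - _).
  apply: funext => u; elim: u F {mF dF} => [|a u IH] F; first by rewrite /= linear0.
  by rewrite !bar_op_cons (linearB d) -IH; congr (_ - _); case: u {IH} => [|b u]; rewrite /= ?linear0.
have El : int_op d p (left_op (tw p) F) = left_op (tw p.+1) (int_op d p F).
  apply: funext => -[|a u]; first by rewrite /int_op !fctE /= scaler0 linear0 subr0.
  rewrite /int_op !fctE left_op_cons der_op_tw left_op_cons dM fcons_left_op der_op_mull /mull /=
    -[Defs.tw p.+1 a]/(tw p.+1 a).
  rewrite tw_d scalerDr -!scalerAl scalerA -expr2 sqrr_sign scale1r.
  rewrite !tw_tw add1n addn1 mulrBr opprD addrA.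
  by rewrite [_ + _ *: _]addrC addrK scalerAr.
have Er : int_op d p (right_op F) = right_op (int_op d p F).
  apply: funext => u; case/lastP: u => [|u b].
    by rewrite /int_op !fctE /= scaler0 linear0 subr0.
  rewrite /int_op der_op_right_op right_opB right_opZ !fctE !right_op_rcons last_op_rcons.
  rewrite [d (_ *: _)]linearZ /= dM (tw_cochain _ mF dF) -scalerAl exprS mulN1r.
  rewrite !scaleNr !scalerDr !scalerN !scalerA [_ ^+ size _ * _]mulrC.
  by abel.
by rewrite /partial_op (linearD (int_op d p)) (linearB (int_op d p)) /= El Eb Er.
Qed.

Lemma total_op_lin c (F G : nat -> seq A -> A) : total_op d (c *: F + G) = c *: total_op d F +
  total_op d G.
Proof.
apply: funext => p; rewrite -[RHS]/(c *: total_op d F p + total_op d G p) /total_op.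
rewrite -[(c *: F + G) p]/(c *: F p + G p) partial_op_linear.
move: (partial_op _ (F p)) (partial_op _ (G p)) => X Y; case: p => [|p].
  by rewrite !scalerDr !scalerN !scalerA [_ * c]mulrC scaler0; abel.
rewrite -[(c *: F + G) p]/(c *: F p + G p) int_op_linear.
move: (int_op _ _ _) (int_op _ _ _) => Z W.
by rewrite !scalerDr !scalerN !scalerA [_ * c]mulrC; abel.
Qed.

Lemma total_op_total_op (F : nat -> seq A -> A) : (forall p, good p (F p)) ->
  total_op d (total_op d F) = 0.
Proof.
move=> gF; apply: funext => p; rewrite -[RHS]/(0 : seq A -> A) /total_op.
have pp q : partial_op (tw q) (partial_op (tw q) (F q)) = 0 by apply: partial_op_partial_op => a b;
  exact: twM.
case: p => [|p]; first by rewrite !sub0r partial_opN partial_opZ pp scaler0 !oppr0 scaler0 oppr0.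
rewrite partial_opB partial_opZ pp scaler0 subr0 linearB linearZ /= int_op_partial_op //.
case: p => [|p]; rewrite ?linear0 ?int_op_int_op; last by case: (gF p).
  by rewrite sub0r expr0 expr1 scale1r scaleN1r opprK addNr.
by rewrite sub0r [(-1) ^+ p.+2]exprS mulN1r scaleNr opprK addNr.
Qed.

Definition TotF n (F : nat -> seq A -> A) := forall p,
  if (p < n)%N then good p (F p) /\ arity (n - p) (F p) else F p = 0.

Lemma TotF_good n (F : nat -> seq A -> A) p : TotF n F -> good p (F p).
Proof. by move=> /(_ p); case: ifP => [_ []//|_ ->]; exact: good0. Qed.

Lemma TotF_lin n c (F G : nat -> seq A -> A) : TotF n F -> TotF n G -> TotF n (c *: F + G).
Proof.
move=> TF TG p; move: (TF p) (TG p); rewrite -[(c *: F + G) p]/(c *: F p + G p).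
case: ifP => _; last by move=> -> ->; rewrite scaler0 addr0.
by move=> [gF aF] [gG aG]; split; [exact: good_lin|exact: arity_lin].
Qed.

Lemma TotF0 n : TotF n 0.
Proof. by move=> p; case: ifP => // _; split; [exact: good0|]. Qed.

Lemma Tot_flat n (f : bicochain A) : Tot n f <-> TotF n (flat f).
Proof.
split=> Tf p; last first.
  move=> m; have := Tf p; case: ifP => [lt [gF aF]|ge F0].
    case: ifP => [/andP[m0 /eqP pm]|pm].
      apply/Chs_good; rewrite (_ : to_words _ = flat f p) //.
      apply: (arity_ext (m := m)); [exact: arity_to_words|by rewrite -pm addKn in aF|].
      by move=> a; rewrite to_words_word flatE.
    apply: funext => a; rewrite -flatE aF // size_word => mE.
    by move: pm; rewrite mE subn_gt0 lt subnKC ?eqxx // ltnW.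
  rewrite ifN.
    by apply: funext => a; rewrite -flatE F0.
  by apply: contraFN ge => /andP[m0 /eqP <-]; rewrite -[X in (X < _)%N]addn0 ltn_add2l.
case: ifP => [lt|ge].
  have fE : flat f p = to_words (f p (n - p)%N).
    apply: funext => u; have [su|su] := eqVneq (size u) (n - p)%N.
      by rewrite /flat su.
    rewrite arity_to_words; last exact/eqP.
    have := Tf p (size u); rewrite ifN; first by rewrite /flat /to_words eqxx => ->.
    by apply: contra su => /andP[_ /eqP <-]; rewrite addKn.
  rewrite fE; split; last exact: arity_to_words.
  by apply/Chs_good; have := Tf p (n - p)%N; rewrite subn_gt0 lt subnKC ?eqxx // ltnW.
apply: funext => u; have := Tf p (size u); rewrite ifN.
  by rewrite /flat /to_words eqxx => ->.
by apply: contraFN ge => /andP[m0 /eqP <-]; rewrite -[X in (X < _)%N]addn0 ltn_add2l.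
Qed.

End InternalDifferential.

(** * Comparison of the cohomologies *)

Section LinearRelation.
Variables (k : fieldType) (V W : lmodType k) (R : V -> W -> Prop).
Hypothesis Rlin : forall c v v' w w', R v w -> R v' w' -> R (c *: v + v') (c *: w + w').
Hypotheses (Rl : forall v, exists w, R v w) (Rr : forall w, exists v, R v w).
Hypotheses (R0l : forall w, R 0 w -> w = 0) (R0r : forall v, R v 0 -> v = 0).

(** This gives an isomorphism of quotients without choosing representatives in a linear way: a
    linear relation that is total and has trivial kernel on both sides is the graph of one. *)
Lemma linear_relation_bij : exists phi : {linear V -> W}, bijective phi.
Proof.
have Rsub v v' w w' : R v w -> R v' w' -> R (v - v') (w - w').
  move=> h h'; have := Rlin (-1) h' h.
  by rewrite !scaleN1r [- v' + v]addrC [- w' + w]addrC.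
have [f fP] := choice Rl; have [g gP] := choice Rr.
have fE v w : R v w -> f v = w.
  by move=> h; apply/subr0_eq/R0l; rewrite -(subrr v); apply: Rsub.
have gE v w : R v w -> g w = v.
  by move=> h; apply/subr0_eq/R0r; rewrite -(subrr w); apply: Rsub.
have f_lin : linear f by move=> c u v; apply/fE/Rlin.
pose phi : {linear V -> W} := HB.pack f (GRing.isLinear.Build k V W _ f f_lin).
by exists phi; exists g => [v|w]; [exact: gE|exact: fE].
Qed.

End LinearRelation.

(** * Reduction of the total complex to tensor degree 1 *)

Section Reduction.
Variables (k : fieldType) (I : choiceType) (deg : I -> nat) (A : gcAlgType k) (x : I -> A).
Hypothesis char0 : [pchar k] =i pred0.
Hypotheses (A_free : free_on deg x) (A_connected : connected A).
Variable d : {linear A -> A}.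
Hypothesis d_diff : alg_differential d.
Implicit Types (F G K : nat -> seq A -> A).

Lemma exactness p m (H : seq A -> A) : (0 < m)%N -> good p H -> arity m.+1 H ->
  partial_op (tw p) H = 0 ->
  exists H', [/\ good p H', arity m H' & partial_op (tw p) H' = H].
Proof.
have [D DP] := partials_ex A_free; have hx := A_free.1.
apply: (@partial_exact _ _ _ deg x D) => //.
- by move=> i; exact: deg_gt0 A_free A_connected i.
- by move=> i; case: (DP i).
- by move=> i; case: (DP i).
- by move=> i; case: (DP i).
- exact: Dfin A_free A_connected _ DP.
- exact: Euler.
Qed.

Definition single (j : nat) (H : seq A -> A) : nat -> seq A -> A :=
  fun p => if p == j then H else 0.

Lemma total_op_single j (H : seq A -> A) p : total_op d (single j H) p =
  if p == j then - (-1) ^+ j *: partial_op (tw j) H else if p == j.+1 then int_op d j H else 0.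
Proof.
rewrite /total_op /single; case: eqVneq => [->|pj].
  case: j => [|j]; first by rewrite sub0r scaleNr.
  by rewrite ltn_eqF // linear0 sub0r scaleNr.
rewrite linear0 scaler0 subr0; case: p pj => [|p] // pj.
by rewrite eqSS; case: eqP => [->//|_]; rewrite linear0.
Qed.

Lemma TotF_single n j (H : seq A -> A) : (j < n)%N -> good j H -> arity (n - j) H ->
  TotF n (single j H).
Proof.
move=> jn gH aH p; rewrite /single; case: eqVneq => [->|pj]; first by rewrite jn.
by case: ifP => // _; split; [exact: good0|].
Qed.

Definition concentrated F := forall p u, size u <> 1%N -> F p u = 0.

Lemma total_op_sub F K : total_op d (F - K) = total_op d F - total_op d K.
Proof. by rewrite addrC -scaleN1r total_op_lin scaleN1r addrC. Qed.

(** The components are cleared for p = 0, ..., n - 1; the last one, p = n, already has tensor degree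
    1. Asking only that the coboundary be concentrated, not zero, lets the lemma apply both to
    cocycles and to cochains that bound a derivation. *)
Lemma reduce_concentrated n F : TotF n.+1 F -> concentrated (total_op d F) ->
  exists K, [/\ TotF n K, TotF n.+1 (F - total_op d K), concentrated (F - total_op d K) &
    total_op d (F - total_op d K) = total_op d F].
Proof.
move=> TF cF.
have DK K : TotF n K -> total_op d (F - total_op d K) = total_op d F.
  by move=> TK; rewrite total_op_sub (total_op_total_op d_diff) ?subr0 // => p; exact: TotF_good TK.
suff [K [TK TG low]] : exists K, [/\ TotF n K, TotF n.+1 (F - total_op d K) &
    forall p, (p < n)%N -> (F - total_op d K) p = 0].
  exists K; split=> // [p u su|]; last exact: DK.
  have [/low ->//|le] := ltnP p n; have := TG p; rewrite ltnS.
  case: ifP => [pn [_ aG]|_ ->//]; apply: aG.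
  by rewrite (_ : p = n) ?subSnn //; apply/eqP; rewrite eqn_leq pn.
suff h j : (j <= n)%N -> exists K, [/\ TotF n K, TotF n.+1 (F - total_op d K) &
    forall p, (p < j)%N -> (F - total_op d K) p = 0] by exact: h n (leqnn n).
elim: j => [|j IH] jn.
  exists 0; have -> : total_op d 0 = 0.
    by have := total_op_lin d (-1) 0 0; rewrite scaler0 addr0 scaleN1r addNr.
  by split; [exact: TotF0|rewrite subr0|].
have [K [TK TG low]] := IH (ltnW jn); set G := F - total_op d K in TG low.
(* As the components below j vanish, component j of the coboundary is [partial_op] of [G j] up to
   sign. It has tensor degree at least 2, where the coboundary is zero. *)
have dG : partial_op (tw j) (G j) = 0.
  have [gG aG] : good j (G j) /\ arity (n.+1 - j) (G j).
    by have := TG j; rewrite ltnS (ltnW jn).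
  apply: funext => u; have [su|su] := eqVneq (size u) (n.+1 - j).+1; last first.
    by apply: (arity_partial_op (tw j) aG); apply/eqP.
  have : total_op d G j u = 0.
    by rewrite DK // cF // su subSn 1?ltnW.
  have -> : total_op d G j = - ((-1) ^+ j *: partial_op (tw j) (G j)).
    rewrite /total_op; case: j {IH aG gG su} jn low => [|j] jn low; first by rewrite sub0r.
    by rewrite low // linear0 sub0r.
  rewrite !fctE => /eqP; rewrite oppr_eq0 scaler_eq0 signr_eq0 => /eqP.
  exact.
have [gG aG] : good j (G j) /\ arity (n - j).+1 (G j).
  by have := TG j; rewrite ltnS (ltnW jn) subSn // ltnW.
have [H [gH aH HG]] := exactness (m := n - j) (ltac:(by rewrite subn_gt0)) gG aG dG.
(* Cancels the sign in front of [partial_op] in component j of [total_op]. *)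
pose s : k := - (-1) ^+ j.
have TK' : TotF n (s *: single j H + K) by apply: TotF_lin => //; exact: TotF_single.
have E p : (F - total_op d (s *: single j H + K)) p = G p - s *: total_op d (single j H) p.
  rewrite total_op_lin -[LHS]/(F p - (s *: total_op d (single j H) p + total_op d K p)).
  by rewrite -[G p]/(F p - total_op d K p); move: (_ *: _) => X; abel.
exists (s *: single j H + K); split=> // p.
  rewrite E total_op_single; have := TG p; case: ifP => [pn [gp ap]|pn ->].
    case: eqVneq => [pj|_].
      rewrite pj scalerA /s mulrNN -expr2 sqrr_sign scale1r HG subrr.
      by split; [exact: good0|].
    case: eqVneq => [pj|_]; last by rewrite scaler0 subr0.
    rewrite pj in gp ap *; split.
      by apply/goodB => //; apply/goodZ/(good_int_op A_connected d_diff).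
    rewrite addrC -scaleNr; apply: arity_lin => //; rewrite subSS.
    exact: arity_int_op.
  by rewrite !ifN ?scaler0 ?subr0 //; apply: contraFN pn => /eqP ->; rewrite ltnS // ltnW.
rewrite ltnS => pj; rewrite E total_op_single.
case: eqVneq => [->|pj'].
  by rewrite scalerA /s mulrNN -expr2 sqrr_sign scale1r HG subrr.
rewrite ifN ?scaler0 ?subr0; last by rewrite ltn_eqF // ltnS.
by rewrite low // ltn_neqAle pj'.
Qed.

Definition degree1 (t : A -> A) : seq A -> A := fun u => if u is [:: a] then t a else 0.

Lemma arity_degree1 t : arity 1 (degree1 t).
Proof. by case=> [|a []]. Qed.

Lemma degree1_lin c t t' : degree1 (c *: t + t') = c *: degree1 t + degree1 t'.
Proof. by apply: funext => -[|a [|b u]]; rewrite !fctE /= ?scaler0 ?addr0. Qed.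

(** Two nonempty words have total length at least 2, so the shuffle condition is vacuous here;
    normalization holds because a derivation kills scalars and A is connected. *)
Lemma good_degree1 p t : derivation p t -> good p (degree1 t).
Proof.
move=> dt; have [[tl th] _] := dt; split.
- move=> [|b [|c u]] [|a v] e y z //=; rewrite ?scaler0 ?addr0 //; exact: tl.
- case=> [|[q a] [|t' w]] hw; try exact: homog0.
  by rewrite /wdeg /= addn0; apply: th; case: hw.
- move=> [|b [|c u]] [|a' v] a ha //=.
  have [c ->] := (A_connected a).1 ha.
  by rewrite -[_%:A]addr0 tl (derivation1 dt) scaler0 add0r; have := tl (-1) 0 0;
    rewrite scaler0 addr0 scaleN1r addNr.
move=> u v Pu Pv u0 v0; rewrite (@sh_ext _ _ _ _ (@phom k A) _ 0) ?sh_0 // => w _ sw.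
by apply: arity_degree1; rewrite size_map sw; case: (size u) (size v) u0 v0 => [|m] [|n] //;
  rewrite addnS.
Qed.

Lemma partial_op_degree1 p t a b : partial_op (tw p) (degree1 t) [:: a; b] =
  tw p a * t b - t (a * b) + t a * b.
Proof. by rewrite /partial_op !fctE /= /fcons /= !subr0 opprK. Qed.

Lemma partial_op_degree10 p t : derivation p t -> partial_op (tw p) (degree1 t) = 0.
Proof.
move=> dt; apply: funext => u; have [|su] := eqVneq (size u) 2; last first.
  by apply: (arity_partial_op (tw p) (@arity_degree1 t)); apply/eqP.
case: u => [|a [|b []]] // _; rewrite partial_op_degree1; case: dt => _ ->.
by rewrite -[RHS]/(0 : A); abel.
Qed.

Lemma int_op_degree1 p t : int_op d p (degree1 t) = - degree1 (ad d p t).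
Proof.
apply: funext => u; have [|su] := eqVneq (size u) 1%N; last first.
  rewrite (arity_int_op d p (@arity_degree1 t)); last exact/eqP.
  by rewrite fctE arity_degree1 ?oppr0 //; apply/eqP.
by case: u => [|a []] // _; rewrite /int_op !fctE /= addr0 /ad opprB.
Qed.

Lemma TotF_degree1 p t : derivation p t -> TotF p.+1 (single p (degree1 t)).
Proof.
move=> dt; apply: TotF_single => //; first exact: good_degree1.
by rewrite subSnn; exact: arity_degree1.
Qed.

Lemma single_lin p c (G H : seq A -> A) :
  single p (c *: G + H) = c *: single p G + single p H.
Proof.
apply: funext => q; rewrite -[RHS]/(c *: single p G q + single p H q) /single.
by case: eqP; rewrite ?scaler0 ?addr0.
Qed.

Lemma total_op_degree1 p t : derivation p t ->
  total_op d (single p (degree1 t)) = - single p.+1 (degree1 (ad d p t)).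
Proof.
move=> dt; apply: funext => q; rewrite total_op_single -[RHS]/(- single p.+1 (degree1 (ad d p t)) q) /single.
case: eqVneq => [->|_]; first by rewrite partial_op_degree10 // scaler0 ltn_eqF // oppr0.
case: eqVneq => _; last by rewrite oppr0.
by rewrite int_op_degree1.
Qed.

(** In total degree n + 1, tensor degree 1 forces p = n. On words of length 2 component n of the
    coboundary is [partial_op] of [F n] up to sign, and its vanishing is the Leibniz rule. *)
Lemma concentrated_degree1 n F : TotF n.+1 F -> concentrated F ->
  (forall u, size u = 2 -> total_op d F n u = 0) ->
  exists2 t, derivation n t & F = single n (degree1 t).
Proof.
move=> TF cF dF; pose t a := F n [:: a].
have [gF aF] : good n (F n) /\ arity 1 (F n) by have := TF n; rewrite ltnSn subSnn.
have F0 p : p != n -> F p = 0.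
  move=> pn; have := TF p; case: ifP => [lt [_ ap]|_ ->] //.
  apply: funext => u; have [su|/eqP su] := eqVneq (size u) 1%N; last exact: cF.
  apply: ap => sn; move/eqP: pn; apply; move: lt; rewrite ltnS su in sn *.
  by move=> pn; apply/eqP; rewrite -eqSS -addn1 [X in (p + X)%N]sn subnKC // ltnW.
have FE : F = single n (degree1 t).
  apply: funext => p; rewrite /single; case: eqVneq => [->|/F0 //].
  by apply: funext => -[|a [|b u]] //=; apply: aF.
have [mF hF nF _] := gF.
have tl : linear t by move=> c a b; exact: (mF [::] [::]).
exists t => //; split; [split=> // q a ha|move=> a b].
  by have := hF [:: (q, a)] (conj ha Logic.I); rewrite /wdeg /= addn0.
have := dF [:: a; b] erefl; rewrite /total_op !fctE.
have -> : (if n is p'.+1 then int_op d p' (F p') else 0) = 0.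
  by case: (n) F0 => // p F0; rewrite F0 ?linear0 // neq_ltn ltnSn.
rewrite -[(0 : seq A -> A) _]/(0 : A) sub0r => /eqP; rewrite oppr_eq0 scaler_eq0 signr_eq0 /=.
have -> : F n = degree1 t by rewrite FE /single eqxx.
rewrite partial_op_degree1 => /eqP E; apply/eqP; rewrite -subr_eq0 -oppr_eq0 -[X in _ == X]E; apply/eqP.
by abel.
Qed.

Lemma ad_derivation p t : derivation p t -> derivation p.+1 (ad d p t).
Proof.
move=> dt; have [[tl th] tM] := dt; have [[[dl dh] dM] dK] := d_diff.
split; [split=> [c a b|n a ha]|move=> a b].
- rewrite /ad tl !(linearP d) tl !scalerDr !scalerN !scalerA [_ * c]mulrC.
  by abel.
- rewrite /ad; apply: homogB.
    by have := dh _ _ (th _ _ ha); rewrite addn1 -addnS.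
  by apply: homogZ; have := th _ _ (dh _ _ ha); rewrite addn1 addSnnS.
have tt : tw 1 (t a) = (-1) ^+ p *: t (tw 1 a) by rewrite (tw_ghom 1 dt.1) mul1n.
have tD u v : t (u + v) = t u + t v by rewrite -[u]scale1r tl !scale1r.
rewrite /ad tM (linearD d) !dM tD !tM tt (tw_d d_diff) !tw_tw add1n addn1.
rewrite !scalerDr -!scalerAl !scalerA -expr2 sqrr_sign scale1r.
rewrite mulrBl mulrBr -!scalerAl -!scalerAr.
by abel.
Qed.

End Reduction.

Section CohomologyClasses.
Variables (k : fieldType) (V : lmodType k) (K : complex V) (n : nat).
Implicit Types z w : cocycle K n.

Lemma coh_classP c z w : coh_class (c *: z + w) = c *: coh_class z + coh_class w.
Proof. by rewrite coh_classD -scaleq_class. Qed.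

Lemma coh_class0 : coh_class (0 : cocycle K n) = 0.
Proof.
have := coh_classP (-1) (0 : cocycle K n) 0.
by rewrite scaler0 addr0 scaleN1r addNr.
Qed.

Lemma coh_class_eq0 z : coh_class z = 0 <-> z \in is_coboundary (K := K) (n := n).
Proof.
by rewrite -coh_class0; split=> [/eqP|zB]; [|apply/eqP]; rewrite coh_class_eq subr0.
Qed.

Lemma cocycle_ex v : cochain K n v -> dif K n v 0 -> exists z : cocycle K n, val z = v.
Proof. by move=> Cv dv; have zP : v \in is_cocycle K n by [apply/asboolP]; exists (Cocycle zP). Qed.

Lemma cocycleP z : cochain K n (val z) /\ dif K n (val z) 0.
Proof. by have /asboolP := valP z. Qed.

End CohomologyClasses.

(** * Restriction to generators *)

Section Restriction.
Variables (k : fieldType) (I : choiceType) (deg : I -> nat) (A : gcAlgType k) (x : I -> A).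
Local Notation X := (genmod k deg).

Lemma fglift0 : fglift x 0 = 0.
Proof. by rewrite -[0 in LHS](subrr (0 : X)) lift_is_additive subrr. Qed.

Lemma fgliftD (u v : X) : fglift x (u + v) = fglift x u + fglift x v.
Proof.
have fgliftN : fglift x (- v) = - fglift x v by rewrite -sub0r lift_is_additive fglift0 sub0r.
by rewrite -[v in LHS]opprK lift_is_additive fgliftN opprK.
Qed.

Lemma fglift_sum (v : X) : fglift x v = \sum_(i <- freeg.dom v) coeff i v *: x i.
Proof.
rewrite -{1}[v]freeg_sumE (big_morph _ fgliftD fglift0); apply: eq_bigr => i _.
exact: liftU.
Qed.

Lemma fglift_scale c (v : X) : fglift x (c *: v) = c *: fglift x v.
Proof.
have -> : c *: v = \sum_(i <- freeg.dom v) << c * coeff i v *g i >>.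
  rewrite -{1}[v]freeg_sumE scaler_sumr; apply: eq_bigr => i _.
  by apply/eqP/freeg_eqP => j; rewrite coeffZ !coeffU mulrA.
rewrite [fglift x v]fglift_sum scaler_sumr (big_morph _ fgliftD fglift0).
by apply: eq_bigr => i _; rewrite scalerA; exact: liftU.
Qed.

Lemma fglift_linear : linear (fglift x : X -> A).
Proof. by move=> c u v; rewrite fgliftD -fglift_scale. Qed.

Lemma restrict_gen (t : A -> A) i : Defs.restrict x t (<< i >> : X) = t (x i).
Proof. by rewrite /Defs.restrict liftU scale1r. Qed.

Lemma restrict_ghom p (t : A -> A) : (forall i, homog (deg i) (x i)) ->
  ghom p t -> ghom p (Defs.restrict x t : X -> A).
Proof.
move=> hx [tl th]; split=> [c u v|n v hv].
  by rewrite /Defs.restrict fglift_linear tl.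
apply: th; rewrite fglift_sum; apply: homog_sum => i _.
have <- : hcomp n v = v by [].
rewrite coeff_gen_hcomp; case: eqP => [<-|_]; first exact: homogZ.
by rewrite scale0r; exact: homog0.
Qed.

End Restriction.

(** * The correspondence of cohomology classes *)

Section Comparison.
Variables (k : fieldType) (I : choiceType) (deg : I -> nat) (A : gcAlgType k) (x : I -> A).
Hypothesis char0 : [pchar k] =i pred0.
Hypotheses (A_free : free_on deg x) (A_connected : connected A).
Variable d : {linear A -> A}.
Hypothesis d_diff : alg_differential d.

Definition inj p (t : A -> A) : bicochain A := unflat (single p (degree1 t)).

Lemma flat_injective (f g : bicochain A) : flat f = flat g -> f = g.
Proof. by move=> fg; rewrite -(flatK f) fg flatK. Qed.

Lemma flat0 : flat (0 : bicochain A) = 0.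
Proof.
have := flat_lin (-1) (0 : bicochain A) 0.
by rewrite scaler0 addr0 scaleN1r addNr.
Qed.

Lemma flatN (f : bicochain A) : flat (- f) = - flat f.
Proof. by have := flat_lin (-1) f 0; rewrite flat0 !addr0 !scaleN1r. Qed.

Lemma flatB (f g : bicochain A) : flat (f - g) = flat f - flat g.
Proof. by rewrite addrC -scaleN1r flat_lin scaleN1r addrC. Qed.

Lemma inj_lin p c t s : inj p (c *: t + s) = c *: inj p t + inj p s.
Proof. by apply: flat_injective; rewrite flat_lin !unflatK degree1_lin single_lin. Qed.

Lemma inj_inj p t s : inj p t = inj p s -> t = s.
Proof.
move=> /(congr1 (@flat _ _)); rewrite !unflatK => /(congr1 (fun F => F p)).
rewrite /single eqxx => ts; apply: funext => a.
by have := congr1 (@^~ [:: a]) ts.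
Qed.

Lemma inj0 p : inj p 0 = 0.
Proof. by have := inj_lin p (-1) 0 0; rewrite scaler0 addr0 scaleN1r addNr. Qed.

Lemma injN p t : inj p (- t) = - inj p t.
Proof. by have := inj_lin p (-1) t 0; rewrite inj0 !addr0 !scaleN1r. Qed.

Lemma Tot_inj p t : derivation p t -> Tot p.+1 (inj p t).
Proof. by move=> dt; apply/Tot_flat; rewrite unflatK; apply: TotF_degree1. Qed.

Lemma D_B_inj p t : derivation p t -> D_B d (inj p t) = - inj p.+1 (ad d p t).
Proof.
move=> dt; apply: flat_injective.
by rewrite flat_total_op flatN !unflatK (total_op_degree1 _ dt).
Qed.

Lemma derivation_opp p (t : A -> A) : derivation p t -> derivation p (- t).
Proof.
by move=> dt; rewrite -scaleN1r -[_ *: t]addr0; apply: derivationP => //; exact: derivation0.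
Qed.

Lemma restrict_inj p (t s : A -> A) : derivation p t -> derivation p s ->
  Defs.restrict x t = Defs.restrict x s :> (genmod k deg -> A) -> t = s.
Proof.
move=> dt ds ts; apply: funext => a; move: a; apply: (derivation_ext A_free dt ds) => i.
have := congr1 (fun h => h (<< i >> : genmod k deg)) ts.
by rewrite !restrict_gen.
Qed.

Lemma adN p (t : A -> A) : ad d p (- t) = - ad d p t.
Proof.
by have := adP d p (-1) t 0; rewrite ad0 !addr0 !scaleN1r.
Qed.

Lemma concentrate n (f : bicochain A) : Tot n.+1 f ->
  (forall p m, m != 1%N -> (D_B d f : bicochain A) p m = 0) ->
    (forall u, size u = 2 -> flat (D_B d f) n u = 0) ->
  exists2 g, Tot n g & exists2 t, derivation n t & f - D_B d g = inj n t.
Proof.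
move=> /(Tot_flat) Tf cf df.
have cF : concentrated (total_op d (flat f)).
  move=> p u su; rewrite -flat_total_op /flat cf; last exact/eqP.
  by rewrite /to_words; case: ifP.
have [K [TK TG cG dG]] := reduce_concentrated char0 A_free A_connected d_diff Tf cF.
have [|t dt GE] := @concentrated_degree1 _ _ d _ _ TG cG; first by move=> u su;
  rewrite dG -flat_total_op df.
exists (unflat K); first by apply/Tot_flat; rewrite unflatK.
by exists t => //; apply: flat_injective; rewrite flatB flat_total_op !unflatK.
Qed.

Lemma D_B_sub n (f g : bicochain A) : Tot n g -> D_B d (f - D_B d g) = D_B d f.
Proof.
move=> /Tot_flat Tg; apply: flat_injective.
rewrite !flat_total_op flatB flat_total_op total_op_sub (total_op_total_op d_diff) ?subr0 // => q.
exact: TotF_good Tg.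
Qed.

(** A relation instead of a map, because the derivation that represents a Harrison class comes from
    the reduction and is not unique. *)
Definition corresponds p (X : Harr d p.+1) (Y : H_gen deg x d p.+1) : Prop :=
  exists z w t, [/\ X = coh_class z, Y = coh_class w, derivation p t,
    val z = inj p t & val w = Defs.restrict x t].

Lemma corresponds_lin p c X X' Y Y' : @corresponds p X Y -> corresponds X' Y' ->
  corresponds (c *: X + X') (c *: Y + Y').
Proof.
move=> [z [w [t [-> -> dt zE wE]]]] [z' [w' [t' [-> -> dt' zE' wE']]]].
exists (c *: z + z'), (c *: w + w'), (c *: t + t'); split.
- by rewrite coh_classP.
- by rewrite coh_classP.
- exact: derivationP.
- by rewrite linearP /= zE zE' inj_lin.
by rewrite linearP /= wE wE'.
Qed.

Lemma corresponds_total p X : exists Y, @corresponds p X Y.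
Proof.
have [z ->] := coh_class_surj X; have [Tz dz] := cocycleP z.
have Dz : D_B d (val z) = 0 := dz.
have [||g Tg [t dt zE]] := concentrate Tz.
- by move=> q m _; rewrite Dz.
- by move=> u _; rewrite Dz flat0.
have Dt : D_B d (inj p t) = 0.
  by rewrite -zE (D_B_sub _ Tg).
have adt : ad d p t = 0.
  have := D_B_inj dt; rewrite Dt => /esym/eqP; rewrite oppr_eq0 => /eqP e.
  by apply: (@inj_inj p.+1); rewrite inj0.
have [z' z'E] : exists z' : cocycle (harrison_complex d) p.+1, val z' = inj p t.
  by apply: cocycle_ex => //; exact: Tot_inj.
have [w wE] : exists w : cocycle (gen_complex deg x d) p.+1, val w = Defs.restrict x t.
  apply: cocycle_ex; first by apply: restrict_ghom; [exact: A_free.1|exact: dt.1].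
  by exists t; rewrite adt.
exists (coh_class w), z', w, t; split=> //; apply/eqP; rewrite coh_class_eq.
apply/asboolP; exists g => //.
by rewrite raddfB /= z'E -zE opprB addrCA subrr addr0.
Qed.

Lemma corresponds_total_r p Y : exists X, @corresponds p X Y.
Proof.
(* The graph [ad_gen] of the differential already supplies a derivation that restricts to the
   cocycle. *)
have [w ->] := coh_class_surj Y; have [Cw [t [dt tw0 adt]]] := cocycleP w.
have adt0 : ad d p t = 0.
  apply: (@restrict_inj p.+1); [exact: ad_derivation|exact: derivation0|exact: adt].
have [z zE] : exists z : cocycle (harrison_complex d) p.+1, val z = inj p t.
  apply: cocycle_ex; first exact: Tot_inj.
  by rewrite /= /D_B_graph (D_B_inj dt) adt0 inj0 oppr0.
by exists (coh_class z), z, w, t.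
Qed.

Lemma corresponds0l p Y : @corresponds p 0 Y -> Y = 0.
Proof.
move=> [z [w [t [/esym/coh_class_eq0/asboolP [g Tg Dg] -> dt zE wE]]]].
have {}Dg : D_B d g = inj p t by rewrite -zE.
apply/coh_class_eq0/asboolP; rewrite wE; case: p Y z w dt zE wE g Tg Dg => [|p] Y z w dt zE wE g Tg Dg.
  exists 0; first by [].
  (* No pair (p, m) with m > 0 has total degree 0, so nothing bounds in total degree 1. *)
  have g0 : g = 0 by apply: bicochainP => p m a; have := Tg p m; case: p => [|p];
    case: m a => [|m] a //= ->.
  split=> //; have -> : t = 0; last by [].
  by apply: (@inj_inj 0); rewrite inj0 -Dg g0 D_B0.
(* [g] is not a cocycle, but its coboundary lies in tensor degree 1, which is enough to replace [g]
   by a derivation with the same coboundary. *)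
have [||g' Tg' [s ds gE]] := concentrate Tg.
- move=> q m m1; rewrite Dg; apply: funext => a; rewrite /inj /unflat /of_words /single.
  by case: eqP => // _; rewrite arity_degree1 // size_word; apply/eqP.
- by move=> u _; rewrite Dg unflatK /single ltn_eqF.
have tE : t = ad d p (- s).
  apply: (@inj_inj p.+1); rewrite adN injN.
  by rewrite -(D_B_inj ds) -gE (D_B_sub _ Tg').
exists (Defs.restrict x (- s)).
  by apply: restrict_ghom; [exact: A_free.1|exact: (derivation_opp ds).1].
by exists (- s); split; [exact: derivation_opp| |rewrite -tE].
Qed.

Lemma corresponds0r p X : @corresponds p X 0 -> X = 0.
Proof.
move=> [z [w [t [-> /esym/coh_class_eq0/asboolP [u Cu du] dt zE wE]]]].
apply/coh_class_eq0/asboolP; rewrite zE; case: p X z w dt zE wE u Cu du => [|p] X z w dt zE wE u Cu du.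
  exists 0; first exact: Tot0.
  have [_ w0] := du; rewrite wE in w0.
  have -> : t = 0 by apply: (restrict_inj dt (derivation0 _ _)); rewrite w0.
  by rewrite inj0; exact: D_B0.
have [s [ds _ adw]] := du.
have tE : t = ad d p s by apply: (restrict_inj dt (ad_derivation d_diff ds)); rewrite -wE adw.
(* The sign compensates for [D_B] being -ad(d) on derivations. *)
exists (inj p (- s)); first exact/Tot_inj/derivation_opp.
by rewrite /= /D_B_graph (D_B_inj (derivation_opp ds)) adN -tE injN opprK.
Qed.

End Comparison.

Theorem corollary2 (k : fieldType) (char0 : [pchar k] =i pred0)
    (I : choiceType) (deg : I -> nat) (A : gcAlgType k) (x : I -> A)
    (A_free : free_on deg x) (A_connected : connected A)
    (d : {linear A -> A}) (d_diff : alg_differential d) (n : nat) :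
  exists phi : {linear Harr d n -> H_gen deg x d n}, bijective phi.
Proof.
case: n => [|p]; last first.
  apply: (@linear_relation_bij _ _ _ (@corresponds _ _ deg _ x d p)).
  - by move=> c v v' w w'; exact: corresponds_lin.
  - exact: corresponds_total.
  - exact: corresponds_total_r.
  - exact: corresponds0l.
  - exact: corresponds0r.
(* In degree 0 both complexes are zero: the sum over p is empty on one side, and the other term is
   zero by convention. *)
have H0 (X : Harr d 0) : X = 0.
  have [z ->] := coh_class_surj X; have [Tz _] := cocycleP z.
  apply/coh_class_eq0/asboolP; apply: bicochainP => p m a.
  by have := Tz p m; case: p => [|p]; case: m a => [|m] a //= ->.
have H0' (Y : H_gen deg x d 0) : Y = 0.
  by have [w ->] := coh_class_surj Y; have [Cw _] := cocycleP w; apply/coh_class_eq0/asboolP.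
by apply: (@linear_relation_bij _ _ _ (fun _ _ => True)) => // ?; exists 0.
Qed.
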